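(* Consider the saddle-point problem $$\min_{x\in Q_x}\max_{y\in Q_y}\{S(x,y):=r(x)+F(x,y)-h(y)\},$$ where $Q_x\subseteq\mathbb{R}^n$, $Q_y\subseteq\mathbb{R}^m$ are nonempty convex compact sets, $r:Q_x\to\mathbb{R}$ is $\mu_x$-strongly convex, $h:Q_y\to\mathbb{R}$ is $\mu_y$-strongly convex ($\mu_x,\mu_y>0$), and $F$ (not necessarily bilinear) is defined in a neighbourhood of $Q_x\times Q_y$, convex in $x$, concave in $y$, and satisfies for all $x,x'\in Q_x$, $y,y'\in Q_y$ $$\|\nabla_xF(x,y)-\nabla_xF(x',y)\|_2\le L_{xx}\|x-x'\|_2,\qquad \|\nabla_xF(x,y)-\nabla_xF(x,y')\|_2\le L_{xy}\|y-y'\|_2,$$ $$\|\nabla_yF(x,y)-\nabla_yF(x',y)\|_2\le L_{xy}\|x-x'\|_2,\qquad \|\nabla_yF(x,y)-\nabla_yF(x,y')\|_2\le L_{yy}\|y-y'\|_2$$ with $L_{xx},L_{xy},L_{yy}\ge 0$. Put $$N_1=\sqrt{\frac{L_{xx}+\frac{L_{xy}^2}{\mu_y}}{\mu_x}},\qquad N_2=N_1\sqrt{\max\left\{\frac{L_{yy}}{\mu_y},1\right\}},\qquad N_3=N_1\sqrt{\frac{L_y}{\mu_y}}.$$ Then the following hold. (2) If $r$ has $L_x$-Lipschitz gradient (but is not prox-friendly) and $h$ is prox-friendly, then an $\varepsilon$-solution can be reached with $\tilde O\left(\sqrt{L_x/\mu_x}\right)$ computations of $\nabla r(x)$, $\tilde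 O(N_1)$ computations of $\nabla_xF(x,y)$, and $\tilde O(N_2)$ computations of $\nabla_yF(x,y)$ and of the proximal problem for $h$. (3) If $h$ has $L_y$-Lipschitz gradient (but is not prox-friendly) and $r$ is prox-friendly, then an $\varepsilon$-solution can be reached with $\tilde O(N_1)$ computations of $\nabla_xF(x,y)$ and of the proximal problem for $r$, $\tilde O(N_3)$ computations of $\nabla h(y)$, and $\tilde O(N_2)$ computations of $\nabla_yF(x,y)$. (4) If $r$ has $L_x$-Lipschitz gradient and $h$ has $L_y$-Lipschitz gradient (and neither is prox-friendly), then an $\varepsilon$-solution can be reached with $\tilde O\left(\sqrt{L_x/\mu_x}\right)$ computations of $\nabla r(x)$, $\tilde O(N_1)$ computations of $\nabla_xF(x,y)$, $\tilde O(N_3)$ computations of $\nabla h(y)$, and $\tilde O(N_2)$ computations of $\nabla_yF(x,y)$.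
   Context: $\langle\cdot,\cdot\rangle$ is the standard scalar product and $\|\cdot\|_2$ the Euclidean norm. Prox-friendliness: $r$ is prox-friendly if every problem $\min_{x\in Q_x}\{\langle c_1,x\rangle+r(x)+c_2\|x\|_2^2\}$ with a vector $c_1$ and $c_2>0$ can be solved explicitly (this is ''the proximal problem for $r$''; solving one such problem is one computation). Similarly $h$ is prox-friendly if every problem $\min_{y\in Q_y}\{\langle c_1,y\rangle+h(y)+c_2\|y\|_2^2\}$ can be solved explicitly (''the proximal problem for $h$''). When a function is assumed not prox-friendly, this means only that its proximal problem is not available as an oracle and its gradient is used instead. Let $f(x)=r(x)+\max_{y\in Q_y}\{F(x,y)-h(y)\}$, let $x_*$ be the minimizer of $f$ on $Q_x$, and $y^*(x)=\arg\max_{y\in Q_y}\{F(x,y)-h(y)\}$. Let $(x^0,y^0)\in Q_x\times Q_y$ be the starting point of the method, $R_x=\|x^0-x_*\|_2$, $R_y=\|y^0-y^*(x_* )\|_2$. An $\varepsilon$-solution is a pair $(\hat x,\hat y)\in Q_x\times Q_y$ such that $$f(\hat x)-f(x_* )\le\max_{y\in Q_y\cap B_m(2R_y)}\{r(\hat x)+F(\hat x,y)-h(y)\}-\min_{x\in Q_x\cap B_n(2R_x)}\{r(x)+F(x,\hat y)-h(\hat y)\}\le\varepsilon,$$ where $B_n(2R_x)\subset\mathbb{R}^n$ and $B_m(2R_y)\subset\mathbb{R}^m$ are Euclidean balls of radii $2R_x$, $2R_y$ (centred at $x^0$ and $y^0$ respectively). ''Can be reached with ... computations'' means that there is an iterative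 method that, for every such problem and every $\varepsilon>0$, outputs an $\varepsilon$-solution and makes at most the indicated numbers of calls to the indicated oracles; only these calls are counted. $\tilde O(\cdot)$ means $O(\cdot)$ up to a small power (as a rule 1 or 2) of a factor that is logarithmic in $\varepsilon$, $\mu_x$ or $\mu_y$, and in $R_x$ or $R_y$.
   Formalization: Counts use max{1,N_1} in place of N_1, also inside N_2 and N_3 (literally no calls if L_xx=L_xy=0); the count is bounded only for R_y>0, where ln R_y is defined; the logarithmic factor also contains ln(1+the Lipschitz constants), to an unspecified fixed power. *)

(* Defs.v *)
From HB Require Import structures.
From mathcomp Require Import all_boot all_order all_algebra.
From mathcomp Require Import all_classical all_reals all_analysis.

Set Implicit Arguments.
Unset Strict Implicit.
Unset Printing Implicit Defensive.

Import Order.TTheory GRing.Theory Num.Theory.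
Import numFieldNormedType.Exports.

Local Open Scope classical_set_scope.
Local Open Scope ring_scope.

Section Euclidean.
Context {R : realType}.

Definition dot k (u v : 'rV[R]_k) : R := \sum_i u 0 i * v 0 i.

(* The library norm of ['rV[R]_k] is the sup norm, hence this definition; the
   topology (compactness, differentiability) is the same for both norms. *)
Definition enorm k (u : 'rV[R]_k) : R := Num.sqrt (dot u u).

Definition eball k (c : 'rV[R]_k) (rho : R) : set 'rV[R]_k :=
  [set u | enorm (u - c) <= rho].

Definition grad k (f : 'rV[R]_k -> R) (u : 'rV[R]_k) : 'rV[R]_k :=
  \row_i 'D_(delta_mx 0 i) f u.

Definition strongly_convex k (Q : set 'rV[R]_k) (mu : R)
    (f : 'rV[R]_k -> R) : Prop :=
  forall (u v : 'rV[R]_k) (t : R), Q u -> Q v -> 0 <= t -> t <= 1 ->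
    f (t *: u + (1 - t) *: v) <=
      t * f u + (1 - t) * f v - mu / 2 * (t * (1 - t)) * enorm (u - v) ^+ 2.

(* For a function known on [Q] only: [g] is a gradient of [f] relative to [Q]
   at every point of [Q], and it is [L]-Lipschitz on [Q].  A function that is
   differentiable around [Q] is covered by [g := grad f]; if [Q] has empty
   interior, [g] is one of several possible gradient fields. *)
Definition lipschitz_gradient k (Q : set 'rV[R]_k) (f : 'rV[R]_k -> R) (L : R)
    (g : 'rV[R]_k -> 'rV[R]_k) : Prop :=
  [/\ 0 <= L,
      forall u, Q u -> forall e : R, 0 < e ->
        \forall v \near within Q (nbhs u),
          `|f v - f u - dot (g u) (v - u)| <= e * enorm (v - u)
    & forall u v, Q u -> Q v -> enorm (g u - g v) <= L * enorm (u - v)].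

(* [P] solves every problem min_{u in Q} <c1,u> + f(u) + c2 ||u||^2, c2 > 0. *)
Definition solves_prox k (Q : set 'rV[R]_k) (f : 'rV[R]_k -> R)
    (P : 'rV[R]_k * R -> 'rV[R]_k) : Prop :=
  forall (c1 : 'rV[R]_k) (c2 : R), 0 < c2 ->
    let obj u := dot c1 u + f u + c2 * enorm u ^+ 2 in
    Q (P (c1, c2)) /\ forall u, Q u -> obj (P (c1, c2)) <= obj u.

(* How a method may access [r] (or [h]): through its proximal problem, or
   through a gradient with the given Lipschitz constant. *)
Inductive access := Prox | Grad of R.

Definition provides k (a : access) (Q : set 'rV[R]_k) (f : 'rV[R]_k -> R)
    (g : 'rV[R]_k -> 'rV[R]_k) (P : 'rV[R]_k * R -> 'rV[R]_k) : Prop :=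
  match a with
  | Prox => solves_prox Q f P
  | Grad L => lipschitz_gradient Q f L g
  end.

Definition access_const (a : access) : R := if a is Grad L then L else 0.

End Euclidean.

Inductive oracle := GradFx | GradFy | GradR | GradH | ProxR | ProxH.

Section Methods.
Context {R : realType} {n m : nat}.

Definition query (o : oracle) : Type :=
  match o with
  | GradFx | GradFy => ('rV[R]_n * 'rV[R]_m)%type
  | GradR => 'rV[R]_n
  | GradH => 'rV[R]_m
  | ProxR => ('rV[R]_n * R)%type
  | ProxH => ('rV[R]_m * R)%type
  end.

Definition answer (o : oracle) : Type :=
  match o with
  | GradFx | GradR | ProxR => 'rV[R]_n
  | GradFy | GradH | ProxH => 'rV[R]_m
  end.

(* A deterministic adaptive method: it either stops with a pair or calls an
   oracle and continues according to the answer.  Arithmetic and operations on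
   the known sets (such as projections) are free. *)
Inductive method : Type :=
  | Output of 'rV[R]_n & 'rV[R]_m
  | Call (o : oracle) of query o & (answer o -> method).

Definition oracles : Type := forall o : oracle, query o -> answer o.

Fixpoint run (O : oracles) (M : method) : 'rV[R]_n * 'rV[R]_m :=
  match M with
  | Output x y => (x, y)
  | Call o q k => run O (k (O o q))
  end.

Fixpoint calls (O : oracles) (o : oracle) (M : method) : nat :=
  match M with
  | Output _ _ => 0%N
  | Call o' q k => (`[< o' = o >] + calls O o (k (O o' q)))%N
  end.

End Methods.

Arguments query : clear implicits.
Arguments answer : clear implicits.
Arguments method : clear implicits.
Arguments oracles : clear implicits.

Section Saddle.
Context {R : realType} {n m : nat}.
Notation Vx := 'rV[R]_n.
Notation Vy := 'rV[R]_m.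

(* What a method knows in advance; [r], [F], [h], the solution and the
   distances from the starting point to the solution are not part of it. *)
Record data := Data {
  Qx : set Vx; Qy : set Vy;
  x0 : Vx; y0 : Vy;
  mux : R; muy : R;
  Lxx : R; Lxy : R; Lyy : R;
  eps : R }.

Record admissible_data (d : data) : Prop := {
  Qx_convex : convex_set (Qx d);
  Qy_convex : convex_set (Qy d);
  Qx_compact : compact (Qx d);
  Qy_compact : compact (Qy d);
  x0_in : Qx d (x0 d);
  y0_in : Qy d (y0 d);
  mux_gt0 : 0 < mux d;
  muy_gt0 : 0 < muy d;
  Lxx_ge0 : 0 <= Lxx d;
  Lxy_ge0 : 0 <= Lxy d;
  Lyy_ge0 : 0 <= Lyy d;
  eps_gt0 : 0 < eps d }.

Record admissible_functions (d : data)
    (r : Vx -> R) (F : Vx -> Vy -> R) (h : Vy -> R) : Prop := {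
  r_strongly_convex : strongly_convex (Qx d) (mux d) r;
  h_strongly_convex : strongly_convex (Qy d) (muy d) h;
  F_convex : forall y, Qy d y -> convex_function (Qx d) (F ^~ y);
  F_concave : forall x, Qx d x -> convex_function (Qy d) (fun y => - F x y);
  F_diff_x : forall x y, Qx d x -> Qy d y -> differentiable (F ^~ y) x;
  F_diff_y : forall x y, Qx d x -> Qy d y -> differentiable (F x) y;
  F_Lxx : forall x x' y, Qx d x -> Qx d x' -> Qy d y ->
    enorm (grad (F ^~ y) x - grad (F ^~ y) x') <= Lxx d * enorm (x - x');
  F_Lxy : forall x y y', Qx d x -> Qy d y -> Qy d y' ->
    enorm (grad (F ^~ y) x - grad (F ^~ y') x) <= Lxy d * enorm (y - y');
  F_Lyx : forall x x' y, Qx d x -> Qx d x' -> Qy d y ->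
    enorm (grad (F x) y - grad (F x') y) <= Lxy d * enorm (x - x');
  F_Lyy : forall x y y', Qx d x -> Qy d y -> Qy d y' ->
    enorm (grad (F x) y - grad (F x) y') <= Lyy d * enorm (y - y') }.

(* The answers to queries outside [Qx d] and [Qy d] are arbitrary, and so are
   those of the oracles that [ax] and [ay] do not make available. *)
Record implements (d : data) (ax ay : @access R) (r : Vx -> R)
    (F : Vx -> Vy -> R) (h : Vy -> R) (O : oracles R n m) : Prop := {
  GradFx_spec : forall x y, Qx d x -> Qy d y ->
    O GradFx (x, y) = grad (F ^~ y) x;
  GradFy_spec : forall x y, Qx d x -> Qy d y ->
    O GradFy (x, y) = grad (F x) y;
  r_spec : provides ax (Qx d) r (O GradR) (O ProxR);
  h_spec : provides ay (Qy d) h (O GradH) (O ProxH) }.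

Definition primal (d : data) (r : Vx -> R) (F : Vx -> Vy -> R) (h : Vy -> R)
    (x : Vx) : R :=
  r x + sup [set F x y - h y | y in Qy d].

Definition is_xstar d r F h (xs : Vx) : Prop :=
  Qx d xs /\ forall x, Qx d x -> primal d r F h xs <= primal d r F h x.

Definition is_ystar (d : data) (F : Vx -> Vy -> R) (h : Vy -> R)
    (x : Vx) (ys : Vy) : Prop :=
  Qy d ys /\ forall y, Qy d y -> F x y - h y <= F x ys - h ys.

Definition Rx (d : data) (xs : Vx) : R := enorm (x0 d - xs).

Definition Ry (d : data) (ys : Vy) : R := enorm (y0 d - ys).

Definition local_gap (d : data) (r : Vx -> R) (F : Vx -> Vy -> R) (h : Vy -> R)
    (xs : Vx) (ys : Vy) (x : Vx) (y : Vy) : R :=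
  sup [set r x + F x v - h v | v in Qy d `&` eball (y0 d) (2 * Ry d ys)] -
  inf [set r u + F u y - h y | u in Qx d `&` eball (x0 d) (2 * Rx d xs)].

Definition eps_solution d r F h (xs : Vx) (ys : Vy) (z : Vx * Vy) : Prop :=
  [/\ Qx d z.1, Qy d z.2,
      primal d r F h z.1 - primal d r F h xs
        <= local_gap d r F h xs ys z.1 z.2
    & local_gap d r F h xs ys z.1 z.2 <= eps d].

(* The factor hidden in O~.  The Lipschitz constants (those of F and, where
   they apply, of the gradients of r and h) are needed to form arguments such
   as [L * R ^+ 2 / eps] or [L / mu]. Recall that [ln 0 = 0] here. *)
Definition log_factor (d : data) (ax ay : @access R) (xs : Vx) (ys : Vy) : R :=
  1 + `|ln (eps d)| + `|ln (mux d)| + `|ln (muy d)|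
    + `|ln (Rx d xs)| + `|ln (Ry d ys)|
    + ln (1 + Lxx d + Lxy d + Lyy d + access_const ax + access_const ay).

(* One method, chosen from the known data only, works for all functions and all
   oracles.  As [Ry] tends to 0, the first inequality of [eps_solution] forces
   [x] to be so accurate that y^*(x) enters a vanishing ball; thus the factor
   [`|ln Ry|] is unbounded at [Ry = 0], where only correctness is claimed. *)
Definition reachable (C : R) (p : nat) (d : data) (ax ay : @access R)
    (N : oracle -> R) : Prop :=
  exists M : method R n m,
    forall (r : Vx -> R) (F : Vx -> Vy -> R) (h : Vy -> R) (O : oracles R n m)
           (xs : Vx) (ys : Vy),
      admissible_functions d r F h -> implements d ax ay r F h O ->
      is_xstar d r F h xs -> is_ystar d F h xs ys ->
      eps_solution d r F h xs ys (run O M) /\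
      (0 < Ry d ys -> forall o,
         (calls O o M)%:R <= C * N o * log_factor d ax ay xs ys ^+ p).

Definition N1 (d : data) : R :=
  Num.sqrt ((Lxx d + Lxy d ^+ 2 / muy d) / mux d).

Definition N2 (d : data) : R :=
  N1 d * Num.sqrt (Num.max (Lyy d / muy d) 1).

Definition N3 (d : data) (Ly : R) : R := N1 d * Num.sqrt (Ly / muy d).

(* N1, N2, N3 as numbers of calls.  N1 is a number of outer iterations and
   may be smaller than 1 (it is 0 if Lxx = Lxy = 0), while N2 and N3 are its
   products with the cost of one inner problem in [y]; so at least one outer
   iteration is counted.  Each count equals the corresponding N if N1 >= 1. *)
Definition count1 (d : data) : R := Num.max 1 (N1 d).

Definition count2 (d : data) : R :=
  Num.max (Num.sqrt (Num.max (Lyy d / muy d) 1)) (N2 d).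

Definition count3 (d : data) (Ly : R) : R :=
  Num.max (Num.sqrt (Ly / muy d)) (N3 d Ly).

End Saddle.

Arguments data : clear implicits.

(* Main.v *)
Require Import Defs.
From HB Require Import structures.
From mathcomp Require Import all_boot all_order all_algebra.
From mathcomp Require Import all_classical all_reals all_analysis.
From mathcomp Require Import ring lra.

Set Implicit Arguments.
Unset Strict Implicit.
Unset Printing Implicit Defensive.

Import Order.TTheory GRing.Theory Num.Theory.
Import numFieldNormedType.Exports.

Local Open Scope classical_set_scope.
Local Open Scope ring_scope.

(* The primal function is [r + psi] with [psi x = max_y (F x y - h y)], whose
   gradient [grad (F ^~ (ystar x)) x] has Lipschitz constant
   [Lpsi = Lxx + Lxy ^ 2 / muy].  It is minimized by an accelerated method whose
   gradients of [psi] come from solving the inner problem in [y] to high accuracy,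
   again by an accelerated method.  When [r] (or [h]) is only known through its
   gradient, sliding keeps the oracle counts separate: the smoother of the two
   summands is linearized in an outer accelerated loop, and each outer step solves
   its subproblem, which contains the other summand, by an inner accelerated loop.

   The distances [Rx] and [Ry] are unknown, so the solver runs in stages that
   assume [Rx, Ry <= expR T] and aim at accuracy [expR (- c T)] for a growing
   [T].  One proximal (or projected) gradient step in each variable gives explicit
   subgradients at the new pair, hence a duality gap bound that is valid whether or
   not the assumption was right.

   The lower bound on the localized gap is the delicate part.  It holds if [Ry]
   dominates the error of [x], which a stage detects once [expR T >= 1 / Ry].
   Since [Ry] may be 0, a step from [y0] is also made: if it returns [y0], then
   [y0] is an exact inner maximizer; otherwise its result [ya] is kept as the
   output in [y], and later stages refine [x] until the distance from [ya] to the
   solution dominates the error of [x]. *)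

(** * Euclidean geometry and first-order convexity *)

Section EuclideanSpace.
Context {R : realType} {k : nat}.
Implicit Types (u v w x y z c : 'rV[R]_k) (Q : set 'rV[R]_k).

(** Every magnitude is compared with a power of [expR T], so the estimates become linear
    inequalities between exponents, and most numerals in them are exponent bookkeeping with some
    slack. A composite solve costs a factor [T ^+ 2]; two of them are nested in a stage, and the
    number of stages is of order [T], whence the power 5 of the logarithmic factor.

    The perturbed output [ya] works because strong concavity adds [muy / 2 * ||ya - ys||^2] to the
    gap at [(x, ya)], while replacing the inner maximizer at [x] by [ys] loses at most
    [(Lxy * ||x - xs||)^2 / (2 * muy)]. The gain stays fixed while [x] is refined. Whether it
    dominates is decided by comparing [ya] with the certified [yh], which is observable although
    [ys] is not.

    A method is a well-founded tree chosen from the known data, so its searches need a bound on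
    their length that is known when they start. Compactness gives a radius [D] for this purpose
    only: it does not enter the counts, which end at a stage determined by the actual [Rx] and
    [Ry]. *)

Definition sqn u : R := dot u u.

Lemma dotC u v : dot u v = dot v u.
Proof. by apply: eq_bigr => i _; rewrite mulrC. Qed.

Lemma dotDl u v w : dot (u + v) w = dot u w + dot v w.
Proof. by rewrite -big_split; apply: eq_bigr => i _; rewrite mxE mulrDl. Qed.

Lemma dotZl (a : R) u v : dot (a *: u) v = a * dot u v.
Proof. by rewrite mulr_sumr; apply: eq_bigr => i _; rewrite mxE mulrA. Qed.

Lemma dotDr u v w : dot u (v + w) = dot u v + dot u w.
Proof. by rewrite dotC dotDl !(dotC u). Qed.

Lemma dotZr (a : R) u v : dot u (a *: v) = a * dot u v.
Proof. by rewrite dotC dotZl dotC. Qed.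

Lemma dotNl u v : dot (- u) v = - dot u v.
Proof. by rewrite -scaleN1r dotZl mulN1r. Qed.

Lemma dotNr u v : dot u (- v) = - dot u v.
Proof. by rewrite dotC dotNl dotC. Qed.

Lemma dotBl u v w : dot (u - v) w = dot u w - dot v w.
Proof. by rewrite dotDl dotNl. Qed.

Lemma dotBr u v w : dot u (v - w) = dot u v - dot u w.
Proof. by rewrite dotDr dotNr. Qed.

Lemma dot0l u : dot 0 u = 0.
Proof. by rewrite -(scale0r (0 : 'rV[R]_k)) dotZl mul0r. Qed.

Lemma dot0r u : dot u 0 = 0.
Proof. by rewrite dotC dot0l. Qed.

Definition dotE := (dotDl, dotDr, dotNl, dotNr, dotZl, dotZr).

Lemma sqn_ge0 u : 0 <= sqn u.
Proof. by apply: sumr_ge0 => i _; rewrite -expr2 sqr_ge0. Qed.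

Lemma enorm_ge0 u : 0 <= enorm u.
Proof. exact: sqrtr_ge0. Qed.

Lemma enorm_sqr u : enorm u ^+ 2 = sqn u.
Proof. by rewrite sqr_sqrtr // sqn_ge0. Qed.

Lemma sqn_eq0 u : sqn u = 0 -> u = 0.
Proof.
move=> /eqP; rewrite /sqn /dot psumr_eq0; last by move=> i _; rewrite -expr2 sqr_ge0.
move=> /allP u0; apply/rowP => i; rewrite mxE.
by have := u0 i (mem_index_enum _); rewrite /= mulf_eq0 orbb => /eqP.
Qed.

Lemma enorm_eq0 u : enorm u = 0 -> u = 0.
Proof. by move=> u0; apply: sqn_eq0; rewrite -enorm_sqr u0 expr0n. Qed.

Lemma enorm0 : enorm (0 : 'rV[R]_k) = 0.
Proof. by rewrite /enorm dot0l sqrtr0. Qed.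

Lemma enormN u : enorm (- u) = enorm u.
Proof. by rewrite /enorm dotNl dotNr opprK. Qed.

Lemma enormBC u v : enorm (u - v) = enorm (v - u).
Proof. by rewrite -enormN opprB. Qed.

Lemma enormZ (a : R) u : enorm (a *: u) = `|a| * enorm u.
Proof.
by rewrite /enorm dotZl dotZr mulrA -expr2 sqrtrM ?sqr_ge0 // sqrtr_sqr.
Qed.

Lemma sqnN u : sqn (- u) = sqn u.
Proof. by rewrite /sqn dotNl dotNr opprK. Qed.

Lemma sqnBC u v : sqn (u - v) = sqn (v - u).
Proof. by rewrite -sqnN opprB. Qed.

Lemma sqnZ (a : R) u : sqn (a *: u) = a ^+ 2 * sqn u.
Proof. by rewrite /sqn dotZl dotZr mulrA expr2. Qed.

Lemma sqn_le (r : R) u : 0 <= r -> (enorm u <= r) = (sqn u <= r ^+ 2).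
Proof.
by move=> r0; rewrite -enorm_sqr ler_sqr ?nnegrE ?enorm_ge0.
Qed.

Lemma cauchy_schwarz u v : dot u v <= enorm u * enorm v.
Proof.
have [->|v0] := eqVneq v 0; first by rewrite dot0r enorm0 mulr0.
have ev : 0 < enorm v.
  rewrite lt_neqAle enorm_ge0 andbT eq_sym; apply: contra v0 => /eqP.
  by move/enorm_eq0 => ->.
have [duv|duv] := lerP (dot u v) 0.
  by apply: (le_trans duv); rewrite mulr_ge0 ?enorm_ge0.
rewrite -ler_sqr ?nnegrE ?mulr_ge0 ?enorm_ge0 ?(ltW duv) //.
rewrite exprMn !enorm_sqr.
have sv : 0 < sqn v by rewrite -enorm_sqr exprn_gt0.
have := sqn_ge0 (sqn v *: u - dot u v *: v).
have -> : sqn (sqn v *: u - dot u v *: v) =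
   sqn v * (sqn u * sqn v - dot u v ^+ 2).
  by rewrite /sqn !dotE (dotC v u); ring.
by rewrite pmulr_rge0 // subr_ge0.
Qed.

Lemma cauchy_schwarz_abs u v : `|dot u v| <= enorm u * enorm v.
Proof.
by rewrite ler_norml cauchy_schwarz lerNl -dotNl -(enormN u) cauchy_schwarz.
Qed.

Lemma enormD u v : enorm (u + v) <= enorm u + enorm v.
Proof.
rewrite sqn_le ?addr_ge0 ?enorm_ge0 //.
have -> : sqn (u + v) = sqn u + 2 * dot u v + sqn v.
  by rewrite /sqn !dotE (dotC v u); ring.
by rewrite sqrrD !enorm_sqr; have := cauchy_schwarz u v; lra.
Qed.

Lemma enorm_tri w u v : enorm (u - v) <= enorm (u - w) + enorm (w - v).
Proof.
have -> : u - v = (u - w) + (w - v) by rewrite addrA subrK.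
exact: enormD.
Qed.

Lemma young u v (a : R) : 0 < a -> dot u v <= sqn u / a + a / 4 * sqn v.
Proof.
move=> a0; have := sqn_ge0 (a^-1 *: u - 2^-1 *: v).
have -> : sqn (a^-1 *: u - 2^-1 *: v) =
   (sqn u / a + a / 4 * sqn v - dot u v) / a.
  by rewrite /sqn !dotE (dotC v u); field; rewrite gt_eqF.
by rewrite pmulr_lge0 ?invr_gt0 // subr_ge0.
Qed.

Lemma sqn_conv (t : R) u v w :
  sqn (t *: u + (1 - t) *: v - w) =
  t * sqn (u - w) + (1 - t) * sqn (v - w) - t * (1 - t) * sqn (u - v).
Proof. by rewrite /sqn !dotE (dotC v u) (dotC w u) (dotC w v); ring. Qed.

Lemma convex_combine Q u v (t : R) : convex_set Q -> Q u -> Q v ->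
  0 <= t -> t <= 1 -> Q (t *: u + (1 - t) *: v).
Proof.
move=> cQ Qu Qv t0 t1.
have t01 : (Itv.spec (@Itv.num_sem R) (Itv.Real `[0%Z, 1%Z]) t).
  by apply/andP; split; [exact: ger0_real | rewrite /= in_itv /= t0 t1].
have := cQ u v (Itv.mk t01); rewrite !inE => /(_ Qu Qv).
by rewrite /conv /=.
Qed.

Lemma strongly_convex_of_convex_function Q (f : 'rV[R]_k -> R) :
  convex_function Q f -> strongly_convex Q 0 f.
Proof.
move=> cf u v t Qu Qv t0 t1; rewrite !mul0r subr0.
have t01 : (Itv.spec (@Itv.num_sem R) (Itv.Real `[0%Z, 1%Z]) t).
  by apply/andP; split; [exact: ger0_real | rewrite /= in_itv /= t0 t1].
have := cf (Itv.mk t01) u v; rewrite !inE => /(_ Qu Qv).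
by rewrite /conv /=.
Qed.

End EuclideanSpace.

Section FirstOrder.
Context {R : realType} {k : nat}.
Implicit Types (u v w x y z c : 'rV[R]_k) (Q : set 'rV[R]_k)
  (f g : 'rV[R]_k -> R) (df dg : 'rV[R]_k -> 'rV[R]_k).

(** The common consequence of the two kinds of gradient in use: relative gradients of [r] and [h],
    known on [Q] only, and gradients of [F], which is differentiable around [Q]. Expansion along
    segments of [Q] is all that first-order inequalities need. *)
Definition segment_gradient Q f df :=
  forall u v, Q u -> Q v -> forall e : R, 0 < e ->
    exists2 d : R, 0 < d & forall t, 0 < t -> t < d -> t <= 1 ->
      `|f (t *: v + (1 - t) *: u) - f u - t * dot (df u) (v - u)| <= e * t.

Lemma near_segment u v (P : set 'rV[R]_k) : nbhs u P ->
  exists2 d : R, 0 < d & forall t, 0 < t -> t < d -> P (t *: v + (1 - t) *: u).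
Proof.
move=> Pu.
have ct : (t *: (v - u) + u) @[t --> (0 : R)] --> u.
  rewrite -[X in _ --> X]add0r; apply: cvgD; last exact: cvg_cst.
  rewrite -(scale0r (v - u)); apply: cvgZr_tmp; exact: cvg_id.
have /nbhs_ballP [d /= d0 dP] : nbhs (0 : R) (fun t => P (t *: (v - u) + u)).
  exact: (ct _ Pu).
exists d => // t t0 td.
have -> : t *: v + (1 - t) *: u = t *: (v - u) + u.
  by apply/rowP => i; rewrite !mxE; ring.
by apply: dP; rewrite /ball /= sub0r normrN gtr0_norm.
Qed.

(** Stands in for limits: an inequality along a segment is divided by the step length, and the
    remainder is linear in a small parameter [e]. *)
Lemma scalar_limit (A C : R) :
  (forall e, 0 < e -> e <= 1 -> 0 <= A + e * C) -> 0 <= A.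
Proof.
move=> AC; rewrite leNgt; apply/negP => A0.
pose e := Num.min 1 (- A / (2 * (`|C| + 1))).
have C1 : 0 < `|C| + 1 by have := normr_ge0 C; lra.
have e0 : 0 < e.
  by rewrite lt_min ltr01 divr_gt0 ?oppr_gt0 // mulr_gt0.
have e1 : e <= 1 by rewrite ge_min lexx.
have := AC e e0 e1.
have : e * C <= e * (`|C| + 1).
  by rewrite ler_wpM2l ?(ltW e0) //; have := ler_norm C; lra.
have : e * (`|C| + 1) <= - A / 2.
  have -> : - A / 2 = (- A / (2 * (`|C| + 1))) * (`|C| + 1).
    by field; rewrite gt_eqF.
  by rewrite ler_wpM2r ?(ltW C1) // /e ge_min lexx orbT.
lra.
Qed.

Lemma segment_gradient_lipschitz Q f (L : R) df : convex_set Q ->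
  lipschitz_gradient Q f L df -> segment_gradient Q f df.
Proof.
move=> cQ [_ fd _] u v Qu Qv e e0.
pose e' := e / (enorm (v - u) + 1).
have n0 : 0 < enorm (v - u) + 1 by have := enorm_ge0 (v - u); lra.
have e'0 : 0 < e' by rewrite divr_gt0.
have /= /(near_segment v) [d d0 dP] := fd u Qu e' e'0.
exists d => // t t0 td t1.
have := dP t t0 td (convex_combine cQ Qv Qu (ltW t0) t1).
have -> : t *: v + (1 - t) *: u - u = t *: (v - u).
  by apply/rowP => i; rewrite !mxE; ring.
rewrite dotZr enormZ (gtr0_norm t0) => /le_trans; apply.
rewrite mulrCA (mulrC e) ler_wpM2l ?(ltW t0) //.
by rewrite /e' mulrAC ler_pdivrMr // ler_wpM2l ?(ltW e0) //; lra.
Qed.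

Lemma dot_grad f u v : differentiable f u -> dot (grad f u) v = 'd f u v.
Proof.
move=> fu; rewrite {2}(row_sum_delta v) linear_sum /=.
apply: eq_bigr => i _; rewrite linearZ /= !mxE -deriveE //.
by rewrite [RHS]/GRing.scale /= mulrC.
Qed.

Lemma segment_gradient_differentiable Q f :
  (forall u, Q u -> differentiable f u) -> segment_gradient Q f (grad f).
Proof.
move=> fd u v Qu Qv e e0.
have /derivable_nbhs /eqaddoP /(_ e e0) : derivable f u (v - u).
  exact: diff_derivable (fd u Qu).
move=> /nbhs_ballP [d /= d0 dP]; exists d => // t t0 td t1.
have := dP t; rewrite /ball /= sub0r normrN (gtr0_norm t0) => /(_ td).
rewrite !fctE /= deriveE; last exact: fd.
rewrite -dot_grad; last exact: fd.
have -> : t *: (v - u) + u = t *: v + (1 - t) *: u.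
  by apply/rowP => i; rewrite !mxE; ring.
by rewrite /GRing.scale /= opprD addrA.
Qed.

Lemma strongly_convex_first_order Q (mu : R) f df : 0 <= mu ->
  strongly_convex Q mu f -> segment_gradient Q f df ->
  forall u v, Q u -> Q v ->
    f u + dot (df u) (v - u) + mu / 2 * sqn (v - u) <= f v.
Proof.
move=> mu0 cf fd u v Qu Qv; rewrite -subr_ge0.
apply: (@scalar_limit _ (mu / 2 * sqn (v - u) + 1)) => e e0 e1.
have [d d0 dP] := fd u v Qu Qv e e0.
(* Below [d] the expansion of [f] holds; below [e] the quadratic remainder [mu / 2 * q * t] is of
   order [e], as [scalar_limit] wants. *)
pose t := Num.min (d / 2) e.
have t0 : 0 < t by rewrite lt_min e0 andbT divr_gt0.
have te : t <= e by rewrite ge_min lexx orbT.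
have td : t < d by rewrite (@le_lt_trans _ _ (d / 2)) ?ge_min ?lexx //; lra.
have t1 : t <= 1 by lra.
have := dP t t0 td t1; rewrite ler_norml => /andP [lo _].
have := cf v u t Qv Qu (ltW t0) t1; rewrite enorm_sqr.
have q0 := sqn_ge0 (v - u).
set D := dot _ _ in lo *; set q := sqn _ in q0 * => hi.
have H : 0 <= t * (f v - (f u + D + mu / 2 * q) + mu / 2 * q * t + e) by nra.
rewrite pmulr_rge0 // in H.
have : mu / 2 * q * t <= mu / 2 * q * e.
  by rewrite ler_wpM2l // mulr_ge0 // divr_ge0.
lra.
Qed.

Lemma strongly_convex_min Q (mu : R) f us : 0 <= mu -> convex_set Q ->
  strongly_convex Q mu f -> Q us -> (forall u, Q u -> f us <= f u) ->
  forall u, Q u -> f us + mu / 2 * sqn (u - us) <= f u.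
Proof.
move=> mu0 cQ cf Qus fmin u Qu; rewrite -subr_ge0.
apply: (@scalar_limit _ (mu / 2 * sqn (u - us))) => t t0 t1.
have := fmin _ (convex_combine cQ Qu Qus (ltW t0) t1).
have := cf u us t Qu Qus (ltW t0) t1; rewrite enorm_sqr.
set q := sqn _ => h1 h2.
rewrite -(pmulr_rge0 _ t0); nra.
Qed.

Lemma strongly_convexD Q (mu nu : R) f g :
  strongly_convex Q mu f -> strongly_convex Q nu g ->
  strongly_convex Q (mu + nu) (fun u => f u + g u).
Proof.
move=> cf cg u v t Qu Qv t0 t1.
by have := cf u v t Qu Qv t0 t1; have := cg u v t Qu Qv t0 t1; lra.
Qed.

Lemma strongly_convex_dot Q c : strongly_convex Q 0 (dot c).
Proof. by move=> u v t _ _ _ _; rewrite !dotE; lra. Qed.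

Lemma strongly_convex_sqn Q (s : R) w :
  strongly_convex Q s (fun u => s / 2 * sqn (u - w)).
Proof.
by move=> u v t _ _ _ _; rewrite sqn_conv enorm_sqr; lra.
Qed.

Lemma strongly_convex_affine Q (mu s : R) x f : convex_set Q -> Q x ->
  0 <= s -> s <= 1 -> strongly_convex Q mu f ->
  strongly_convex Q (s ^+ 2 * mu) (fun z => f (s *: z + (1 - s) *: x)).
Proof.
move=> cQ Qx s0 s1 cf u v t Qu Qv t0 t1.
have := cf _ _ t (convex_combine cQ Qu Qx s0 s1)
  (convex_combine cQ Qv Qx s0 s1) t0 t1.
have -> : t *: (s *: u + (1 - s) *: x) + (1 - t) *: (s *: v + (1 - s) *: x)
  = s *: (t *: u + (1 - t) *: v) + (1 - s) *: x.
  by apply/rowP => i; rewrite !mxE; ring.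
have -> : s *: u + (1 - s) *: x - (s *: v + (1 - s) *: x) = s *: (u - v).
  by apply/rowP => i; rewrite !mxE; ring.
by rewrite !enorm_sqr sqnZ; lra.
Qed.

(** Convexity and the descent inequality relative to [Q], for an arbitrary field [df]. In this form
    the notion covers the max-function [psi] and passes to sums, subsets and affine substitutions
    without any differentiation. *)
Definition smooth_on Q f df (L : R) :=
  forall u v, Q u -> Q v ->
    f u + dot (df u) (v - u) <= f v /\
    f v <= f u + dot (df u) (v - u) + L / 2 * sqn (v - u).

(* Bounding [f v] by its first-order model at [v] costs a factor 2 but needs no
   integration along the segment. *)
Lemma smooth_on_lipschitz Q f df (L : R) :
  (forall u v, Q u -> Q v -> f u + dot (df u) (v - u) <= f v) ->
  (forall u v, Q u -> Q v -> enorm (df u - df v) <= L * enorm (u - v)) ->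
  smooth_on Q f df (2 * L).
Proof.
move=> lo lip u v Qu Qv; split; first exact: lo.
have h1 := lo v u Qv Qu.
have h2 := cauchy_schwarz (df v - df u) (v - u).
have h3 : enorm (df v - df u) * enorm (v - u) <= L * sqn (v - u).
  by rewrite -enorm_sqr expr2 mulrA ler_wpM2r ?enorm_ge0 ?lip.
rewrite -(opprB v u) in h1.
move: h1 h2; rewrite dotNr dotBl; lra.
Qed.

Lemma smooth_onW Q f df (L L' : R) : L <= L' -> smooth_on Q f df L ->
  smooth_on Q f df L'.
Proof.
move=> LL sf u v Qu Qv; have [-> h] := sf u v Qu Qv; split => //.
have : L / 2 * sqn (v - u) <= L' / 2 * sqn (v - u).
  by rewrite ler_wpM2r ?sqn_ge0 //; lra.
lra.
Qed.

Lemma smooth_on_sub Q Q' f df (L : R) : Q' `<=` Q -> smooth_on Q f df L ->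
  smooth_on Q' f df L.
Proof. by move=> sQ sf u v /sQ Qu /sQ Qv; exact: sf. Qed.

(** Moves the strong convexity of [f] into an explicit quadratic, which sliding treats exactly; the
    rest is still convex, with no worse a constant. *)
Lemma smooth_on_shift Q f df (mu L : R) :
  (forall u v, Q u -> Q v ->
     f u + dot (df u) (v - u) + mu / 2 * sqn (v - u) <= f v) ->
  0 <= mu -> smooth_on Q f df L ->
  smooth_on Q (fun u => f u - mu / 2 * sqn u) (fun u => df u - mu *: u) L.
Proof.
move=> lo mu0 sf u v Qu Qv.
have [_] := sf u v Qu Qv; have := lo u v Qu Qv.
have -> : sqn v = sqn u + 2 * dot u (v - u) + sqn (v - u).
  by rewrite /sqn !dotE (dotC v u); ring.
rewrite dotBl dotZl; have := mulr_ge0 mu0 (sqn_ge0 (v - u)).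
by move=> *; split; lra.
Qed.

Lemma smooth_on_affine Q f df (L s : R) x : convex_set Q -> Q x ->
  0 <= s -> s <= 1 -> smooth_on Q f df L ->
  smooth_on Q (fun z => f (s *: z + (1 - s) *: x))
    (fun z => s *: df (s *: z + (1 - s) *: x)) (s ^+ 2 * L).
Proof.
move=> cQ Qx s0 s1 sf u v Qu Qv.
have := sf _ _ (convex_combine cQ Qu Qx s0 s1) (convex_combine cQ Qv Qx s0 s1).
have -> : s *: v + (1 - s) *: x - (s *: u + (1 - s) *: x) = s *: (v - u).
  by apply/rowP => i; rewrite !mxE; ring.
rewrite sqnZ dotZr dotZl => -[]; split; lra.
Qed.

Lemma smooth_on_convex Q f df (L : R) : convex_set Q -> smooth_on Q f df L ->
  strongly_convex Q 0 f.
Proof.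
move=> cQ sf u v t Qu Qv t0 t1; rewrite !mul0r subr0.
have Qw := convex_combine cQ Qu Qv t0 t1.
have [hu _] := sf _ _ Qw Qu; have [hv _] := sf _ _ Qw Qv.
have t1' : 0 <= 1 - t by rewrite subr_ge0.
have := ler_wpM2l t0 hu; have := ler_wpM2l t1' hv.
have : t * dot (df (t *: u + (1 - t) *: v)) (u - (t *: u + (1 - t) *: v))
  + (1 - t) * dot (df (t *: u + (1 - t) *: v)) (v - (t *: u + (1 - t) *: v)) = 0.
  by rewrite !dotE; ring.
lra.
Qed.

End FirstOrder.

(** * Minimizers on compact sets and clipping to balls *)

Section Minimizers.
Context {R : realType} {k : nat}.
Implicit Types (u v w x y z c : 'rV[R]_k) (Q : set 'rV[R]_k)
  (f g : 'rV[R]_k -> R) (df dg : 'rV[R]_k -> 'rV[R]_k).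

Lemma dot_continuous c : continuous (dot c).
Proof.
apply: continuous_big => [|i _ x]; first exact: add_continuous.
have cc : u 0 i @[u --> x] --> x 0 i by exact: (@coord_continuous R 1 k 0 i x).
exact: (cvgM (cvg_cst _) cc).
Qed.

Lemma sqn_continuous w : continuous (fun u => sqn (u - w)).
Proof.
apply: continuous_big => [|i _ x]; first exact: add_continuous.
have cc : (u - w) 0 i @[u --> x] --> (x - w) 0 i.
  have -> : (fun u => (u - w) 0 i) = (fun u => u 0 i - w 0 i).
    by apply/funext => u; rewrite !mxE.
  have -> : (x - w) 0 i = x 0 i - w 0 i by rewrite !mxE.
  exact: (cvgB (@coord_continuous R 1 k 0 i x) (cvg_cst _)).
exact: (cvgM cc cc).
Qed.

Lemma model_distance (x y a p q : R) :
  x + a <= y -> y <= x + a + p -> p <= q -> 0 <= q -> `|x - y| <= `|a| + q.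
Proof.
have := ler_norm a; have := ler_norm (- a); rewrite normrN => *.
by rewrite ler_norml; apply/andP; split; lra.
Qed.

Lemma smooth_on_continuous Q f df (L : R) : smooth_on Q f df L ->
  {within Q, continuous f}.
Proof.
move=> sf; apply/subspace_continuousP => u Qu.
apply/cvgrPdist_le => e e0.
pose h v := `|dot (df u) v - dot (df u) u| + `|L| / 2 * sqn (v - u).
have ch : h v @[v --> u] --> 0.
  have -> : (0 : R) = `|dot (df u) u - dot (df u) u| + `|L| / 2 * sqn (u - u).
    by rewrite !subrr normr0 /sqn dot0l mulr0 addr0.
  exact: (cvgD (cvg_norm (cvgB (@dot_continuous (df u) u) (cvg_cst _)))
    (cvgM (cvg_cst _) (@sqn_continuous u u))).
have /cvgrPdist_le /(_ e e0) := ch; rewrite /within /=.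
apply: filterS => v; rewrite sub0r normrN => he Qv; apply: le_trans he.
have [] := sf u v Qu Qv; rewrite dotBr => lo hi.
apply: le_trans (ler_norm _); apply: (model_distance lo hi).
  by rewrite ler_wpM2r ?sqn_ge0 //; have := ler_norm L; lra.
by rewrite mulr_ge0 ?sqn_ge0 ?divr_ge0.
Qed.

Lemma exists_minimizer Q f : Q !=set0 -> compact Q -> {within Q, continuous f} ->
  exists2 u, Q u & forall v, Q v -> f u <= f v.
Proof.
move=> Q0 cQ cf; have [u uQ umin] := compact_EVT_min Q0 cQ cf.
exists u; first by rewrite inE in uQ.
by move=> v Qv; apply: umin; rewrite inE.
Qed.

Lemma compact_bounded_dist Q x : compact Q ->
  exists D : R, forall u, Q u -> enorm (x - u) <= D.
Proof.
move=> cQ; have [Q0|/set0P/negP/negPn/eqP ->] := pselect (Q !=set0); last by exists 0.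
have [|u Qu umax] := @exists_minimizer Q (fun u => - sqn (u - x)) Q0 cQ.
  apply: continuous_subspaceT => u; exact: (cvgN (@sqn_continuous x u)).
exists (enorm (x - u)) => v Qv; rewrite sqn_le ?enorm_ge0 // enorm_sqr.
by rewrite sqnBC [leRHS]sqnBC -lerN2 umax.
Qed.

Lemma compact_clip Q x (r : R) : 0 <= r -> compact Q -> compact (Q `&` eball x r).
Proof.
move=> r0 cQ; apply: compact_closedI => //.
have -> : eball x r = (fun u => sqn (u - x)) @^-1` [set a | a <= r ^+ 2].
  by apply/seteqP; split => u /=; rewrite /eball /= sqn_le.
apply: closed_comp => [u _|]; [exact: (@sqn_continuous x u) | exact: closed_le].
Qed.

Lemma convex_clip Q x (r : R) : 0 <= r -> convex_set Q ->
  convex_set (Q `&` eball x r).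
Proof.
move=> r0 cQ u v t; rewrite !inE => -[Qu ur] [Qv vr].
split; first by have := cQ u v t; rewrite !inE; apply.
move: ur vr; rewrite /eball /= !sqn_le // => ur vr.
have t0 : 0 <= t%:num by [].
have t1 : 0 <= 1 - t%:num by rewrite subr_ge0.
have := sqn_conv t%:num u v x; rewrite /conv /= => ->.
have := mulr_ge0 (mulr_ge0 t0 t1) (sqn_ge0 (u - v)).
have := ler_wpM2l t0 ur; have := ler_wpM2l t1 vr; lra.
Qed.

End Minimizers.

(** * Oracle programs and the accelerated gradient method *)

Section Programs.
Context {R : realType} {n m : nat}.
Variable O : oracles R n m.

Definition cost := oracle -> nat.

(* Methods in continuation-passing style. *)
Definition prog (A : Type) := (A -> method R n m) -> method R n m.

Definition ret (A : Type) (a : A) : prog A := fun K => K a.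

Definition bind (A B : Type) (p : prog A) (q : A -> prog B) : prog B :=
  fun K => p (fun a => q a K).

Fixpoint iterate (A : Type) (N : nat) (q : A -> prog A) (a : A) : prog A :=
  if N is N'.+1 then bind (q a) (iterate N' q) else ret a.

(** With the oracles fixed a program is deterministic, so one result [a] and one exact count [e]
    serve all continuations [K]. Exact counts add up under [bind]; [P] and [c] only bound them. *)
Definition hoare (A : Type) (p : prog A) (P : A -> Prop) (c : cost) : Prop :=
  exists2 a, P a & exists2 e : cost, (forall o, e o <= c o)%N &
    forall K, run O (p K) = run O (K a) /\
      forall o, calls O o (p K) = (e o + calls O o (K a))%N.

Definition cost0 : cost := fun=> 0%N.
Definition cost1 (o' : oracle) : cost := fun o => `[< o' = o >] : nat.
Definition costD (c c' : cost) : cost := fun o => (c o + c' o)%N.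
Definition costM (N : nat) (c : cost) : cost := fun o => (N * c o)%N.

Lemma hoare_ret (A : Type) (a : A) (P : A -> Prop) (c : cost) :
  P a -> hoare (ret a) P c.
Proof. by move=> Pa; exists a => //; exists cost0. Qed.

Lemma hoare_bind (A B : Type) (p : prog A) (q : A -> prog B) P Q c c' :
  hoare p P c -> (forall a, P a -> hoare (q a) Q c') ->
  hoare (bind p q) Q (costD c c').
Proof.
move=> [a Pa [e ec ep]] /(_ a Pa) [b Qb [e1 ec1 ep1]].
exists b => //; exists (costD e e1) => [i|K]; first exact: leq_add.
have [r1 c1] := ep (fun a => q a K); have [r2 c2] := ep1 K.
by split=> [|i]; rewrite /bind ?r1 // c1 c2 addnA.
Qed.

Lemma hoare_weaken (A : Type) (p : prog A) (P P' : A -> Prop) (c c' : cost) :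
  hoare p P c -> (forall a, P a -> P' a) -> (forall o, c o <= c' o)%N ->
  hoare p P' c'.
Proof.
move=> [a Pa [e ec ep]] PP' cc'; exists a; first exact: PP'.
by exists e => // o; exact: leq_trans (ec o) (cc' o).
Qed.

Lemma hoare_call (o : oracle) (q : query R n m o) :
  hoare (Call (o := o) q) (fun a => a = @O o q) (cost1 o).
Proof. by exists (@O o q) => //; exists (cost1 o). Qed.

Lemma hoare_iterate (A : Type) (q : A -> prog A) (I : nat -> A -> Prop) c N a :
  (forall i a, I i a -> hoare (q a) (I i.+1) c) ->
  I 0 a -> hoare (iterate N q a) (I N) (costM N c).
Proof.
move=> Iq Ia.
suff gen i b : I i b -> hoare (iterate N q b) (I (N + i)%N) (costM N c).
  by rewrite -[X in I X]addn0; exact: gen.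
elim: N i b => [|N IH] i b Ib /=; first by apply: hoare_ret.
apply: hoare_weaken (hoare_bind (Iq i b Ib) (fun a => IH i.+1 a)) _ _.
  by move=> d; rewrite addnS.
by move=> o; rewrite /costD /costM mulSn.
Qed.

End Programs.

Section AcceleratedGradient.
Context {R : realType} {k : nat}.
Implicit Types (u v w x y z c : 'rV[R]_k) (Q : set 'rV[R]_k)
  (f g om : 'rV[R]_k -> R) (df dg : 'rV[R]_k -> 'rV[R]_k).

Definition prox_min Q om c z (tau : R) : set 'rV[R]_k := [set w | Q w /\
  forall u, Q u -> dot c w + om w + tau / 2 * sqn (w - z) <=
                   dot c u + om u + tau / 2 * sqn (u - z)].

Lemma prox_min_growth Q om (mu : R) c z tau w : 0 <= mu -> 0 <= tau ->
  convex_set Q -> strongly_convex Q mu om -> prox_min Q om c z tau w ->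
  forall u, Q u -> dot c w + om w + tau / 2 * sqn (w - z) +
      (mu + tau) / 2 * sqn (u - w) <= dot c u + om u + tau / 2 * sqn (u - z).
Proof.
move=> mu0 tau0 cQ com [Qw wmin].
have sc := strongly_convexD (strongly_convexD (@strongly_convex_dot _ _ Q c) com)
  (@strongly_convex_sqn _ _ Q tau z).
rewrite add0r in sc.
have := strongly_convex_min _ cQ sc Qw wmin; apply.
by rewrite addr_ge0.
Qed.

(** Since [xp - y = theta *: (zp - z)], the descent inequality from [y] to [xp] has remainder
    [L / 2 * theta ^+ 2 * sqn (zp - z)], which the proximal term weighted by [theta] absorbs when
    [L * theta <= tau]. The last summand is the effect of using [ge] instead of the gradient
    [dg y]. *)
Lemma accelerated_step Q g dg om (L mu theta tau : R) x z ge zp u :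
  let y := theta *: z + (1 - theta) *: x in
  let xp := theta *: zp + (1 - theta) *: x in
  0 <= theta -> theta <= 1 -> 0 <= mu -> 0 <= tau -> L * theta <= tau ->
  convex_set Q -> smooth_on Q g dg L -> strongly_convex Q mu om ->
  Q x -> Q z -> Q u -> prox_min Q om ge z tau zp ->
  g xp + om xp + theta * (mu + tau) / 2 * sqn (u - zp) <=
    (1 - theta) * (g x + om x) + theta * (g u + om u) +
    theta * tau / 2 * sqn (u - z) + theta * dot (ge - dg y) (u - zp).
Proof.
move=> y xp t0 t1 mu0 tau0 Lt cQ sg com Qx Qz Qu pm.
have Qzp : Q zp by case: pm.
have Qy : Q y by exact: convex_combine.
have Qxp : Q xp by exact: convex_combine.
have h1 := prox_min_growth mu0 tau0 cQ com pm Qu.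
have [_ h2] := sg y xp Qy Qxp.
have [h3 _] := sg y x Qy Qx.
have [h4 _] := sg y u Qy Qu.
have h5 := com zp x theta Qzp Qx t0 t1.
have h5' : om xp <= theta * om zp + (1 - theta) * om x.
  apply: le_trans h5 _; rewrite gerBl mulr_ge0 ?sqr_ge0 //.
  by rewrite mulr_ge0 ?divr_ge0 // mulr_ge0 ?subr_ge0.
have e1 : xp - y = theta *: (zp - z).
  by apply/rowP => i; rewrite !mxE; ring.
have e2 : theta * dot (dg y) (zp - z) =
   (1 - theta) * dot (dg y) (x - y) + theta * dot (dg y) (u - y)
     - theta * dot (dg y) (u - zp).
  by rewrite /y !dotE; ring.
rewrite e1 dotZr sqnZ e2 in h2.
have h6 : L / 2 * (theta ^+ 2 * sqn (zp - z)) <=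
          theta * (tau / 2 * sqn (zp - z)).
  have -> : L / 2 * (theta ^+ 2 * sqn (zp - z)) =
    L * theta * (theta / 2 * sqn (zp - z)) by ring.
  have -> : theta * (tau / 2 * sqn (zp - z)) =
    tau * (theta / 2 * sqn (zp - z)) by ring.
  by rewrite ler_wpM2r // mulr_ge0 ?sqn_ge0 // divr_ge0.
have h1' := ler_wpM2l t0 h1.
have t1' : 0 <= 1 - theta by rewrite subr_ge0.
have h3' := ler_wpM2l t1' h3.
have h4' := ler_wpM2l t0 h4.
have e3 : dot ge u = dot ge zp + dot ge (u - zp) by rewrite dotBr; ring.
rewrite e3 in h1'; rewrite dotBl.
move: h1' h2 h3' h4' h5' h6; lra.
Qed.

Context {n m : nat} (O : oracles R n m).
Variables (G : 'rV[R]_k -> prog (R := R) (n := n) (m := m) 'rV[R]_k)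
  (PX : 'rV[R]_k -> 'rV[R]_k -> R ->
        prog (R := R) (n := n) (m := m) 'rV[R]_k).

Definition agd_step (theta tau : R) (s : 'rV[R]_k * 'rV[R]_k) :
    prog (R := R) (n := n) (m := m) ('rV[R]_k * 'rV[R]_k) :=
  bind (G (theta *: s.2 + (1 - theta) *: s.1)) (fun ge =>
  bind (PX ge s.2 tau) (fun z =>
  ret (theta *: z + (1 - theta) *: s.1, z))).

(** The factor 1/2 gives [theta <= 1/2] and [L * theta ^+ 2 = mu / 4]. This leaves half of the
    strong convexity to absorb gradient errors and still lets the potential contract by
    [1 - theta]. *)
Definition agd_rate (L mu : R) : R := Num.sqrt (mu / L) / 2.

(** The opening step with [theta = 1] removes the function value at [x] from the analysis: only the
    distance from [x] to the minimizer enters the bound. *)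
Definition agd (L mu : R) (N : nat) x :
    prog (R := R) (n := n) (m := m) ('rV[R]_k * 'rV[R]_k) :=
  bind (agd_step 1 L (x, x))
    (iterate N (agd_step (agd_rate L mu) (L * agd_rate L mu))).

Lemma agd_rate_bounds (L mu : R) : 0 < mu -> mu <= L ->
  [/\ 0 < agd_rate L mu, agd_rate L mu <= 2^-1 &
      L * agd_rate L mu ^+ 2 = mu / 4].
Proof.
move=> mu0 muL; have L0 : 0 < L by lra.
have mL : 0 < mu / L by rewrite divr_gt0.
split; rewrite /agd_rate.
- by rewrite divr_gt0 // sqrtr_gt0.
- rewrite ler_pdivrMr // mulVf // -sqrtr1 ler_sqrt //.
  by rewrite ler_pdivrMr // mul1r.
- by rewrite exprMn sqr_sqrtr ?(ltW mL) //; field; rewrite gt_eqF.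
Qed.

(** A gradient error costs [theta * eta ^+ 2 / mu] per step against a contraction by [1 - theta], so
    all errors together stay within [eta ^+ 2 / mu]. Accuracy of the gradients is required only at
    squared distance at most [W] from the minimizer, because the potential bounds both sequences.
    This locality matters for [psi]: its gradient comes from an inner solve whose starting distance
    is controlled only near [xs]. *)
Lemma agd_correct Q g dg om (L mu eta rho2 W : R) us x (cG cP : cost) N :
  let theta := agd_rate L mu in
  let P0 := L / 2 * rho2 + eta ^+ 2 / mu in
  0 < mu -> mu <= L -> 0 <= eta -> convex_set Q ->
  smooth_on Q g dg L -> strongly_convex Q mu om ->
  Q us -> (forall u, Q u -> g us + om us <= g u + om u) ->
  Q x -> sqn (x - us) <= rho2 -> 8 / mu * (P0 + eta ^+ 2 / mu) <= W ->
  (forall y, Q y -> sqn (y - us) <= W ->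
     hoare O (G y) (fun ge => enorm (ge - dg y) <= eta) cG) ->
  (forall c z tau, Q z -> 0 < tau ->
     hoare O (PX c z tau) (prox_min Q om c z tau) cP) ->
  hoare O (agd L mu N x)
    (fun s => [/\ Q s.1, Q s.2 &
      g s.1 + om s.1 - (g us + om us) <= (1 - theta) ^+ N * P0 + eta ^+ 2 / mu])
    (costM N.+1 (costD cG cP)).
Proof.
move=> theta P0 mu0 muL eta0 cQ sg com Qus usmin Qx xus W8 HG HP.
have [t0 t1 Lt2] := agd_rate_bounds mu0 muL; rewrite -/theta in t0 t1 Lt2.
have L0 : 0 < L by lra.
have em0 : 0 <= eta ^+ 2 / mu by rewrite divr_ge0 ?sqr_ge0 // ltW.
set em := eta ^+ 2 / mu in em0 W8 *.
have r0 : 0 <= rho2 by exact: le_trans (sqn_ge0 _) xus.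
have Lr0 : 0 <= L / 2 * rho2 by rewrite mulr_ge0 // divr_ge0 // ltW.
have P00 : 0 <= P0 by rewrite addr_ge0.
pose E v := g v + om v - (g us + om us).
(* The weight is [theta * (mu / 2 + tau) / 2] with [tau = L * theta], the coefficient that one step
   leaves on the left; [mu / 2] instead of [mu] because Young's inequality spends the other half on
   the gradient error. *)
pose pot (s : 'rV[R]_k * 'rV[R]_k) :=
  E s.1 + (mu / 8 + theta * mu / 4) * sqn (s.2 - us).
have pc0 : 0 < mu / 8 + theta * mu / 4.
  by have := mulr_gt0 t0 mu0; lra.
have scg := smooth_on_convex cQ sg.
have Egrow v : Q v -> mu / 2 * sqn (v - us) <= E v.
  move=> Qv; have sc := strongly_convexD scg com; rewrite add0r in sc.
  by have := strongly_convex_min (ltW mu0) cQ sc Qus usmin Qv; rewrite /E; lra.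
have near_us v w : Q v -> Q w -> pot (v, w) <= P0 + em ->
  sqn (theta *: w + (1 - theta) *: v - us) <= W.
  move=> Qv Qw pvw; apply: le_trans W8.
  rewrite -mulrA [_ * (P0 + em)]mulrC mulrA ler_pdivlMr //.
  rewrite sqn_conv; have := Egrow v Qv; move: pvw; rewrite /pot /=.
  have := sqn_ge0 (v - us); have := sqn_ge0 (w - us); have := sqn_ge0 (w - v).
  set a := sqn (v - us); set b := sqn (w - us); set c := sqn (w - v).
  move=> c0 b0 a0 h1 h2.
  have h3 : 0 <= theta * mu * b by rewrite !mulr_ge0 // ltW.
  have h4 : 0 <= theta * (1 - theta) * c * mu.
    by rewrite !mulr_ge0 // ?(ltW t0) ?(ltW mu0) //; lra.
  have h5 : 0 <= mu * a by rewrite mulr_ge0 // ltW.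
  have h6 : 0 <= mu * b by rewrite mulr_ge0 // ltW.
  have h7 : theta * (mu * b) <= 1 * (mu * b) by rewrite ler_wpM2r //; lra.
  have h8 : (1 - theta) * (mu * a) <= 1 * (mu * a) by rewrite ler_wpM2r //; lra.
  lra.
have step (th tau : R) v w ge zp : 0 <= th -> th <= 1 -> 0 <= tau ->
    L * th <= tau -> Q v -> Q w ->
    enorm (ge - dg (th *: w + (1 - th) *: v)) <= eta ->
    prox_min Q om ge w tau zp ->
    E (th *: zp + (1 - th) *: v) + th * (mu / 2 + tau) / 2 * sqn (zp - us) <=
    (1 - th) * E v + th * tau / 2 * sqn (w - us) + th * em.
  move=> th0 th1 tau0 Lth Qv Qw eeta pm.
  have := accelerated_step th0 th1 (ltW mu0) tau0 Lth cQ sg com Qv Qw Qus pm.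
  have := young (ge - dg (th *: w + (1 - th) *: v)) (us - zp) mu0.
  have : sqn (ge - dg (th *: w + (1 - th) *: v)) / mu <= em.
    rewrite /em ler_wpM2r ?invr_ge0 ?(ltW mu0) //.
    by rewrite -sqn_le.
  rewrite (sqnBC us zp) (sqnBC us w) /E.
  set d := dot _ (us - zp); set s1 := sqn (ge - _) / mu.
  move=> h1 h2; have := ler_wpM2l th0 (le_trans h2 (lerD h1 (lexx _))).
  lra.
have thp : 0 <= 1 - theta by lra.
have th2 : theta * (L * theta) = mu / 4 by rewrite mulrCA -expr2.
pose I i (s : 'rV[R]_k * 'rV[R]_k) :=
  [/\ Q s.1, Q s.2 & pot s <= (1 - theta) ^+ i * P0 + em].
have Ibound i s : I i s -> pot s <= P0 + em.
  move=> [_ _ /le_trans]; apply; rewrite lerD2r ler_piMl //.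
  by apply: exprn_ile1; lra.
apply: (hoare_weaken (c := costD (costD cG (costD cP cost0))
   (costM N (costD cG (costD cP cost0))))).
- apply: (hoare_bind (P := I 0)).
    have h : hoare O (G (1 *: x + (1 - 1) *: x)) 
        (fun ge => enorm (ge - dg (1 *: x + (1 - 1) *: x)) <= eta) cG.
      apply: HG; first by apply: convex_combine.
      have -> : 1 *: x + (1 - 1) *: x = x.
        by apply/rowP => i; rewrite !mxE; ring.
      apply: le_trans xus _; apply: le_trans W8.
      rewrite /P0 -/em -mulrA [_ * (_ + em)]mulrC mulrA ler_pdivlMr //.
      have : rho2 * mu <= rho2 * L by rewrite ler_wpM2l.
      lra.
    apply: (hoare_bind h) => ge hge /=.
    apply: (hoare_bind (HP ge x L Qx L0)) => z pm; apply: hoare_ret.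
    have Qz : Q z by case: pm.
    split => //=; first by exact: convex_combine.
    have := step 1 L x x ge z ler01 (lexx _) (ltW L0).
    rewrite mulr1 => /(_ (lexx _) Qx Qx hge pm).
    rewrite /pot /= expr0 /P0 -/em !mul1r.
    have : (mu / 8 + theta * mu / 4) * sqn (z - us) <=
           (mu / 2 + L) / 2 * sqn (z - us).
      rewrite ler_wpM2r ?sqn_ge0 //.
      have : theta * mu <= 2^-1 * mu by rewrite ler_wpM2r // ltW.
      lra.
    have : L / 2 * sqn (x - us) <= L / 2 * rho2.
      by rewrite ler_wpM2l // divr_ge0 // ltW.
    lra.
  move=> s Is; apply: hoare_iterate Is => i [v w] Iv; have [/= Qv Qw pv] := Iv.
  have h := HG _ (convex_combine cQ Qw Qv (ltW t0) (_ : theta <= 1))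
    (near_us v w Qv Qw (Ibound _ _ Iv)).
  apply: (hoare_bind (h _)) => [|ge hge]; first by lra.
  have tau0 : 0 < L * theta by rewrite mulr_gt0.
  apply: (hoare_bind (HP ge w _ Qw tau0)) => z pm; apply: hoare_ret.
  have Qz : Q z by case: pm.
  have th1 : theta <= 1 by lra.
  split => //=; first exact: convex_combine (ltW t0) th1.
  have := step theta (L * theta) v w ge z (ltW t0) th1 (ltW tau0) (lexx _) Qv Qw hge pm.
  have -> : theta * (mu / 2 + L * theta) = theta * mu / 2 + mu / 4 by rewrite -th2; ring.
  rewrite th2 exprS.
  have := ler_wpM2l thp pv; rewrite /pot /=.
  have b0 := sqn_ge0 (w - us).
  (* This is where [theta <= 1/2] is used: it says that [mu / 8] is at most
     [(1 - theta) * (mu / 8 + theta * mu / 4)]. *)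
  have : 0 <= theta * mu * (2^-1 - theta) * sqn (w - us).
    by rewrite !mulr_ge0 // ?(ltW t0) ?(ltW mu0) //; lra.
  set r := _ ^+ i; set b := sqn (w - us); set e1 := sqn (z - us).
  lra.
- move=> s [Q1 Q2 ps]; split => //; apply: le_trans ps.
  by rewrite /pot lerDl mulr_ge0 ?sqn_ge0 // ltW.
- by move=> o; rewrite /costD /costM /cost0 !addn0 mulSn.
Qed.

End AcceleratedGradient.

(** * Gradient sliding *)

Section Sliding.
Context {R : realType} {k : nat}.
Implicit Types (u v w x y z c : 'rV[R]_k) (Q : set 'rV[R]_k)
  (f g p q om : 'rV[R]_k -> R) (df dg dp dq : 'rV[R]_k -> 'rV[R]_k).

Lemma smooth_onD Q f df (L : R) g dg (M : R) :
  smooth_on Q f df L -> smooth_on Q g dg M ->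
  smooth_on Q (fun u => f u + g u) (fun u => df u + dg u) (L + M).
Proof.
move=> sf sg u v Qu Qv; have := sf u v Qu Qv; have := sg u v Qu Qv.
by rewrite dotDl => -[? ?] [? ?]; split; lra.
Qed.

Lemma smooth_on_dot Q c : smooth_on Q (dot c) (fun=> c) 0.
Proof. by move=> u v _ _; rewrite dotBr; split; lra. Qed.

Lemma smooth_on_sqn Q (s : R) w : 0 <= s ->
  smooth_on Q (fun u => s / 2 * sqn (u - w)) (fun u => s *: (u - w)) s.
Proof.
move=> s0 u v _ _.
have -> : sqn (v - w) = sqn (u - w) + 2 * dot (u - w) (v - u) + sqn (v - u).
  by rewrite /sqn !dotE (dotC v u) (dotC w u) (dotC w v); ring.
rewrite dotZl; have := mulr_ge0 s0 (sqn_ge0 (v - u)).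
by move=> *; split; lra.
Qed.

Lemma prox_min_nonempty Q om dom (L : R) c z tau :
  Q !=set0 -> compact Q -> smooth_on Q om dom L -> 0 <= tau ->
  prox_min Q om c z tau (xget 0 (prox_min Q om c z tau)).
Proof.
move=> Q0 cQ som tau0.
have sm := smooth_onD (smooth_onD (@smooth_on_dot Q c) som)
  (@smooth_on_sqn Q tau z tau0).
have [w Qw wmin] := exists_minimizer Q0 cQ (smooth_on_continuous sm).
by apply: (@xgetPex _ 0 (prox_min Q om c z tau)); exists w.
Qed.

(** Writing [w - 0] gives both quadratics the one shape that [smooth_on_sqn] and
    [strongly_convex_sqn] handle. *)
Definition model c (mu : R) y (M : R) : 'rV[R]_k -> R :=
  fun w => dot c w + mu / 2 * sqn (w - 0) + M / 2 * sqn (w - y).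

Lemma smooth_on_model Q c (mu M : R) y : 0 <= mu -> 0 <= M ->
  smooth_on Q (model c mu y M)
    (fun w => c + mu *: (w - 0) + M *: (w - y)) (0 + mu + M).
Proof.
by move=> mu0 M0; apply: smooth_onD; [apply: smooth_onD; [exact: smooth_on_dot|]|];
  exact: smooth_on_sqn.
Qed.

Lemma strongly_convex_model Q c (mu M : R) y :
  strongly_convex Q (mu + M) (model c mu y M).
Proof.
rewrite -[mu]add0r; rewrite [in model _ _]add0r.
by apply: strongly_convexD; [apply: strongly_convexD; [exact: strongly_convex_dot|]|];
  exact: strongly_convex_sqn.
Qed.

(** Growth at [v] itself gives [nu / 2 * sqn (v - us) <= dl], hence [nu * enorm (v - us) <= r].
    Expanding [sqn (u - us)] around [v] then costs only the cross term, at most [D * r]. So an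
    approximate minimizer inherits quadratic growth up to an additive error. *)
Lemma inexact_minimizer Q (J : 'rV[R]_k -> R) us v (nu D r dl : R) :
  0 < nu -> 0 <= r ->
  (forall u, Q u -> J us + nu / 2 * sqn (u - us) <= J u) ->
  (forall u, Q u -> sqn (u - v) <= D ^+ 2) -> 0 <= D ->
  Q v -> J v <= J us + dl -> 2 * dl * nu <= r ^+ 2 ->
  forall u, Q u -> J v - dl - D * r + nu / 2 * sqn (u - v) <= J u.
Proof.
move=> nu0 r0 gr diam D0 Qv Jv dlr u Qu.
have h1 := gr u Qu; have h2 := gr v Qv.
have nr : nu * enorm (v - us) <= r.
  rewrite -ler_sqr ?nnegrE ?mulr_ge0 ?enorm_ge0 ?(ltW nu0) //.
  rewrite exprMn enorm_sqr; apply: le_trans dlr.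
  have : nu / 2 * sqn (v - us) <= dl by lra.
  move=> /(ler_wpM2l (ltW nu0)); lra.
have uD : enorm (u - v) <= D by rewrite sqn_le // diam.
have cs := cauchy_schwarz_abs (u - v) (v - us).
have : - D * r <= nu * dot (u - v) (v - us).
  have : nu * `|dot (u - v) (v - us)| <= D * r.
    apply: le_trans (ler_wpM2l (ltW nu0) cs) _.
    by rewrite mulrCA ler_pM ?enorm_ge0 ?mulr_ge0 ?enorm_ge0 ?(ltW nu0).
  have := ler_norm (- dot (u - v) (v - us)); rewrite normrN.
  move=> /(ler_wpM2l (ltW nu0)); lra.
have : sqn (u - us) = sqn (u - v) + 2 * dot (u - v) (v - us) + sqn (v - us).
  by rewrite /sqn !dotE (dotC v u) (dotC us u) (dotC us v); ring.
have := mulr_ge0 (ltW nu0) (sqn_ge0 (v - us)).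
move=> h3 e h4; rewrite e in h1; lra.
Qed.

(** The point [zh] mixes [x] into [z] so that the weight of [sqn (z - u)] already carries the
    contraction [1 - theta]. The price is a multiple of [sqn (x - u)], to be paid by the negative
    term that the strong convexity of [mu / 2 * sqn] leaves between [x] and [u]. *)
Lemma sliding_inequality Q p dp q dq (Lp Lq mu theta etap D err : R)
    x z gp zp u :
  let zh := theta *: x + (1 - theta) *: z in
  let y := theta *: zh + (1 - theta) *: x in
  let W := fun t => theta *: t + (1 - theta) *: x in
  let J := fun t => q (W t) + model gp mu y Lp (W t) in
  let Phi := fun t => p t + q t + mu / 2 * sqn t in
  0 <= theta -> theta <= 1 -> 0 < mu -> 0 <= Lp -> 0 <= etap -> 0 <= D ->
  convex_set Q -> smooth_on Q p dp Lp -> smooth_on Q q dq Lq ->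
  (forall u v, Q u -> Q v -> sqn (u - v) <= D ^+ 2) ->
  Q x -> Q z -> Q zp -> Q u -> enorm (gp - dp y) <= etap ->
  J zp - err + theta ^+ 2 * (mu + Lp) / 2 * sqn (u - zp) <= J u ->
  Phi (W zp) + Lp * theta ^+ 2 / 2 * sqn (zp - u) <=
    (1 - theta) * Phi x + theta * Phi u +
    Lp * theta ^+ 2 / 2 * (theta * sqn (x - u) + (1 - theta) * sqn (z - u))
    - mu / 2 * (theta * (1 - theta)) * sqn (x - u) + err + etap * D.
Proof.
move=> zh y W J Phi t0 t1 mu0 Lp0 eta0 D0 cQ sp sq diam Qx Qz Qzp Qu geta hJ.
have t1' : 0 <= 1 - theta by rewrite subr_ge0.
have Qzh : Q zh by exact: convex_combine.
have Qy : Q y by exact: convex_combine.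
have QW t : Q t -> Q (W t) by move=> Qt; exact: convex_combine.
have [_ h1] := sp y (W zp) Qy (QW _ Qzp).
have [/(ler_wpM2l t0) h2 _] := sp y u Qy Qu.
have [/(ler_wpM2l t1') h3 _] := sp y x Qy Qx.
have h4 := smooth_on_convex cQ sq Qu Qx t0 t1; rewrite !mul0r subr0 in h4.
have h5 := sqn_conv theta u x 0; rewrite !subr0 -/(W u) in h5.
have e1 : W u - y = theta *: (u - zh).
  by apply/rowP => i; rewrite !mxE; ring.
have h6 : sqn (u - zh) = theta * sqn (x - u) + (1 - theta) * sqn (z - u)
    - theta * (1 - theta) * sqn (x - z).
  by rewrite (sqnBC u zh) /zh sqn_conv.
have h7 : 0 <= theta * (1 - theta) * sqn (x - z) by rewrite !mulr_ge0 ?sqn_ge0.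
have h8 : theta * dot (gp - dp y) (u - zp) <= etap * D.
  have cs := cauchy_schwarz_abs (gp - dp y) (u - zp).
  have uD : enorm (u - zp) <= D by rewrite sqn_le // diam.
  have h : `|dot (gp - dp y) (u - zp)| <= etap * D.
    by apply: le_trans cs _; rewrite ler_pM ?enorm_ge0.
  have := ler_norm (dot (gp - dp y) (u - zp)) => /(ler_wpM2l t0).
  have : theta * `|dot (gp - dp y) (u - zp)| <= 1 * `|dot (gp - dp y) (u - zp)|.
    by rewrite ler_wpM2r.
  lra.
have e2 : theta * dot (gp - dp y) (u - zp) =
  dot gp (W u) - dot gp (W zp) - (theta * dot (dp y) (u - y)
    + (1 - theta) * dot (dp y) (x - y)) + dot (dp y) (W zp - y).
  by rewrite /W !dotE; ring.
move: hJ; rewrite /J /model e1 sqnZ !subr0 h6 (sqnBC u zp) => hJ.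
rewrite (sqnBC u x) in h5.
have h9 : 0 <= mu / 2 * theta ^+ 2 * sqn (zp - u).
  by rewrite !mulr_ge0 ?sqn_ge0 ?sqr_ge0 ?(ltW mu0).
have h10 : 0 <= Lp / 2 * theta ^+ 2 * (theta * (1 - theta) * sqn (x - z)).
  by rewrite !mulr_ge0 ?sqn_ge0 ?sqr_ge0.
rewrite e2 in h8; rewrite h5 in hJ; rewrite /Phi.
move: h1 h2 h3 h4 hJ h8 h9 h10.
set A1 := sqn (W zp - y); set A2 := dot (dp y) (W zp - y).
lra.
Qed.

End Sliding.

Section SlidingMethod.
Context {R : realType} {k n m : nat} (O : oracles R n m).
Implicit Types (u v w x y z c : 'rV[R]_k) (Q : set 'rV[R]_k)
  (f g p q om : 'rV[R]_k -> R) (df dg dp dq : 'rV[R]_k -> 'rV[R]_k).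
Notation progm := (prog (R := R) (n := n) (m := m)).
Variables (GP GQ : 'rV[R]_k -> progm 'rV[R]_k).

(** The subproblem is posed in [t], with the new point [W t] as its argument; the factor
    [theta ^+ 2] appears in both constants and cancels in the inner rate. [Lq] is doubled so that
    the modulus [mu + Lp] does not exceed the smoothness constant. The inner proximal problems
    contain known data only, so [xget] solves them without a call. *)
Definition sliding_step Q (mu Lp Lq theta : R) (N : nat)
    (s : 'rV[R]_k * 'rV[R]_k) : progm ('rV[R]_k * 'rV[R]_k) :=
  let: (x, z) := s in
  let y := theta *: (theta *: x + (1 - theta) *: z) + (1 - theta) *: x in
  let W := fun t => theta *: t + (1 - theta) *: x in
  bind (GP y) (fun gp =>
  bind (agd (fun t => bind (GQ (W t)) (fun ge => ret (theta *: ge)))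
     (fun c z tau =>
        ret (xget 0 (prox_min Q (fun t => model gp mu y Lp (W t)) c z tau)))
     (theta ^+ 2 * (2 * Lq)) (theta ^+ 2 * (mu + Lp)) N z)
  (fun s => ret (W s.1, s.1))).

Definition sliding Q (mu Lp Lq : R) (N1 N2 : nat) x :
    progm ('rV[R]_k * 'rV[R]_k) :=
  bind (sliding_step Q mu Lp Lq 1 N2 (x, x))
    (iterate N1 (sliding_step Q mu Lp Lq (agd_rate Lp mu) N2)).

Lemma agd_rate_scale (s L mu : R) : s != 0 ->
  agd_rate (s * L) (s * mu) = agd_rate L mu.
Proof. by move=> s0; rewrite /agd_rate -mulf_div divff // mul1r. Qed.

Lemma sliding_step_correct Q p dp q dq (Lp Lq mu theta etap etaq D r : R)
    x z (cp cq : cost) N :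
  let ti := agd_rate (2 * Lq) (mu + Lp) in
  let dl := (1 - ti) ^+ N * (Lq * D ^+ 2 + etaq ^+ 2 / mu) + etaq ^+ 2 / mu in
  let Phi := fun t => p t + q t + mu / 2 * sqn t in
  0 < theta -> theta <= 1 ->
  0 < mu -> mu <= Lp -> Lp <= Lq -> 0 <= etap -> 0 <= etaq -> 0 <= D -> 0 <= r ->
  convex_set Q -> compact Q -> smooth_on Q p dp Lp -> smooth_on Q q dq Lq ->
  (forall u v, Q u -> Q v -> sqn (u - v) <= D ^+ 2) ->
  Q x -> Q z ->
  (forall y, Q y -> hoare O (GP y) (fun ge => enorm (ge - dp y) <= etap) cp) ->
  (forall y, Q y -> hoare O (GQ y) (fun ge => enorm (ge - dq y) <= etaq) cq) ->
  2 * dl * (mu + Lp) <= r ^+ 2 ->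
  hoare O (sliding_step Q mu Lp Lq theta N (x, z))
    (fun s => [/\ Q s.1, Q s.2 & forall u, Q u ->
       Phi s.1 + Lp * theta ^+ 2 / 2 * sqn (s.2 - u) <=
       (1 - theta) * Phi x + theta * Phi u +
       Lp * theta ^+ 2 / 2 * (theta * sqn (x - u) + (1 - theta) * sqn (z - u))
       - mu / 2 * (theta * (1 - theta)) * sqn (x - u)
       + (dl + D * r + etap * D)])
    (costD cp (costM N.+1 cq)).
Proof.
move=> ti dl Phi t0 t1 mu0 muLp LpLq etap0 etaq0 D0 r0 cQ kQ sp sq diam Qx Qz
  hP hQ dlr.
set zh := theta *: x + (1 - theta) *: z.
set y := theta *: zh + (1 - theta) *: x.
set W := fun t => theta *: t + (1 - theta) *: x.
have th2 : 0 < theta ^+ 2 by rewrite exprn_gt0.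
have Qzh : Q zh by exact: convex_combine (ltW t0) t1.
have Qy : Q y by exact: convex_combine (ltW t0) t1.
have QW t : Q t -> Q (W t) by move=> Qt; exact: convex_combine (ltW t0) t1.
have Q0 : Q !=set0 by exists x.
have Lp0 : 0 < Lp by lra.
have Lq0 : 0 < Lq by lra.
apply: (hoare_weaken (c := costD cp (costD (costM N.+1
   (costD (costD cq cost0) cost0)) cost0))); last first.
- by move=> o; rewrite /costD /costM /cost0 !addn0.
- by move=> s; exact.
apply: (hoare_bind (hP y Qy)) => gp hgp.
set om := fun t => model gp mu y Lp (W t).
have som : smooth_on Q om (fun t => theta *: (gp + mu *: (W t - 0) + Lp *: (W t - y)))
    (theta ^+ 2 * (0 + mu + Lp)).
  exact: (smooth_on_affine cQ Qx (ltW t0) t1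
    (@smooth_on_model R k Q gp mu Lp y (ltW mu0) (ltW Lp0))).
have com : strongly_convex Q (theta ^+ 2 * (mu + Lp)) om.
  exact: (strongly_convex_affine cQ Qx (ltW t0) t1
    (@strongly_convex_model R k Q gp mu Lp y)).
have sg : smooth_on Q (fun t => q (W t)) (fun t => theta *: dq (W t))
    (theta ^+ 2 * (2 * Lq)).
  apply: (smooth_on_affine cQ Qx (ltW t0) t1 (smooth_onW _ sq)); lra.
have mu'0 : 0 < theta ^+ 2 * (mu + Lp) by rewrite mulr_gt0 //; lra.
have [us Qus usmin] := exists_minimizer Q0 kQ
   (smooth_on_continuous (smooth_onD sg som)).
have grow : forall u, Q u -> (q (W us) + om us) +
    (theta ^+ 2 * (mu + Lp)) / 2 * sqn (u - us) <= q (W u) + om u.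
  have scJ := strongly_convexD (smooth_on_convex cQ sg) com.
  rewrite add0r in scJ.
  exact: strongly_convex_min (ltW mu'0) cQ scJ Qus usmin.
have eW : 0 <= theta * etaq by rewrite mulr_ge0 // ltW.
have hG t : Q t -> hoare O (bind (GQ (W t)) (fun ge => ret (theta *: ge)))
    (fun ge => enorm (ge - theta *: dq (W t)) <= theta * etaq) (costD cq cost0).
  move=> Qt; apply: (hoare_bind (hQ _ (QW t Qt))) => ge hg; apply: hoare_ret.
  by rewrite -scalerBr enormZ gtr0_norm // ler_wpM2l // ltW.
have := @agd_correct R k n m O _ _ Q _ _ om (theta ^+ 2 * (2 * Lq))
  (theta ^+ 2 * (mu + Lp)) (theta * etaq) (D ^+ 2) _ us z (costD cq cost0) cost0 N
  mu'0 _ eW cQ sg com Qus usmin Qz (diam _ _ Qz Qus) (lexx _)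
  (fun t Qt _ => hG t Qt)
  (fun c z tau Qz tau0 => hoare_ret O cost0
     (prox_min_nonempty c z Q0 kQ som (ltW tau0))).
rewrite agd_rate_scale ?gt_eqF // -/ti.
have LL : theta ^+ 2 * (mu + Lp) <= theta ^+ 2 * (2 * Lq).
  by rewrite ler_wpM2l ?(ltW th2) //; lra.
move=> /(_ LL) hA; apply: (hoare_bind hA) => {hA} s [Q1 Q2 hs].
apply: hoare_ret; split => //=; first exact: QW.
move=> u Qu.
have [ti0 ti1 _] : [/\ 0 < ti, ti <= 2^-1 & 2 * Lq * ti ^+ 2 = (mu + Lp) / 4].
  by apply: agd_rate_bounds; lra.
have h2 : (theta * etaq) ^+ 2 / (theta ^+ 2 * (mu + Lp)) <= etaq ^+ 2 / mu.
  rewrite exprMn -mulf_div divff ?gt_eqF // mul1r.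
  by rewrite ler_wpM2l ?sqr_ge0 // lef_pV2 ?posrE //; lra.
have h3 : (q (W s.1) + om s.1) <= (q (W us) + om us) + dl.
  have h4 : theta ^+ 2 * (2 * Lq) / 2 * D ^+ 2 <= Lq * D ^+ 2.
    rewrite ler_wpM2r ?sqr_ge0 //.
    have : theta ^+ 2 * Lq <= 1 * Lq by rewrite ler_wpM2r ?(ltW Lq0) // expr_le1 // ltW.
    lra.
  have h5 : 0 <= (1 - ti) ^+ N by rewrite exprn_ge0 //; lra.
  have := ler_wpM2l h5 (lerD h4 h2).
  move: hs; rewrite /dl; lra.
have nr : 2 * dl * (theta ^+ 2 * (mu + Lp)) <= r ^+ 2.
  have [d0|d0] := lerP dl 0.
    apply: le_trans (sqr_ge0 r); rewrite -mulrA pmulr_rle0 //.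
    by rewrite mulr_le0_ge0 // ltW.
  apply: le_trans dlr; rewrite ler_wpM2l ?mulr_ge0 ?(ltW d0) //.
  by rewrite ler_piMl ?expr_le1 //; lra.
have hJ := inexact_minimizer mu'0 r0 grow
  (fun v Qv => diam v s.1 Qv Q1) D0 Q1 h3 nr Qu.
have := @sliding_inequality R k Q p dp q dq Lp Lq mu theta etap D (dl + D * r) x z gp
  s.1 u (ltW t0) t1 mu0 (ltW Lp0) etap0 D0 cQ sp sq diam Qx Qz Q1 Qu hgp.
rewrite /= -/zh -/y => hS.
have := hS _; rewrite -/(W u) -/(W s.1) /Phi => H.
rewrite addrA; apply: H.
by move: hJ; rewrite /om; lra.
Qed.

(** An outer step adds a fixed error [err] and contracts by [1 - theta], so the geometric series
    gives [err / theta]. *)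
Lemma sliding_correct Q p dp q dq (Lp Lq mu etap etaq D r : R)
    us x (cp cq : cost) N1 N2 :
  let theta := agd_rate Lp mu in
  let ti := agd_rate (2 * Lq) (mu + Lp) in
  let dl := (1 - ti) ^+ N2 * (Lq * D ^+ 2 + etaq ^+ 2 / mu) + etaq ^+ 2 / mu in
  let Phi := fun t => p t + q t + mu / 2 * sqn t in
  0 < mu -> mu <= Lp -> Lp <= Lq -> 0 <= etap -> 0 <= etaq -> 0 <= D -> 0 <= r ->
  convex_set Q -> compact Q -> smooth_on Q p dp Lp -> smooth_on Q q dq Lq ->
  (forall u v, Q u -> Q v -> sqn (u - v) <= D ^+ 2) ->
  Q us -> (forall u, Q u -> Phi us <= Phi u) -> Q x ->
  (forall y, Q y -> hoare O (GP y) (fun ge => enorm (ge - dp y) <= etap) cp) ->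
  (forall y, Q y -> hoare O (GQ y) (fun ge => enorm (ge - dq y) <= etaq) cq) ->
  2 * dl * (mu + Lp) <= r ^+ 2 ->
  hoare O (sliding Q mu Lp Lq N1 N2 x)
    (fun s => Q s.1 /\ Phi s.1 - Phi us <=
       (1 - theta) ^+ N1 * (Lp / 2 * D ^+ 2) + (dl + D * r + etap * D) / theta)
    (costM N1.+1 (costD cp (costM N2.+1 cq))).
Proof.
move=> theta ti dl Phi mu0 muLp LpLq etap0 etaq0 D0 r0 cQ kQ sp sq diam Qus
  usmin Qx hP hQ dlr.
have [t0 t1 Lt2] := agd_rate_bounds mu0 muLp; rewrite -/theta in t0 t1 Lt2.
have Lp0 : 0 < Lp by lra.
have stepc th x' z' th0 th1 Qx' Qz' := @sliding_step_correct Q p dp q dq Lp Lq mu th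
  etap etaq D r x' z' cp cq N2 th0 th1 mu0 muLp LpLq etap0 etaq0 D0 r0 cQ kQ sp sq
  diam Qx' Qz' hP hQ dlr.
rewrite /= -/ti -/dl -/Phi in stepc.
set err := dl + D * r + etap * D in stepc *.
have err0 : 0 <= err.
  have ti' : 0 <= 1 - ti.
    have [_ + _] : [/\ 0 < ti, ti <= 2^-1 & 2 * Lq * ti ^+ 2 = (mu + Lp) / 4].
      by apply: agd_rate_bounds; lra.
    lra.
  have e0 : 0 <= etaq ^+ 2 / mu by rewrite divr_ge0 ?sqr_ge0 // ltW.
  have Lq0 : 0 <= Lq by lra.
  rewrite /err /dl; have := mulr_ge0 D0 r0; have := mulr_ge0 etap0 D0.
  have := mulr_ge0 (exprn_ge0 N2 ti')
     (addr_ge0 (mulr_ge0 Lq0 (sqr_ge0 D)) e0).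
  lra.
pose pot (s : 'rV[R]_k * 'rV[R]_k) :=
  Phi s.1 - Phi us + mu / 8 * sqn (s.2 - us).
have e8 : Lp * theta ^+ 2 / 2 = mu / 8 by rewrite Lt2; lra.
pose I i (s : 'rV[R]_k * 'rV[R]_k) := [/\ Q s.1, Q s.2 &
  pot s <= (1 - theta) ^+ i * (Lp / 2 * D ^+ 2) + err / theta].
have ee : theta * (err / theta) = err by rewrite mulrC divfK // gt_eqF.
have errt : err <= err / theta.
  by rewrite ler_pdivlMr // ler_piMr //; lra.
apply: (hoare_weaken (c := costD (costD cp (costM N2.+1 cq))
   (costM N1 (costD cp (costM N2.+1 cq))))).
- apply: (hoare_bind (P := I 0)).
    apply: hoare_weaken (stepc 1 x x ltr01 (lexx _) Qx Qx) _ _ => [s|o] //.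
    move=> [Q1 Q2 /(_ us Qus) hs]; split => //; move: hs.
    rewrite expr1n mulr1 !subrr !mul0r !mulr0 mul0r subr0 addr0 !add0r !mul1r /pot.
    have : Lp / 2 * sqn (x - us) <= Lp / 2 * D ^+ 2.
      by rewrite ler_wpM2l ?diam //; lra.
    have : mu / 8 * sqn (s.2 - us) <= Lp / 2 * sqn (s.2 - us).
      by rewrite ler_wpM2r ?sqn_ge0 //; lra.
    rewrite /Phi; lra.
  move=> s Is; apply: hoare_iterate Is => i [v w] [/= Qv Qw pv].
  have th1 : theta <= 1 by lra.
  apply: hoare_weaken (stepc theta v w t0 th1 Qv Qw) _ _ => [s'|o] //.
  move=> [Q1 Q2 /(_ us Qus) hs]; split => //; move: hs; rewrite e8 /pot exprS => hs.
  have thp : 0 <= 1 - theta by lra.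
  have := ler_wpM2l thp pv; rewrite /pot /=.
  (* The surplus of the strong convexity term [mu / 2 * theta * (1 - theta)] over [theta * mu / 8],
     the price of mixing [x] into [zh]. *)
  have : 0 <= mu * theta * (3 / 8 - theta / 2) * sqn (v - us).
    by rewrite !mulr_ge0 ?sqn_ge0 ?(ltW mu0) ?(ltW t0) //; lra.
  set rr := _ ^+ i; set er := err / theta in ee *.
  move: hs; rewrite /Phi; lra.
- move=> s [Q1 Q2 ps]; split => //; apply: le_trans ps.
  by rewrite /pot lerDl mulr_ge0 ?sqn_ge0 //; lra.
- by move=> o; rewrite /costD /costM mulSn.
Qed.

End SlidingMethod.

(** * Exponential scale and iteration counts *)

Section Scale.
Context {R : realType}.
Implicit Types (T a b c x y e : R).

(** Products add exponents, and a sum of two terms costs one unit of exponent because [T >= 1] gives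
    [expR T >= 2]. Estimates are thereby left to [lra] on exponents. *)
Definition pw T a : R := expR (a * T).

Lemma pw_gt0 T a : 0 < pw T a. Proof. exact: expR_gt0. Qed.

Lemma pw_ge0 T a : 0 <= pw T a. Proof. exact: expR_ge0. Qed.

Lemma pwD T a b : pw T (a + b) = pw T a * pw T b.
Proof. by rewrite /pw mulrDl expRD. Qed.

Lemma pw0 T : pw T 0 = 1. Proof. by rewrite /pw mul0r expR0. Qed.

Lemma pwN T a : pw T (- a) = (pw T a)^-1.
Proof. by rewrite /pw mulNr expRN. Qed.

Lemma pw_mono T a b : 1 <= T -> a <= b -> pw T a <= pw T b.
Proof. by move=> T1 ab; rewrite /pw ler_expR ler_wpM2r //; lra. Qed.

Lemma pw_ge2 T : 1 <= T -> 2 <= pw T 1.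
Proof. by move=> T1; have := expR_ge1Dx T; rewrite /pw mul1r; lra. Qed.

Lemma pw_trans T a b x : 1 <= T -> x <= pw T a -> a <= b -> x <= pw T b.
Proof. by move=> T1 xa ab; exact: le_trans xa (pw_mono T1 ab). Qed.

Lemma pw_add T a x y : 1 <= T -> x <= pw T a -> y <= pw T a ->
  x + y <= pw T (a + 1).
Proof.
move=> T1 xa ya; rewrite pwD.
have := pw_ge2 T1 => /(ler_wpM2l (pw_ge0 T a)); lra.
Qed.

Lemma pw_mul T a b x y : 0 <= x -> x <= pw T a -> 0 <= y -> y <= pw T b ->
  x * y <= pw T (a + b).
Proof. by move=> x0 xa y0 yb; rewrite pwD ler_pM. Qed.

Lemma pw_nat T (n : nat) : 1 <= T -> 2 ^+ n <= pw T n%:R.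
Proof.
move=> T1; elim: n => [|n IH]; first by rewrite expr0 pw0.
rewrite exprS -(nat1r n) pwD.
by rewrite ler_pM ?exprn_ge0 ?pw_ge2.
Qed.

Lemma pw_sqr T a x : 0 <= x -> x <= pw T a -> x ^+ 2 <= pw T (a + a).
Proof. by move=> x0 xa; rewrite expr2 pw_mul. Qed.

Lemma pw_inv T a x : pw T a <= x -> x^-1 <= pw T (- a).
Proof.
move=> xa; rewrite pwN lef_pV2 ?posrE ?pw_gt0 //.
exact: lt_le_trans (pw_gt0 T a) xa.
Qed.

Lemma sqrt_pw T a x : 0 <= x -> x ^+ 2 <= pw T (a + a) -> x <= pw T a.
Proof.
by move=> x0; rewrite pwD -expr2 ler_sqr ?nnegrE ?pw_ge0.
Qed.

Definition iters (theta e T : R) : nat := (Num.truncn (e * T / theta)).+1.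

Lemma iters_decay (theta e T : R) : 0 < theta -> theta <= 1 -> 0 <= e -> 1 <= T ->
  (1 - theta) ^+ iters theta e T <= pw T (- e).
Proof.
move=> t0 t1 e0 T1; rewrite /pw mulNr.
apply: (@le_trans _ _ (expR (- theta) ^+ iters theta e T)).
  rewrite lerXn2r ?nnegrE ?expR_ge0 ?subr_ge0 //.
  by have := expR_ge1Dx (- theta).
rewrite -expRM_natl ler_expR mulrN lerN2 -ler_pdivrMr //.
by rewrite ltW // truncnS_gt.
Qed.

Lemma iters_bound (theta e T q : R) : 0 < theta -> 1 <= e -> 1 <= T -> 1 <= q ->
  theta^-1 <= 2 * q -> ((iters theta e T).+1)%:R <= 4 * e * T * q.
Proof.
move=> t0 e1 T1 q1 tq; rewrite /iters.
have eT : 1 <= e * T by rewrite -[1]mulr1 ler_pM.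
have x0 : 0 <= e * T / theta by rewrite divr_ge0 // ?(ltW t0) //; lra.
have /andP [h _] := truncn_itv x0.
have h2 : e * T / theta <= e * T * (2 * q) by rewrite ler_wpM2l //; lra.
have h3 : 1 <= e * T * q by rewrite -[1]mulr1 ler_pM.
rewrite -addn2 natrD; lra.
Qed.

Lemma agd_rate_inv (L mu : R) : 0 < mu -> mu <= L ->
  (agd_rate L mu)^-1 = 2 * Num.sqrt (L / mu).
Proof.
move=> mu0 muL; rewrite /agd_rate invf_div -sqrtrV ?invf_div //.
by rewrite ltW // divr_gt0 //; lra.
Qed.

Lemma sqrt_ratio_ge1 (L mu : R) : 0 < mu -> mu <= L -> 1 <= Num.sqrt (L / mu).
Proof.
by move=> mu0 muL; rewrite -[leLHS]sqrtr1 ler_wsqrtr // ler_pdivlMr ?mul1r.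
Qed.

End Scale.

(** * Composite minimization to a prescribed accuracy *)

Section Composite.
Context {R : realType} {k n m : nat} (O : oracles R n m).
Implicit Types (u v w x y z : 'rV[R]_k) (Q : set 'rV[R]_k)
  (f p q b : 'rV[R]_k -> R) (df dp dq db : 'rV[R]_k -> 'rV[R]_k).
Notation progm := (prog (R := R) (n := n) (m := m)).

(** Distance [pw T (- c)] asks for objective accuracy about [pw T (- (2 * c))] by strong convexity;
    the initial error [Lp / 2 * D ^+ 2] is at most [pw T 9], and the remaining 4 cover [1 / mu] and
    sums. The inner exponent [4 * c + 45] doubles once more, because the error [D * r] of
    [inexact_minimizer] is of the order of the square root of the inner objective error. *)
Definition outer_iters (mu L c T : R) : nat :=
  iters (agd_rate L mu) (2 * c + 13) T.

Definition inner_iters (mu Lp Lq c T : R) : nat :=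
  iters (agd_rate (2 * Lq) (mu + Lp)) (4 * c + 45) T.

Lemma sliding_accuracy (GP GQ : 'rV[R]_k -> progm 'rV[R]_k)
    Q p dp q dq (Lp Lq mu c T : R) us x (cp cq : cost) :
  let Phi := fun t => p t + q t + mu / 2 * sqn t in
  1 <= T -> 0 <= c -> pw T (-1) <= mu -> mu <= Lp -> Lp <= Lq -> Lq <= pw T 5 ->
  convex_set Q -> compact Q -> smooth_on Q p dp Lp -> smooth_on Q q dq Lq ->
  (forall u v, Q u -> Q v -> enorm (u - v) <= pw T 2) ->
  Q us -> (forall u, Q u -> Phi us <= Phi u) -> Q x ->
  (forall y, Q y -> hoare O (GP y)
     (fun ge => enorm (ge - dp y) <= pw T (- (2 * c + 18))) cp) ->
  (forall y, Q y -> hoare O (GQ y)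
     (fun ge => enorm (ge - dq y) <= pw T (- (2 * c + 18))) cq) ->
  hoare O (sliding GP GQ Q mu Lp Lq (outer_iters mu Lp c T)
             (inner_iters mu Lp Lq c T) x)
    (fun s => Q s.1 /\ enorm (s.1 - us) <= pw T (- c))
    (costM (outer_iters mu Lp c T).+1
       (costD cp (costM (inner_iters mu Lp Lq c T).+1 cq))).
Proof.
move=> Phi T1 c0 mu1 muLp LpLq Lq5 cQ kQ sp sq diam Qus usmin Qx hP hQ.
have mu0 : 0 < mu by exact: lt_le_trans (pw_gt0 _ _) mu1.
have Lp0 : 0 < Lp by lra.
have Lq0 : 0 < Lq by lra.
have muV : mu^-1 <= pw T 1 by rewrite -[1]opprK; exact: pw_inv.
have muV0 : 0 <= mu^-1 by rewrite invr_ge0 ltW.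
have two : 2 <= pw T 1 by exact: pw_ge2.
have [t0 t1 _] := agd_rate_bounds mu0 muLp.
have mL0 : 0 < mu + Lp by lra.
have mL1 : mu + Lp <= 2 * Lq by lra.
have [ti0 ti1 _] := agd_rate_bounds mL0 mL1.
set theta := agd_rate Lp mu in t0 t1 *.
set ti := agd_rate (2 * Lq) (mu + Lp) in ti0 ti1 *.
have thV : theta^-1 <= pw T 7.
  rewrite agd_rate_inv //.
  have h := sqrt_ratio_ge1 mu0 muLp.
  (* A crude bound suffices: it affects only the exponents, hence the number of iterations by a
     constant factor. *)
  have h2 : Num.sqrt (Lp / mu) <= Lp / mu.
    have e : Lp / mu = Num.sqrt (Lp / mu) ^+ 2.
      by rewrite sqr_sqrtr // divr_ge0 // ltW.
    by rewrite [leRHS]e expr2 ler_peMl //; lra.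
  apply: (@pw_trans _ _ (1 + (5 + 1))) => //; last lra.
  apply: pw_mul => //; apply: le_trans h2 _.
  by apply: pw_mul => //; lra.
set eta := pw T (- (2 * c + 18)).
have eta0 : 0 <= eta by exact: pw_ge0.
set D := pw T 2; have D0 : 0 <= D by exact: pw_ge0.
set r := pw T (- (2 * c + 13)); have r0 : 0 <= r by exact: pw_ge0.
have D2 : D ^+ 2 <= pw T 4 by apply: pw_trans T1 (pw_sqr D0 (lexx _)) _; lra.
have em : eta ^+ 2 / mu <= pw T (- (4 * c + 35)).
  apply: pw_trans T1 (pw_mul (sqr_ge0 _) (pw_sqr eta0 (lexx _)) muV0 muV) _; lra.
have em0 : 0 <= eta ^+ 2 / mu by rewrite mulr_ge0 ?sqr_ge0.
have decay1 : (1 - theta) ^+ outer_iters mu Lp c T <= pw T (- (2 * c + 13)).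
  by apply: iters_decay => //; lra.
have decay2 : (1 - ti) ^+ inner_iters mu Lp Lq c T <= pw T (- (4 * c + 45)).
  by apply: iters_decay => //; lra.
have d1p : 0 <= (1 - theta) ^+ outer_iters mu Lp c T.
  by rewrite exprn_ge0 //; lra.
have d2p : 0 <= (1 - ti) ^+ inner_iters mu Lp Lq c T.
  by rewrite exprn_ge0 //; lra.
set dl := (1 - ti) ^+ inner_iters mu Lp Lq c T *
    (Lq * D ^+ 2 + eta ^+ 2 / mu) + eta ^+ 2 / mu.
have sm0 : 0 <= Lq * D ^+ 2 + eta ^+ 2 / mu.
  by rewrite addr_ge0 // mulr_ge0 ?sqr_ge0 // ltW.
have dl0 : 0 <= dl by rewrite addr_ge0 // mulr_ge0.
have dlb : dl <= pw T (- (4 * c + 34)).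
  apply: (@pw_trans _ _ (- (4 * c + 35) + 1)) => //; last lra.
  apply: pw_add => //.
  have h : Lq * D ^+ 2 + eta ^+ 2 / mu <= pw T (9 + 1).
    apply: pw_add => //; last by apply: (pw_trans T1 em); lra.
    by apply: pw_trans T1 (pw_mul (ltW Lq0) Lq5 (sqr_ge0 _) D2) _; lra.
  apply: pw_trans T1 (pw_mul d2p decay2 sm0 h) _; lra.
have dlr : 2 * dl * (mu + Lp) <= r ^+ 2.
  have -> : r ^+ 2 = pw T (- (2 * c + 13) + - (2 * c + 13)).
    by rewrite expr2 /r -pwD.
  have mL : mu + Lp <= pw T (5 + 1) by apply: pw_add => //; lra.
  have h2 : 2 * dl <= pw T (1 + - (4 * c + 34)) by apply: pw_mul.
  apply: pw_trans T1 (pw_mul _ h2 _ mL) _; [|lra|lra].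
  by rewrite mulr_ge0.
have sqD u v : Q u -> Q v -> sqn (u - v) <= D ^+ 2.
  by move=> Qu Qv; rewrite -sqn_le // diam.
have h := sliding_correct _ mu0 muLp LpLq eta0 eta0 D0 r0 cQ kQ sp sq sqD Qus
  usmin Qx hP hQ dlr.
apply: (hoare_weaken (h (outer_iters mu Lp c T))) => // {h} s [Q1 hs]; split => //.
rewrite -/theta -/ti -/dl in hs.
have sc : strongly_convex Q mu Phi.
  rewrite /Phi -[mu in strongly_convex _ mu]add0r.
  apply: strongly_convexD.
    rewrite -[0]addr0; apply: strongly_convexD;
      [exact: smooth_on_convex sp|exact: smooth_on_convex sq].
  have -> : (fun u => mu / 2 * sqn u) = (fun u => mu / 2 * sqn (u - 0)).
    by apply/funext => u; rewrite subr0.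
  exact: strongly_convex_sqn.
have := strongly_convex_min (ltW mu0) cQ sc Qus usmin Q1 => hg.
set E := Phi s.1 - Phi us in hs.
have hE : E <= pw T (- (2 * c + 2)).
  have thV0 : 0 <= theta^-1 by rewrite invr_ge0 ltW.
  have t2 : dl / theta <= pw T (- (2 * c + 4)).
    by apply: pw_trans T1 (pw_mul dl0 dlb thV0 thV) _; lra.
  have t3 : D * r / theta <= pw T (- (2 * c + 4)).
    rewrite -mulrA; apply: pw_trans T1 (pw_mul D0 (lexx _) _
      (pw_mul r0 (lexx _) thV0 thV)) _; last by lra.
    by rewrite mulr_ge0.
  have t4 : eta * D / theta <= pw T (- (2 * c + 4)).
    rewrite -mulrA; apply: pw_trans T1 (pw_mul eta0 (lexx _) _
      (pw_mul D0 (lexx _) thV0 thV)) _; last by lra.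
    by rewrite mulr_ge0.
  have t5 : (1 - theta) ^+ outer_iters mu Lp c T * (Lp / 2 * D ^+ 2) <=
      pw T (- (2 * c + 4)).
    have h1 : Lp / 2 <= pw T 5 by lra.
    have h0 : 0 <= Lp / 2 by rewrite divr_ge0 // ltW.
    apply: pw_trans T1 (pw_mul d1p decay1 _ (pw_mul h0 h1 (sqr_ge0 _) D2)) _.
      by rewrite mulr_ge0 ?sqr_ge0.
    lra.
  apply: (@pw_trans _ _ (- (2 * c + 4) + 1 + 1)) => //; last lra.
  apply: le_trans hs _.
  rewrite (_ : (dl + D * r + eta * D) / theta =
    dl / theta + D * r / theta + eta * D / theta); last by rewrite -!mulrDl.
  have := pw_add T1 (pw_add T1 t2 t3) (pw_add T1 t4 t5); lra.
have : sqn (s.1 - us) <= pw T (- c + - c).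
  have e : sqn (s.1 - us) <= 2 * (mu^-1 * E).
    rewrite mulrCA mulrC ler_pdivlMr // /E.
    lra.
  apply: le_trans e _.
  have E0 : 0 <= E.
    by rewrite /E; have := mulr_ge0 (ltW mu0) (sqn_ge0 (s.1 - us)); lra.
  have h : 2 * (mu^-1 * E) <= pw T (1 + (1 + - (2 * c + 2))).
    by apply: pw_mul => //; [rewrite mulr_ge0|exact: pw_mul].
  by apply: pw_trans T1 h _; lra.
rewrite -enorm_sqr; exact: sqrt_pw (enorm_ge0 _).
Qed.

End Composite.

Section CompositeSolver.
Context {R : realType} {k n m : nat} (O : oracles R n m).
Implicit Types (u v w x y z : 'rV[R]_k) (Q : set 'rV[R]_k)
  (f p q b : 'rV[R]_k -> R) (df dp dq db : 'rV[R]_k -> 'rV[R]_k).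
Notation progm := (prog (R := R) (n := n) (m := m)).

Lemma agd_accuracy (G : 'rV[R]_k -> progm 'rV[R]_k)
    (PX : 'rV[R]_k -> 'rV[R]_k -> R -> progm 'rV[R]_k)
    Q p dp f (L mu c T : R) us x (cg cp : cost) :
  1 <= T -> 0 <= c -> pw T (-1) <= mu -> mu <= L -> L <= pw T 5 ->
  convex_set Q -> smooth_on Q p dp L -> strongly_convex Q mu f ->
  Q us -> (forall u, Q u -> p us + f us <= p u + f u) -> Q x ->
  enorm (x - us) <= pw T 1 ->
  (forall y, Q y -> enorm (y - us) <= pw T 7 -> hoare O (G y)
     (fun ge => enorm (ge - dp y) <= pw T (- (2 * c + 18))) cg) ->
  (forall c z tau, Q z -> 0 < tau ->
     hoare O (PX c z tau) (prox_min Q f c z tau) cp) ->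
  hoare O (agd G PX L mu (outer_iters mu L c T) x)
    (fun s => Q s.1 /\ enorm (s.1 - us) <= pw T (- c))
    (costM (outer_iters mu L c T).+1 (costD cg cp)).
Proof.
move=> T1 c0 mu1 muL L5 cQ sp cf Qus usmin Qx xus hG hP.
have mu0 : 0 < mu by exact: lt_le_trans (pw_gt0 _ _) mu1.
have L0 : 0 < L by lra.
have muV : mu^-1 <= pw T 1 by rewrite -[1]opprK; exact: pw_inv.
have muV0 : 0 <= mu^-1 by rewrite invr_ge0 ltW.
have two : 2 <= pw T 1 by exact: pw_ge2.
have [t0 t1 _] := agd_rate_bounds mu0 muL.
set theta := agd_rate L mu in t0 t1 *.
set eta := pw T (- (2 * c + 18)).
have eta0 : 0 <= eta by exact: pw_ge0.
have em : eta ^+ 2 / mu <= pw T (- (4 * c + 35)).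
  apply: pw_trans T1 (pw_mul (sqr_ge0 _) (pw_sqr eta0 (lexx _)) muV0 muV) _; lra.
have em0 : 0 <= eta ^+ 2 / mu by rewrite mulr_ge0 ?sqr_ge0.
have rho : sqn (x - us) <= pw T (1 + 1).
  by rewrite -enorm_sqr; exact: pw_sqr (enorm_ge0 _) xus.
set P0 := L / 2 * pw T (1 + 1) + eta ^+ 2 / mu.
have P00 : 0 <= P0.
  by rewrite addr_ge0 // mulr_ge0 ?pw_ge0 //; lra.
have P0b : P0 <= pw T 8.
  apply: (@pw_trans _ _ (7 + 1)) => //; last lra.
  apply: pw_add => //; last by apply: (pw_trans T1 em); lra.
  have h0 : 0 <= L / 2 by lra.
  have h1 : L / 2 <= pw T 5 by lra.
  by apply: (pw_trans T1 (pw_mul h0 h1 (pw_ge0 _ _) (lexx _))); lra.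
(* Origin of the query radius [pw T 7]: here [8 / mu] is at most [pw T 4] and the potential at most
   [pw T 9], and 13 is below twice 7. *)
have W8 : 8 / mu * (P0 + eta ^+ 2 / mu) <= pw T 7 ^+ 2.
  have h1 : P0 + eta ^+ 2 / mu <= pw T (8 + 1).
    by apply: pw_add => //; apply: (pw_trans T1 em); lra.
  have h8 : 8 <= pw T 3.
    have e8 : 8 = 2 ^+ 3 :> R by ring.
    by rewrite e8; exact: (pw_nat 3).
  have h2 : 8 / mu <= pw T (3 + 1) by exact: pw_mul (ler0n _ 8) h8 muV0 muV.
  have -> : pw T 7 ^+ 2 = pw T (7 + 7) by rewrite (pwD T 7 7) expr2.
  apply: (pw_trans T1 (pw_mul _ h2 _ h1)); first by rewrite divr_ge0 // ltW.
    by rewrite addr_ge0.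
  lra.
have hG' y : Q y -> sqn (y - us) <= pw T 7 ^+ 2 ->
    hoare O (G y) (fun ge => enorm (ge - dp y) <= eta) cg.
  by move=> Qy yus; apply: hG => //; rewrite sqn_le ?pw_ge0.
have h := agd_correct (outer_iters mu L c T) mu0 muL eta0 cQ sp cf Qus usmin Qx rho W8 hG' hP.
apply: (hoare_weaken h) => // {h} s [Q1 Q2 hs]; split => //.
rewrite -/theta -/P0 in hs.
have decay1 : (1 - theta) ^+ outer_iters mu L c T <= pw T (- (2 * c + 13)).
  by apply: iters_decay => //; lra.
have d1p : 0 <= (1 - theta) ^+ outer_iters mu L c T.
  by rewrite exprn_ge0 //; lra.
have sc : strongly_convex Q mu (fun u => p u + f u).
  rewrite -[mu in strongly_convex _ mu]add0r.
  by apply: strongly_convexD => //; exact: smooth_on_convex sp.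
have hg := strongly_convex_min (ltW mu0) cQ sc Qus usmin Q1.
set E := _ - _ in hs.
have hE : E <= pw T (- (2 * c + 5) + 1).
  apply: le_trans hs _; apply: pw_add => //; last first.
    by apply: (pw_trans T1 em); lra.
  by apply: (pw_trans T1 (pw_mul d1p decay1 P00 P0b)); lra.
have E0 : 0 <= E.
  by rewrite /E; have := mulr_ge0 (ltW mu0) (sqn_ge0 (s.1 - us)); lra.
have : sqn (s.1 - us) <= pw T (- c + - c).
  have e : sqn (s.1 - us) <= 2 * (mu^-1 * E).
    by rewrite mulrCA mulrC ler_pdivlMr // /E; lra.
  apply: le_trans e _.
  have h : 2 * (mu^-1 * E) <= pw T (1 + (1 + (- (2 * c + 5) + 1))).
    by apply: pw_mul => //; [rewrite mulr_ge0|exact: pw_mul].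
  by apply: (pw_trans T1 h); lra.
rewrite -enorm_sqr; exact: sqrt_pw (enorm_ge0 _).
Qed.

Lemma hoare_fst (A B : Type) (p : progm (A * B)) (P : A -> Prop) (c : cost) :
  hoare O p (fun s => P s.1) c -> hoare O (bind p (fun s => ret s.1)) P c.
Proof.
have hr (s : A * B) : P s.1 -> hoare O (ret s.1) P cost0 by exact: hoare_ret.
move=> h; apply: (hoare_weaken (hoare_bind h hr)) => // i.
by rewrite /costD addn0.
Qed.

(** With gradient access, clipping to the ball makes the diameter a power of [expR T] whatever the
    size of [Q], and [- mu *: u] shifts the strong convexity into sliding's own quadratic. With
    proximal access the domain stays whole, since the oracle solves problems over [Q] only; there
    the potential of [agd] keeps the queries near the minimizer. The arguments of [pp] come from
    expanding [tau / 2 * sqn (u - z)]. The factor in [2 * L] is the one lost in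
    [smooth_on_lipschitz]. *)
Definition composite (a : @access R) Q (mu Lb c T : R)
    (pg : 'rV[R]_k -> progm 'rV[R]_k) (pp : 'rV[R]_k * R -> progm 'rV[R]_k)
    (GB : 'rV[R]_k -> progm 'rV[R]_k) x0 : progm 'rV[R]_k :=
  match a with
  | Prox =>
      bind (agd GB (fun ge z tau => pp (ge - tau *: z, tau / 2)) Lb mu
              (outer_iters mu Lb c T) x0)
        (fun s => ret s.1)
  | Grad L =>
      let Q' := Q `&` eball x0 (pw T 1) in
      let ga := fun u => bind (pg u) (fun ge => ret (ge - mu *: u)) in
      if 2 * L <= Lb then
        bind (sliding ga GB Q' mu (2 * L) Lb (outer_iters mu (2 * L) c T)
                (inner_iters mu (2 * L) Lb c T) x0) (fun s => ret s.1)
      else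
        bind (sliding GB ga Q' mu Lb (2 * L) (outer_iters mu Lb c T)
                (inner_iters mu Lb (2 * L) c T) x0) (fun s => ret s.1)
  end.

Definition composite_cost (a : @access R) (mu Lb c T : R) (ca cb : cost) : cost :=
  match a with
  | Prox => costM (outer_iters mu Lb c T).+1 (costD cb ca)
  | Grad L =>
      if 2 * L <= Lb then
        costM (outer_iters mu (2 * L) c T).+1
          (costD ca (costM (inner_iters mu (2 * L) Lb c T).+1 cb))
      else
        costM (outer_iters mu Lb c T).+1
          (costD cb (costM (inner_iters mu Lb (2 * L) c T).+1 ca))
  end.

Definition implemented_by (a : @access R) Q gf Pf
    (pg : 'rV[R]_k -> progm 'rV[R]_k) (pp : 'rV[R]_k * R -> progm 'rV[R]_k)
    (ca : cost) : Prop :=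
  match a with
  | Prox => forall t, hoare O (pp t) (fun w => w = Pf t) ca
  | Grad _ => forall u, Q u -> hoare O (pg u) (fun w => w = gf u) ca
  end.

Definition well_scaled (a : @access R) (mu T : R) : Prop :=
  if a is Grad L then mu <= L /\ L <= pw T 1 else True.

Lemma prox_min_of_solves_prox Q f Pf c z tau : 0 < tau -> solves_prox Q f Pf ->
  prox_min Q f c z tau (Pf (c - tau *: z, tau / 2)).
Proof.
move=> tau0 /(_ (c - tau *: z) (tau / 2)) [|QP hP]; first by rewrite divr_gt0.
split => // u Qu; have := hP u Qu; rewrite !enorm_sqr.
set w := Pf _.
have e v : sqn (v - z) = sqn v - 2 * dot z v + sqn z.
  by rewrite /sqn !dotE (dotC v z); ring.
rewrite !e !dotBl !dotZl; lra.
Qed.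

Lemma composite_correct (a : @access R) Q f gf Pf b db (mu Lb c T : R)
    pg pp GB us x0 (ca cb : cost) :
  1 <= T -> 0 <= c -> pw T (-1) <= mu -> mu <= Lb -> Lb <= pw T 5 ->
  well_scaled a mu T -> convex_set Q -> compact Q -> strongly_convex Q mu f ->
  provides a Q f gf Pf -> implemented_by a Q gf Pf pg pp ca ->
  smooth_on Q b db Lb ->
  Q us -> (forall u, Q u -> f us + b us <= f u + b u) -> Q x0 ->
  enorm (x0 - us) <= pw T 1 ->
  (forall y, Q y -> enorm (y - us) <= pw T 7 -> hoare O (GB y)
     (fun ge => enorm (ge - db y) <= pw T (- (2 * c + 18))) cb) ->
  hoare O (composite a Q mu Lb c T pg pp GB x0)
    (fun x => Q x /\ enorm (x - us) <= pw T (- c))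
    (composite_cost a mu Lb c T ca cb).
Proof.
move=> T1 c0 mu1 muL L5 wa cQ kQ cf pa ia sb Qus usmin Qx0 x0us hB.
have mu0 : 0 < mu by exact: lt_le_trans (pw_gt0 _ _) mu1.
case: a wa pa ia => [|L] /= wa pa ia.
  have usmin' u : Q u -> b us + f us <= b u + f u.
    by move=> Qu; have := usmin u Qu; lra.
  have hP d z tau : Q z -> 0 < tau ->
      hoare O (pp (d - tau *: z, tau / 2)) (prox_min Q f d z tau) ca.
    move=> Qz tau0; apply: (hoare_weaken (ia _)) => // w ->.
    exact: prox_min_of_solves_prox.
  have h := agd_accuracy T1 c0 mu1 muL L5 cQ sb cf Qus usmin' Qx0 x0us hB hP.
  exact: hoare_fst h.
case: wa => muL' L1.
set Q' := Q `&` eball x0 (pw T 1).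
have sQ : Q' `<=` Q by move=> u [].
have cQ' : convex_set Q' by apply: convex_clip => //; exact: pw_ge0.
have kQ' : compact Q' by apply: compact_clip => //; exact: pw_ge0.
have Qus' : Q' us by split => //; rewrite /eball /= enormBC.
have Qx0' : Q' x0 by split => //; rewrite /eball /= subrr enorm0 pw_ge0.
have two : 2 <= pw T 1 by exact: pw_ge2.
have diam u v : Q' u -> Q' v -> enorm (u - v) <= pw T 2.
  move=> [_ hu] [_ hv]; apply: le_trans (enorm_tri x0 u v) _.
  rewrite (enormBC x0 v); exact: pw_add.
case: (pa) => _ _ lip.
have fo := strongly_convex_first_order (ltW mu0) cf (segment_gradient_lipschitz cQ pa).
have sf : smooth_on Q f gf (2 * L).
  apply: smooth_on_lipschitz lip => u v Qu Qv; have := fo u v Qu Qv.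
  by have := mulr_ge0 (ltW mu0) (sqn_ge0 (v - u)); lra.
have sa := smooth_on_sub sQ (smooth_on_shift fo (ltW mu0) sf).
have sb' := smooth_on_sub sQ sb.
have eB y : Q' y -> hoare O (GB y)
     (fun ge => enorm (ge - db y) <= pw T (- (2 * c + 18))) cb.
  move=> Qy; apply: hB; first exact: sQ.
  by apply: (pw_trans T1 (diam _ _ Qy Qus')); lra.
have eA y : Q' y -> hoare O (bind (pg y) (fun ge => ret (ge - mu *: y)))
     (fun ge => enorm (ge - (gf y - mu *: y)) <= pw T (- (2 * c + 18))) ca.
  move=> Qy; apply: (hoare_weaken (hoare_bind (ia y (sQ _ Qy)) _ (c' := cost0))
    (fun ge => id)) => [ge ->|i]; last by rewrite /costD addn0.
  by apply: hoare_ret; rewrite subrr enorm0 pw_ge0.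
have L5' : 2 * L <= pw T 5.
  apply: (@pw_trans _ _ (1 + 1)) => //; last lra.
  by apply: pw_mul => //; lra.
case: ifPn => LL.
  have usmin' u : Q' u ->
      f us - mu / 2 * sqn us + b us + mu / 2 * sqn us <=
      f u - mu / 2 * sqn u + b u + mu / 2 * sqn u.
    by move=> Qu; have := usmin u (sQ _ Qu); lra.
  have muL2 : mu <= 2 * L by lra.
  have h := sliding_accuracy T1 c0 mu1 muL2 LL L5 cQ' kQ' sa sb' diam Qus' usmin' Qx0' eA eB.
  by apply: hoare_fst; apply: (hoare_weaken h) => // x [/sQ].
have {}LL : Lb <= 2 * L by rewrite ltW // ltNge.
have usmin' u : Q' u ->
    b us + (f us - mu / 2 * sqn us) + mu / 2 * sqn us <=
    b u + (f u - mu / 2 * sqn u) + mu / 2 * sqn u.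
  by move=> Qu; have := usmin u (sQ _ Qu); lra.
have h := sliding_accuracy T1 c0 mu1 muL LL L5' cQ' kQ' sb' sa diam Qus' usmin' Qx0' eB eA.
by apply: hoare_fst; apply: (hoare_weaken h) => // x [/sQ].
Qed.

Definition access_rate (a : @access R) (mu Lb : R) : R :=
  if a is Grad L then Num.sqrt (L / mu) else Num.sqrt (Lb / mu).

Lemma outer_iters_bound (mu L c T : R) : 0 < mu -> mu <= L -> 0 <= c -> 1 <= T ->
  (outer_iters mu L c T).+1%:R <= 4 * (2 * c + 13) * T * Num.sqrt (L / mu).
Proof.
move=> mu0 muL c0 T1; have [t0 _ _] := agd_rate_bounds mu0 muL.
apply: iters_bound => //; [lra|exact: sqrt_ratio_ge1|].
by rewrite agd_rate_inv.
Qed.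

Lemma inner_iters_bound (mu Lp Lq c T : R) : 0 < mu -> mu <= Lp -> Lp <= Lq ->
  0 <= c -> 1 <= T ->
  (inner_iters mu Lp Lq c T).+1%:R <=
  8 * (4 * c + 45) * T * Num.sqrt (Lq / Lp).
Proof.
move=> mu0 muL LL c0 T1.
have m0 : 0 < mu + Lp by lra.
have m1 : mu + Lp <= 2 * Lq by lra.
have Lp0 : 0 < Lp by lra.
have [t0 _ _] := agd_rate_bounds m0 m1.
have q1 := sqrt_ratio_ge1 Lp0 LL.
have h : (agd_rate (2 * Lq) (mu + Lp))^-1 <= 2 * (2 * Num.sqrt (Lq / Lp)).
  rewrite agd_rate_inv // ler_wpM2l //.
  have -> : 2 * Num.sqrt (Lq / Lp) = Num.sqrt (2 ^+ 2 * (Lq / Lp)).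
    by rewrite [RHS]sqrtrM ?sqr_ge0 // sqrtr_sqr ger0_norm.
  apply: ler_wsqrtr; rewrite ler_pdivrMr //.
  have -> : 2 ^+ 2 * (Lq / Lp) * (mu + Lp) = 4 * Lq + 4 * (Lq / Lp * mu).
    by field; rewrite gt_eqF.
  have : 0 <= Lq / Lp * mu by rewrite mulr_ge0 ?divr_ge0 //; lra.
  lra.
have := iters_bound t0 (_ : 1 <= 4 * c + 45) T1 (_ : 1 <= 2 * Num.sqrt (Lq / Lp)) h.
rewrite -/(inner_iters mu Lp Lq c T) => hh.
apply: le_trans (hh _ _) _; lra.
Qed.

(** The heart of sliding: the quadratic of weight [Lp] in the subproblem lowers the inner condition
    number to about [Lq / Lp], and the counts telescope, [sqrt (Lp / mu) * sqrt (Lq / Lp) = sqrt (Lq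
    / mu)]. Each summand's gradient is therefore charged at the rate of its own constant. *)
Lemma composite_cost_bound (a : @access R) (mu Lb c T : R) (ca cb : cost) o :
  1 <= T -> 0 <= c -> 0 < mu -> mu <= Lb -> well_scaled a mu T ->
  (composite_cost a mu Lb c T ca cb o)%:R <=
    64 * (2 * c + 13) * (4 * c + 45) * T ^+ 2 *
    (access_rate a mu Lb * (ca o)%:R + Num.sqrt (Lb / mu) * (cb o)%:R).
Proof.
move=> T1 c0 mu0 muL wa.
have Lb0 : 0 < Lb by lra.
set A : R := (ca o)%:R; set B : R := (cb o)%:R.
have A0 : 0 <= A by exact: ler0n.
have B0 : 0 <= B by exact: ler0n.
have TT : T <= T ^+ 2 by rewrite expr2 ler_peMl //; lra.
have out L : mu <= L -> (outer_iters mu L c T).+1%:R <=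
    32 * (2 * c + 13) * (4 * c + 45) * T ^+ 2 * Num.sqrt (L / mu) :> R.
  move=> muL'; apply: le_trans (outer_iters_bound mu0 muL' c0 T1) _.
  rewrite ler_wpM2r ?sqrtr_ge0 //.
  rewrite -[leLHS]mulr1 -[X in _ <= X * T ^+ 2]mulr1.
  have h1 : 4 * (2 * c + 13) * T * 1 <= 4 * (2 * c + 13) * T ^+ 2 * (8 * (4 * c + 45)).
    by rewrite ler_pM ?ler_wpM2l ?mulr_ge0 //; lra.
  lra.
have inn Lp Lq : mu <= Lp -> Lp <= Lq -> (outer_iters mu Lp c T).+1%:R *
    (inner_iters mu Lp Lq c T).+1%:R <=
    32 * (2 * c + 13) * (4 * c + 45) * T ^+ 2 * Num.sqrt (Lq / mu) :> R.
  move=> muL' LL.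
  apply: le_trans (ler_pM _ _ (outer_iters_bound mu0 muL' c0 T1)
    (inner_iters_bound mu0 muL' LL c0 T1)) _ => //.
  have -> : Num.sqrt (Lq / mu) = Num.sqrt (Lp / mu) * Num.sqrt (Lq / Lp).
    rewrite -sqrtrM ?divr_ge0 //; [|lra|lra].
    by congr Num.sqrt; field; rewrite !gt_eqF //; lra.
  set s1 := Num.sqrt _; set s2 := Num.sqrt _.
  by rewrite le_eqVlt; apply/orP; left; apply/eqP; ring.
have sq2 (L : R) : mu <= L -> Num.sqrt (2 * L / mu) <= 2 * Num.sqrt (L / mu).
  move=> muL'; have -> : 2 * Num.sqrt (L / mu) = Num.sqrt (2 ^+ 2 * (L / mu)).
    by rewrite [RHS]sqrtrM ?sqr_ge0 // sqrtr_sqr ger0_norm.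
  apply: ler_wsqrtr; rewrite -mulrA ler_wpM2r ?divr_ge0 //; lra.
have K0 : 0 <= 32 * (2 * c + 13) * (4 * c + 45) * T ^+ 2.
  by rewrite !mulr_ge0 ?sqr_ge0 //; lra.
have -> : 64 * (2 * c + 13) * (4 * c + 45) * T ^+ 2 =
  2 * (32 * (2 * c + 13) * (4 * c + 45) * T ^+ 2) by ring.
move: out inn K0; set K := 32 * _ * _ * _ => out inn K0.
have s0 : 0 <= Num.sqrt (Lb / mu) by exact: sqrtr_ge0.
case: a wa => [|L] /= wa.
  rewrite /costM /costD natrM natrD -/A -/B.
  have h := ler_wpM2r (addr_ge0 B0 A0) (out Lb muL).
  have := mulr_ge0 (mulr_ge0 K0 s0) (addr_ge0 B0 A0); lra.
case: wa => muL' _.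
have muL2 : mu <= 2 * L by lra.
have sL0 : 0 <= Num.sqrt (L / mu) by exact: sqrtr_ge0.
have KA := mulr_ge0 (mulr_ge0 K0 sL0) A0.
have KB := mulr_ge0 (mulr_ge0 K0 s0) B0.
have sA := ler_wpM2r A0 (ler_wpM2l K0 (sq2 L muL')).
case: ifPn => LL; rewrite /costM /costD natrM natrD natrM -/A -/B.
  have h1 := ler_wpM2r A0 (out _ muL2).
  have h2 := ler_wpM2r B0 (inn _ _ muL2 LL).
  lra.
have {}LL : Lb <= 2 * L by rewrite ltW // ltNge.
have h1 := ler_wpM2r B0 (out _ muL).
have h2 := ler_wpM2r A0 (inn _ _ muL LL).
lra.
Qed.

End CompositeSolver.

(** * Optimality conditions and existence of composite minimizers *)

Section CompositeOptimality.
Context {R : realType} {k : nat}.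
Implicit Types (u v w x y z c : 'rV[R]_k) (Q : set 'rV[R]_k)
  (f g b om : 'rV[R]_k -> R) (df dg db : 'rV[R]_k -> 'rV[R]_k).

Lemma composite_optimality Q f b db (mu L : R) us : 0 <= mu ->
  convex_set Q -> strongly_convex Q mu f -> smooth_on Q b db L ->
  Q us -> (forall u, Q u -> f us + b us <= f u + b u) ->
  forall u, Q u -> f us + dot (- db us) (u - us) + mu / 2 * sqn (u - us) <= f u.
Proof.
move=> mu0 cQ cf sb Qus usmin u Qu; rewrite -subr_ge0.
apply: (@scalar_limit _ _ ((mu / 2 + L / 2) * sqn (u - us))) => t t0 t1.
have Qw := convex_combine cQ Qu Qus (ltW t0) t1.
have h1 := usmin _ Qw.
have h2 := cf u us t Qu Qus (ltW t0) t1; rewrite enorm_sqr in h2.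
have [_ h3] := sb _ _ Qus Qw.
have e : t *: u + (1 - t) *: us - us = t *: (u - us).
  by apply/rowP => i; rewrite !mxE; ring.
rewrite e dotZr sqnZ in h3; rewrite dotNl.
rewrite -(pmulr_rge0 _ t0).
move: h1 h2 h3; set q := sqn _; set D := dot _ _; lra.
Qed.

Lemma prox_min_subgradient Q om (mu : R) c z (tau : R) w : 0 <= mu -> 0 <= tau ->
  convex_set Q -> strongly_convex Q mu om -> prox_min Q om c z tau w ->
  forall u, Q u ->
    om w + dot (- c - tau *: (w - z)) (u - w) + mu / 2 * sqn (u - w) <= om u.
Proof.
move=> mu0 tau0 cQ com pm u Qu.
have := prox_min_growth mu0 tau0 cQ com pm Qu.
have -> : sqn (u - z) = sqn (w - z) + 2 * dot (w - z) (u - w) + sqn (u - w).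
  by rewrite /sqn !dotE (dotC w u) (dotC z u) (dotC z w); ring.
rewrite !(dotBl, dotBr, dotNl, dotZl); lra.
Qed.

Lemma strong_monotone (mu fa fb : R) u v s t :
  fa + dot s (v - u) + mu / 2 * sqn (v - u) <= fb ->
  fb + dot t (u - v) + mu / 2 * sqn (u - v) <= fa ->
  mu * sqn (u - v) <= dot (s - t) (u - v).
Proof.
rewrite (sqnBC v u) dotBl -(opprB u v) dotNr; lra.
Qed.

Lemma sqn_le_enorm (a : R) u v : 0 <= a ->
  a * sqn u <= dot v u -> a * enorm u <= enorm v.
Proof.
move=> a0 h; have [u0|u0] := eqVneq (enorm u) 0.
  by rewrite u0 mulr0 enorm_ge0.
have up : 0 < enorm u by rewrite lt_neqAle eq_sym u0 enorm_ge0.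
rewrite -(ler_pM2r up) -mulrA -expr2 enorm_sqr.
exact: le_trans h (cauchy_schwarz _ _).
Qed.

Lemma lipschitz_continuous Q (f : 'rV[R]_k -> R) (C : R) :
  (forall u v, Q u -> Q v -> `|f u - f v| <= C * enorm (u - v)) ->
  {within Q, continuous f}.
Proof.
move=> lf; apply/subspace_continuousP => u Qu.
apply/cvgrPdist_le => e e0.
pose C' := `|C| + 1.
have C0 : 0 < C' by rewrite /C'; have := normr_ge0 C; lra.
have d0 : 0 < (e / C') ^+ 2 by rewrite exprn_gt0 // divr_gt0.
have /cvgrPdist_le /(_ _ d0) := @sqn_continuous R k u u.
rewrite /within /=; apply: filterS => v.
rewrite !subrr {1}/sqn dot0l sub0r normrN ger0_norm ?sqn_ge0 // => hv Qv.
apply: le_trans (lf _ _ Qu Qv) _.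
have h : enorm (u - v) <= e / C'.
  by rewrite enormBC sqn_le // divr_ge0 // ltW.
apply: (@le_trans _ _ (C' * enorm (u - v))).
  rewrite ler_wpM2r ?enorm_ge0 // /C'; have := ler_norm C; lra.
by rewrite mulrC -ler_pdivlMr.
Qed.

(* The forward-backward map with a large proximal weight is a contraction; on a
   compact set its displacement attains its minimum, which must then be zero. *)
Lemma exists_composite_minimizer Q f b db (mu L Lb : R) P : 0 < mu -> 0 <= L ->
  Q !=set0 -> convex_set Q -> compact Q -> strongly_convex Q mu f ->
  solves_prox Q f P -> smooth_on Q b db Lb ->
  (forall u v, Q u -> Q v -> enorm (db u - db v) <= L * enorm (u - v)) ->
  exists2 u, Q u & forall v, Q v -> f u + b u <= f v + b v.
Proof.
move=> mu0 L0 Q0 cQ kQ cf sP sb lip.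
(* The forward step has squared Lipschitz constant [kap ^+ 2 + L ^+ 2], since monotonicity of [db]
   removes the cross term, and the backward step divides by [(mu + kap) ^+ 2]. With
   [L ^+ 2 <= kap * mu] the quotient [rho] is below 1. *)
pose kap := L ^+ 2 / mu + 1.
have kap0 : 0 < kap.
  have : 0 <= L ^+ 2 / mu by rewrite divr_ge0 ?sqr_ge0 // ltW.
  by rewrite /kap; lra.
have Lk : L ^+ 2 <= kap * mu by rewrite /kap mulrDl divfK ?gt_eqF //; lra.
pose S u := P (db u - kap *: u, kap / 2).
have pS u : prox_min Q f (db u) u kap (S u).
  have [|QS hS] := sP (db u - kap *: u) (kap / 2); first by rewrite divr_gt0.
  split => // v Qv; have := hS v Qv; rewrite !enorm_sqr -/(S u).
  have e w : sqn (w - u) = sqn w - 2 * dot u w + sqn u.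
    by rewrite /sqn !dotE (dotC w u); ring.
  rewrite !e !dotBl !dotZl; lra.
have QS u : Q (S u) by case: (pS u).
have sub u v : Q v -> f (S u) + dot (- db u - kap *: (S u - u)) (v - S u)
    + mu / 2 * sqn (v - S u) <= f v.
  exact: prox_min_subgradient (ltW mu0) (ltW kap0) cQ cf (pS u) v.
pose rho := (kap ^+ 2 + L ^+ 2) / (mu + kap) ^+ 2.
have mk0 : 0 < mu + kap by lra.
have rho1 : rho < 1.
  rewrite ltr_pdivrMr ?exprn_gt0 // mul1r.
  have -> : (mu + kap) ^+ 2 = mu ^+ 2 + 2 * (kap * mu) + kap ^+ 2 by ring.
  have : 0 < mu ^+ 2 by rewrite exprn_gt0.
  have := mulr_gt0 kap0 mu0; lra.
have contr u v : Q u -> Q v -> sqn (S u - S v) <= rho * sqn (u - v).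
  move=> Qu Qv.
  have h := strong_monotone (sub u _ (QS v)) (sub v _ (QS u)).
  set a := kap *: (u - v) - (db u - db v).
  have h2 : (mu + kap) * sqn (S u - S v) <= dot a (S u - S v).
    have e : - db u - kap *: (S u - u) - (- db v - kap *: (S v - v)) =
      a - kap *: (S u - S v).
      by apply/rowP => i; rewrite !mxE; ring.
    move: h; rewrite e dotBl dotZl -/(sqn _); lra.
  have h3 := sqn_le_enorm (ltW mk0) h2.
  have a2 : sqn a <= (kap ^+ 2 + L ^+ 2) * sqn (u - v).
    have -> : sqn a = kap ^+ 2 * sqn (u - v) - 2 * kap * dot (u - v) (db u - db v)
       + sqn (db u - db v).
      rewrite /a; move: (u - v) (db u - db v) => x y.
      by rewrite /sqn !dotE (dotC y x); ring.
    have l2 : sqn (db u - db v) <= L ^+ 2 * sqn (u - v).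
      rewrite -enorm_sqr -(enorm_sqr (u - v)) -exprMn.
      by rewrite lerXn2r ?nnegrE ?mulr_ge0 ?enorm_ge0 // lip.
    have mon : 0 <= dot (u - v) (db u - db v).
      have [h4 _] := sb u v Qu Qv; have [h5 _] := sb v u Qv Qu.
      rewrite dotC dotBl; move: h4 h5; rewrite -(opprB u v) dotNr; lra.
    have := mulr_ge0 (ltW kap0) mon; lra.
  rewrite /rho mulrAC ler_pdivlMr ?exprn_gt0 //.
  apply: le_trans a2; rewrite -!enorm_sqr mulrC -exprMn.
  by rewrite lerXn2r ?nnegrE ?mulr_ge0 ?enorm_ge0 // ltW.
have nonexp u v : Q u -> Q v -> enorm (S u - S v) <= enorm (u - v).
  move=> Qu Qv; rewrite sqn_le ?enorm_ge0 // enorm_sqr.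
  apply: le_trans (contr u v Qu Qv) _.
  by rewrite ler_piMl ?sqn_ge0 // ltW.
have cphi : {within Q, continuous (fun u => enorm (u - S u))}.
  apply: (@lipschitz_continuous _ _ 2) => u v Qu Qv.
  have h1 : enorm (u - S u) <= enorm (u - v) + enorm (v - S v) + enorm (S v - S u).
    apply: le_trans (enorm_tri (S v) _ _) _; rewrite lerD2r.
    exact: enorm_tri.
  have h2 : enorm (v - S v) <= enorm (v - u) + enorm (u - S u) + enorm (S u - S v).
    apply: le_trans (enorm_tri (S u) _ _) _; rewrite lerD2r.
    exact: enorm_tri.
  have := nonexp u v Qu Qv; rewrite (enormBC (S v)) in h1; rewrite (enormBC v u) in h2.
  by rewrite ler_norml => h3; apply/andP; split; lra.
have [u Qu umin] := exists_minimizer Q0 kQ cphi.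
have fixu : S u = u.
  have h1 := umin _ (QS u); have h2 := contr u (S u) Qu (QS u).
  have h3 : sqn (u - S u) <= sqn (S u - S (S u)).
    by rewrite -!enorm_sqr lerXn2r ?nnegrE ?enorm_ge0.
  have z0 : sqn (u - S u) = 0.
    apply/eqP; rewrite eq_le sqn_ge0 andbT.
    have := le_trans h3 h2; have := sqn_ge0 (u - S u); set q := sqn _ => q0 qr.
    have h4 : 0 < 1 - rho by lra.
    rewrite -(pmulr_rle0 _ h4); lra.
  by move/sqn_eq0 : z0 => /eqP; rewrite subr_eq0 => /eqP.
exists u => // v Qv; have := sub u v Qv; rewrite fixu subrr scaler0 subr0 dotNl.
have [h _] := sb u v Qu Qv.
have := mulr_ge0 (ltW mu0) (sqn_ge0 (v - u)); lra.
Qed.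

End CompositeOptimality.

(** * One regularized proximal or gradient step *)

Section ModelStep.
Context {R : realType} {k n m : nat} (O : oracles R n m).
Implicit Types (u v w x y z c : 'rV[R]_k) (Q : set 'rV[R]_k) (f : 'rV[R]_k -> R).
Notation progm := (prog (R := R) (n := n) (m := m)).

Definition model_step (a : @access R) Q (kap : R)
    (pg : 'rV[R]_k -> progm 'rV[R]_k) (pp : 'rV[R]_k * R -> progm 'rV[R]_k)
    c z : progm 'rV[R]_k :=
  match a with
  | Prox => pp (c - kap *: z, kap / 2)
  | Grad _ => bind (pg z) (fun ge =>
      ret (xget 0 (prox_min Q (fun=> 0) (c + ge) z kap)))
  end.

(* [w] has the subgradient [- c - kap (w - z) + e] of [f] plus the indicator of
   [Q], where [e] comes from linearizing [f] at [z]. *)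
Definition model_step_spec (La mu kap : R) Q f c z w : Prop := Q w /\
  exists2 e, enorm e <= La * enorm (w - z) & forall u, Q u ->
    f w + dot (- c - kap *: (w - z) + e) (u - w) + mu / 2 * sqn (u - w) <= f u.

Lemma model_step_correct (a : @access R) Q f gf Pf (mu kap : R) pg pp c z ca :
  0 < mu -> 0 < kap -> convex_set Q -> compact Q -> strongly_convex Q mu f ->
  provides a Q f gf Pf -> implemented_by O a Q gf Pf pg pp ca -> Q z ->
  hoare O (model_step a Q kap pg pp c z)
    (model_step_spec (access_const a) mu kap Q f c z) ca.
Proof.
move=> mu0 kap0 cQ kQ cf pa ia Qz.
case: a pa ia => [|L] /= pa ia.
  apply: (hoare_weaken (ia _)) => // w ->.
  have pm := prox_min_of_solves_prox c z kap0 pa.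
  split; first by case: pm.
  exists 0; first by rewrite enorm0 mul0r.
  by move=> u Qu; rewrite addr0; exact: (prox_min_subgradient (ltW mu0) (ltW kap0) cQ cf pm Qu).
have hr ge : ge = gf z -> hoare O (ret (xget 0 (prox_min Q (fun=> 0) (c + ge) z kap)))
   (model_step_spec L mu kap Q f c z) cost0.
  move=> ->; apply: hoare_ret.
  have s0 : smooth_on Q (fun=> 0 : R) (fun=> 0) 0.
    by move=> u v _ _; rewrite dot0l; split; lra.
  have Q0 : Q !=set0 by exists z.
  have pm := prox_min_nonempty (c + gf z) z Q0 kQ s0 (ltW kap0).
  set w := xget _ _ in pm *.
  have Qw : Q w by case: pm.
  case: (pa) => _ _ lip.
  split=> //; exists (gf w - gf z); first exact: lip.
  move=> u Qu.
  have c0 : strongly_convex Q 0 (fun=> 0 : R).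
    by move=> u' v' t _ _ _ _; rewrite !mul0r !mulr0 addr0 subr0.
  have := prox_min_subgradient (lexx 0) (ltW kap0) cQ c0 pm Qu.
  have := strongly_convex_first_order (ltW mu0) cf
    (segment_gradient_lipschitz cQ pa) Qw Qu.
  rewrite !dotDl !dotNl !dotDl; lra.
apply: (hoare_weaken (hoare_bind (ia z Qz) hr)) => // i.
by rewrite /costD addn0.
Qed.

(* The linearization error is absorbed because [kap] is at least [La]. *)
Lemma model_step_stable (La mu kap : R) Q f c z w cs ws : 0 < mu ->
  0 <= La -> La <= kap -> model_step_spec La mu kap Q f c z w -> Q ws ->
  (forall u, Q u -> f ws + dot (- cs) (u - ws) + mu / 2 * sqn (u - ws) <= f u) ->
  mu * enorm (w - ws) <= enorm (c - cs) + (kap + La) * enorm (z - ws).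
Proof.
move=> mu0 La0 Lk [Qw [e he hw]] Qws hws.
have h := strong_monotone (hw _ Qws) (hws _ Qw).
have h2 : (mu + kap) * sqn (w - ws) <=
   dot (- (c - cs) + kap *: (z - ws) + e) (w - ws).
  have e1 : - c - kap *: (w - z) + e - - cs =
    (- (c - cs) + kap *: (z - ws) + e) - kap *: (w - ws).
    by apply/rowP => i; rewrite !mxE; ring.
  by move: h; rewrite e1 dotBl dotZl -/(sqn _); lra.
have mk : 0 <= mu + kap by lra.
have := sqn_le_enorm mk h2.
have t1 := enormD (- (c - cs) + kap *: (z - ws)) e.
have t2 := enormD (- (c - cs)) (kap *: (z - ws)).
have kap0 : 0 <= kap by lra.
rewrite enormN enormZ ger0_norm // in t2.
have t3 : La * enorm (w - z) <= La * (enorm (w - ws) + enorm (z - ws)).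
  by rewrite ler_wpM2l // (enormBC z) enorm_tri.
have t4 : La * enorm (w - ws) <= kap * enorm (w - ws).
  by rewrite ler_wpM2r ?enorm_ge0.
lra.
Qed.

End ModelStep.

(** * The saddle-point problem *)

Section SaddleStructure.
Context {R : realType} {n m : nat} (d : data R n m) (ax ay : @access R).
Variables (r : 'rV[R]_n -> R) (F : 'rV[R]_n -> 'rV[R]_m -> R) (h : 'rV[R]_m -> R).
Variable O : oracles R n m.
Hypotheses (ad : admissible_data d) (af : admissible_functions d r F h)
  (im : implements d ax ay r F h O).

Notation gx := (fun x y => grad (F ^~ y) x).
Notation gy := (fun x y => grad (F x) y).

Lemma F_lower_x x x' y : Qx d x -> Qx d x' -> Qy d y ->
  F x y + dot (gx x y) (x' - x) <= F x' y.
Proof.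
move=> Qxx Qxx' Qyy.
have sc := strongly_convex_of_convex_function (F_convex af Qyy).
have sg := segment_gradient_differentiable (fun u Qu => F_diff_x af Qu Qyy).
have := strongly_convex_first_order (lexx 0) sc sg Qxx Qxx'.
by rewrite !mul0r addr0.
Qed.

Lemma F_upper_y x y y' : Qx d x -> Qy d y -> Qy d y' ->
  F x y' <= F x y + dot (gy x y) (y' - y).
Proof.
move=> Qxx Qyy Qyy'.
have sc := strongly_convex_of_convex_function (F_concave af Qxx).
have sg := segment_gradient_differentiable (fun u Qu => F_diff_y af Qxx Qu).
have sg' : segment_gradient (Qy d) (fun y => - F x y) (fun y => - gy x y).
  move=> u v Qu Qv e e0; have [dl dl0 hd] := sg u v Qu Qv e e0.
  exists dl => // t t0 td t1; have := hd t t0 td t1; rewrite -normrN.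
  by rewrite dotNl mulrN !opprD !opprK.
have := strongly_convex_first_order (lexx 0) sc sg' Qyy Qyy'.
rewrite !mul0r addr0 dotNl; lra.
Qed.

Lemma smooth_on_negFy x : Qx d x ->
  smooth_on (Qy d) (fun y => - F x y) (fun y => - gy x y) (2 * Lyy d).
Proof.
move=> Qxx; apply: smooth_on_lipschitz => u v Qu Qv.
  by have := F_upper_y Qxx Qu Qv; rewrite dotNl; lra.
rewrite -opprD enormN; exact: (F_Lyy af).
Qed.

(** With proximal access nothing is assumed about the continuity of [h], so compactness alone does
    not give a maximizer; attainment is drawn from the proximal oracle itself. With gradient access
    [h] is continuous on [Qy d] and the extreme value theorem applies. *)
Lemma exists_ystar x : Qx d x -> exists y, is_ystar d F h x y.
Proof.
move=> Qxx.
have Qy0 : Qy d !=set0 by exists (y0 d); exact: y0_in ad.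
have mu0 := muy_gt0 ad.
have ch := h_strongly_convex af.
have sF := smooth_on_negFy Qxx.
have [y Qyy ymin] : exists2 y, Qy d y & forall v, Qy d v -> h y + - F x y <= h v + - F x v.
  have := h_spec im; case: (ay) => [|L] /= pa.
    apply: (exists_composite_minimizer mu0 (Lyy_ge0 ad) Qy0 (Qy_convex ad)
      (Qy_compact ad) ch pa sF).
    by move=> u v Qu Qv; rewrite -opprD enormN; exact: (F_Lyy af).
  have fo := strongly_convex_first_order (ltW mu0) ch
    (segment_gradient_lipschitz (Qy_convex ad) pa).
  case: (pa) => _ _ lip.
  have sh : smooth_on (Qy d) h (@O GradH) (2 * L).
    apply: smooth_on_lipschitz lip => u v Qu Qv; have := fo u v Qu Qv.
    by have := mulr_ge0 (ltW mu0) (sqn_ge0 (v - u)); lra.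
  exact: exists_minimizer Qy0 (Qy_compact ad) (smooth_on_continuous (smooth_onD sh sF)).
by exists y; split => // v Qv; have := ymin v Qv; lra.
Qed.

Lemma ystar_optimality x ys y : Qx d x -> is_ystar d F h x ys -> Qy d y ->
  h ys + dot (gy x ys) (y - ys) + muy d / 2 * sqn (y - ys) <= h y.
Proof.
move=> Qxx [Qys ymax] Qyy.
have ymin v : Qy d v -> h ys + - F x ys <= h v + - F x v.
  by move=> Qv; have := ymax v Qv; lra.
have := composite_optimality (ltW (muy_gt0 ad)) (Qy_convex ad)
  (h_strongly_convex af) (smooth_on_negFy Qxx) Qys ymin Qyy.
by rewrite opprK.
Qed.

Lemma Fy_monotone x y y' : Qx d x -> Qy d y -> Qy d y' ->
  dot (gy x y - gy x y') (y - y') <= 0.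
Proof.
move=> Qxx Qyy Qyy'; have := F_upper_y Qxx Qyy Qyy'; have := F_upper_y Qxx Qyy' Qyy.
rewrite dotBl -(opprB y y') dotNr; lra.
Qed.

(** The two optimality conditions are added. The part of the gradient difference caused by moving
    [y] has the good sign by concavity, so only the change in [x] counts and [Lyy] does not
    appear. *)
Lemma ystar_lipschitz x x' y y' : Qx d x -> Qx d x' ->
  is_ystar d F h x y -> is_ystar d F h x' y' ->
  muy d * enorm (y - y') <= Lxy d * enorm (x - x').
Proof.
move=> Qxx Qxx' yx yx'.
have Qyy : Qy d y by case: yx.
have Qyy' : Qy d y' by case: yx'.
have h1 := ystar_optimality Qxx yx Qyy'.
have h2 := ystar_optimality Qxx' yx' Qyy.
have := strong_monotone h1 h2.
have mon := Fy_monotone Qxx' Qyy Qyy'.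
have -> : grad (F x) y - grad (F x') y' =
  (grad (F x) y - grad (F x') y) + (grad (F x') y - grad (F x') y').
  by rewrite addrA subrK.
rewrite dotDl => h3.
have h4 : muy d * sqn (y - y') <= dot (grad (F x) y - grad (F x') y) (y - y').
  by apply: le_trans h3 _; rewrite gerDl.
apply: le_trans (sqn_le_enorm (ltW (muy_gt0 ad)) h4) _.
exact: (F_Lyx af).
Qed.

Lemma ystar_unique x y y' : Qx d x -> is_ystar d F h x y -> is_ystar d F h x y' ->
  y = y'.
Proof.
move=> Qxx yx yx'; have := ystar_lipschitz Qxx Qxx yx yx'.
rewrite subrr enorm0 mulr0 pmulr_rle0 ?(muy_gt0 ad) // => le0.
have /enorm_eq0 /eqP : enorm (y - y') = 0.
  by apply/eqP; rewrite eq_le le0 enorm_ge0.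
by rewrite subr_eq0 => /eqP.
Qed.

Definition ystar x : 'rV[R]_m := xget 0 [set y | is_ystar d F h x y].

Lemma ystarP x : Qx d x -> is_ystar d F h x (ystar x).
Proof. by move=> Qxx; apply: (@xgetPex _ 0 [set y | is_ystar d F h x y]); exact: exists_ystar. Qed.

Definition psi x : R := F x (ystar x) - h (ystar x).

Definition Lpsi : R := Lxx d + Lxy d ^+ 2 / muy d.

(** Danskin's formula without differentiating a maximum: [ystar u] competes in the maximum at [v],
    which yields the subgradient inequality. The Lipschitz bound goes through the intermediate
    gradient at [v] and [ystar u]. *)
Lemma psi_smooth : smooth_on (Qx d) psi (fun x => gx x (ystar x)) (2 * Lpsi).
Proof.
apply: smooth_on_lipschitz => u v Qu Qv.
  have [Qyu _] := ystarP Qu; have [_ ymax] := ystarP Qv.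
  have := F_lower_x Qu Qv Qyu; have := ymax _ Qyu; rewrite /psi; lra.
have [Qyu _] := ystarP Qu; have [Qyv _] := ystarP Qv.
have lip := ystar_lipschitz Qu Qv (ystarP Qu) (ystarP Qv).
have h1 := F_Lxx af Qu Qv Qyu.
have h2 := F_Lxy af Qv Qyu Qyv.
apply: le_trans (enorm_tri (grad (F ^~ (ystar u)) v) _ _) _.
rewrite /Lpsi mulrDl; apply: lerD => //; apply: le_trans h2 _.
have -> : Lxy d ^+ 2 / muy d * enorm (u - v) =
  Lxy d * (Lxy d * enorm (u - v) / muy d) by ring.
rewrite ler_wpM2l ?(Lxy_ge0 ad) //.
by rewrite ler_pdivlMr ?(muy_gt0 ad) // mulrC.
Qed.

Lemma primalE x : Qx d x -> primal d r F h x = r x + psi x.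
Proof.
move=> Qxx; rewrite /primal; congr (_ + _).
have [Qyy ymax] := ystarP Qxx.
apply/eqP; rewrite eq_le; apply/andP; split.
  apply: ge_sup => [|_ [y Qy' <-]]; last exact: ymax.
  by exists (psi x); exists (ystar x).
apply: ub_le_sup; last by exists (ystar x).
by exists (psi x) => _ [y Qy' <-]; exact: ymax.
Qed.

Lemma xstar_min xs : is_xstar d r F h xs ->
  forall u, Qx d u -> r xs + psi xs <= r u + psi u.
Proof. by move=> [Qxs xmin] u Qu; have := xmin u Qu; rewrite !primalE. Qed.

Lemma xstar_optimality xs ys x : is_xstar d r F h xs -> is_ystar d F h xs ys ->
  Qx d x -> r xs + dot (- gx xs ys) (x - xs) + mux d / 2 * sqn (x - xs) <= r x.
Proof.
move=> hxs hys Qxx; have [Qxs _] := hxs.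
rewrite (ystar_unique Qxs hys (ystarP Qxs)).
exact: (composite_optimality (ltW (mux_gt0 ad)) (Qx_convex ad)
  (r_strongly_convex af) psi_smooth Qxs (xstar_min hxs) Qxx).
Qed.

(** Passing from [ys] to the maximizer at [x], at distance [e], gains at most
    [a * e - muy / 2 * e ^+ 2], where [a] bounds the change of the [y]-gradient between [xs] and
    [x]; the supremum over [e] is [a ^+ 2 / (2 * muy)]. *)
Lemma primal_excess xs ys x : is_xstar d r F h xs -> is_ystar d F h xs ys ->
  Qx d x -> primal d r F h x <=
  r x + F x ys - h ys + (Lxy d * enorm (x - xs)) ^+ 2 / (2 * muy d).
Proof.
move=> [Qxs _] hys Qxx; rewrite primalE // /psi.
have mu0 := muy_gt0 ad.
have [Qyy _] := ystarP Qxx; have [Qys _] := hys.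
have h1 := ystar_optimality Qxs hys Qyy.
have h2 := F_upper_y Qxx Qys Qyy.
have h3 := cauchy_schwarz (gy x ys - gy xs ys) (ystar x - ys).
have h4 := F_Lyx af Qxx Qxs Qys.
have h5 := ler_wpM2r (enorm_ge0 (ystar x - ys)) h4.
rewrite -enorm_sqr in h1; rewrite dotBl in h3.
set a := Lxy d * enorm (x - xs) in h4 h5 *; set e := enorm (ystar x - ys) in h1 h3 h5 *.
have h6 : a * e - muy d / 2 * e ^+ 2 <= a ^+ 2 / (2 * muy d).
  rewrite -subr_ge0.
  have -> : a ^+ 2 / (2 * muy d) - (a * e - muy d / 2 * e ^+ 2) =
    (a - muy d * e) ^+ 2 / (2 * muy d) by field; rewrite gt_eqF.
  by rewrite divr_ge0 ?sqr_ge0 ?mulr_ge0 // ltW.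
lra.
Qed.

End SaddleStructure.

(** * Duality-gap certificates and the localized gap *)

Section Certificate.
Context {R : realType} {n m : nat} (d : data R n m) (ax ay : @access R).
Variables (r : 'rV[R]_n -> R) (F : 'rV[R]_n -> 'rV[R]_m -> R) (h : 'rV[R]_m -> R).
Variable O : oracles R n m.
Hypotheses (ad : admissible_data d) (af : admissible_functions d r F h)
  (im : implements d ax ay r F h O).
Variables (xs : 'rV[R]_n) (ys : 'rV[R]_m).
Hypotheses (hxs : is_xstar d r F h xs) (hys : is_ystar d F h xs ys).

Notation gx := (fun x y => grad (F ^~ y) x).
Notation gy := (fun x y => grad (F x) y).

(** Approximate stationarity in one variable: [v] is a subgradient of the [x]-objective plus the
    indicator of [Qx d]. Two such conditions bound the gap over the whole product without knowing
    the saddle point. *)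
Definition x_certificate (bx : R) x y : Prop := exists2 v, enorm v <= bx &
  forall u, Qx d u ->
    r x + F x y + dot v (u - x) + mux d / 2 * sqn (u - x) <= r u + F u y.

Definition y_certificate (by_ : R) x y : Prop := exists2 v, enorm v <= by_ &
  forall u, Qy d u ->
    h y - F x y + dot v (u - y) + muy d / 2 * sqn (u - y) <= h u - F x u.

(** The second component [yh] is arbitrary, at the cost [Lxy d * enorm (yh - y)]. This freedom lets
    a certificate be carried over to the perturbed point [ya]. *)
Lemma x_certificate_step (La kap : R) x y xh yh : 0 <= kap ->
  Qx d x -> Qy d y -> Qy d yh ->
  model_step_spec La (mux d) kap (Qx d) r (gx x y) x xh ->
  x_certificate ((Lxx d + kap + La) * enorm (xh - x) + Lxy d * enorm (yh - y)) xh yh.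
Proof.
move=> kap0 Qxx Qyy Qyh [Qxh [e he hu]].
exists (gx xh yh - gx x y - kap *: (xh - x) + e).
  have t1 := enormD (gx xh yh - gx x y - kap *: (xh - x)) e.
  have t2 := enormD (gx xh yh - gx x y) (- (kap *: (xh - x))).
  have t3 := enorm_tri (gx x yh) (gx xh yh) (gx x y).
  rewrite enormN enormZ (ger0_norm kap0) in t2.
  have -> : (Lxx d + kap + La) * enorm (xh - x) + Lxy d * enorm (yh - y) =
    Lxx d * enorm (xh - x) + Lxy d * enorm (yh - y) + kap * enorm (xh - x)
    + La * enorm (xh - x) by ring.
  apply: (le_trans t1); apply: lerD => //.
  apply: (le_trans t2); apply: lerD => //.
  apply: (le_trans t3); apply: lerD.
    exact: (F_Lxx af Qxh Qxx Qyh).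
  exact: (F_Lxy af Qxx Qyh Qyy).
move=> u Qu; have := hu u Qu; have := F_lower_x af Qxh Qu Qyh.
rewrite !(dotBl, dotDl, dotNl, dotZl); lra.
Qed.

Lemma y_certificate_step (La kap : R) x y xh yh : 0 <= kap ->
  Qx d x -> Qy d y -> Qx d xh ->
  model_step_spec La (muy d) kap (Qy d) h (- gy x y) y yh ->
  y_certificate ((Lyy d + kap + La) * enorm (yh - y) + Lxy d * enorm (xh - x)) xh yh.
Proof.
move=> kap0 Qxx Qyy Qxh [Qyh [e he hu]].
exists (gy x y - gy xh yh - kap *: (yh - y) + e).
  have t1 := enormD (gy x y - gy xh yh - kap *: (yh - y)) e.
  have t2 := enormD (gy x y - gy xh yh) (- (kap *: (yh - y))).
  have t3 := enorm_tri (gy xh y) (gy x y) (gy xh yh).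
  rewrite enormN enormZ (ger0_norm kap0) in t2.
  have -> : (Lyy d + kap + La) * enorm (yh - y) + Lxy d * enorm (xh - x) =
    Lxy d * enorm (xh - x) + Lyy d * enorm (yh - y) + kap * enorm (yh - y)
    + La * enorm (yh - y) by ring.
  apply: (le_trans t1); apply: lerD => //.
  apply: (le_trans t2); apply: lerD => //.
  apply: (le_trans t3); apply: lerD.
    by rewrite (enormBC xh x); exact: (F_Lyx af Qxx Qxh Qyy).
  by rewrite (enormBC yh y); exact: (F_Lyy af Qxh Qyy Qyh).
move=> u Qu; have := hu u Qu; have := F_upper_y af Qxh Qyh Qu.
rewrite !(dotBl, dotDl, dotNl, dotZl); lra.
Qed.

Lemma certificate_value k (mu b fa fb : R) (v u x : 'rV[R]_k) : 0 < mu ->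
  enorm v <= b -> fa + dot v (u - x) + mu / 2 * sqn (u - x) <= fb ->
  fa - b ^+ 2 / (2 * mu) <= fb.
Proof.
move=> mu0 vb; apply: le_trans.
have h1 := cauchy_schwarz_abs v (u - x).
have h2 : enorm v * enorm (u - x) <= b * enorm (u - x).
  by rewrite ler_wpM2r ?enorm_ge0.
have h3 := ler_norm (- dot v (u - x)); rewrite normrN in h3.
rewrite -enorm_sqr; set e := enorm (u - x) in h1 h2 *.
have h6 : b * e - mu / 2 * e ^+ 2 <= b ^+ 2 / (2 * mu).
  rewrite -subr_ge0.
  have -> : b ^+ 2 / (2 * mu) - (b * e - mu / 2 * e ^+ 2) =
    (b - mu * e) ^+ 2 / (2 * mu) by field; rewrite gt_eqF.
  by rewrite divr_ge0 ?sqr_ge0 ?mulr_ge0 // ltW.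
lra.
Qed.

Notation S x y := (r x + F x y - h y).

Lemma certified_gap (bx by_ : R) x y u v :
  x_certificate bx x y -> y_certificate by_ x y -> Qx d u -> Qy d v ->
  S x v - S u y <= bx ^+ 2 / (2 * mux d) + by_ ^+ 2 / (2 * muy d).
Proof.
move=> [vx hx cx] [vy hy cy] Qu Qv.
have := certificate_value (mux_gt0 ad) hx (cx u Qu).
have := certificate_value (muy_gt0 ad) hy (cy v Qv).
lra.
Qed.

Lemma saddle_x x : Qx d x ->
  S xs ys + mux d / 2 * sqn (x - xs) <= S x ys.
Proof.
move=> Qxx; have [Qxs _] := hxs; have [Qys _] := hys.
have := xstar_optimality ad af im hxs hys Qxx.
have := F_lower_x af Qxs Qxx Qys; rewrite dotNl; lra.
Qed.

Lemma saddle_y y : Qy d y ->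
  S xs y + muy d / 2 * sqn (y - ys) <= S xs ys.
Proof.
move=> Qyy; have [Qxs _] := hxs; have [Qys _] := hys.
have := ystar_optimality ad af Qxs hys Qyy.
have := F_upper_y af Qxs Qys Qyy; lra.
Qed.

Lemma certified_distance (bx by_ : R) x y :
  x_certificate bx x y -> y_certificate by_ x y -> Qx d x -> Qy d y ->
  mux d / 2 * sqn (x - xs) + muy d / 2 * sqn (y - ys) <=
  bx ^+ 2 / (2 * mux d) + by_ ^+ 2 / (2 * muy d).
Proof.
move=> cx cy Qxx Qyy; have [Qxs _] := hxs; have [Qys _] := hys.
have := certified_gap cx cy Qxs Qys.
have := saddle_x Qxx; have := saddle_y Qyy; lra.
Qed.

(** On the [x] side [xs] always lies in its ball. The first inequality of [eps_solution] thus comes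
    down to one point [v] of the ball around [y0 d] that makes up for the primal excess; the three
    lemmas after this one differ in how they find it. *)
Lemma eps_solution_of_certificate (bx by_ : R) x y v :
  x_certificate bx x y -> y_certificate by_ x y -> Qx d x -> Qy d y ->
  bx ^+ 2 / (2 * mux d) + by_ ^+ 2 / (2 * muy d) <= eps d ->
  Qy d v -> enorm (v - y0 d) <= 2 * Ry d ys ->
  primal d r F h x - S xs ys <= S x v - S xs y ->
  eps_solution d r F h xs ys (x, y).
Proof.
move=> cx cy Qxx Qyy be Qv vb pv.
have [Qxs _] := hxs; have [Qys _] := hys.
have gap u w : Qx d u -> Qy d w -> S x w - S u y <= eps d.
  by move=> Qu Qw; apply: le_trans (certified_gap cx cy Qu Qw) be.
have xsb : enorm (xs - x0 d) <= 2 * Rx d xs.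
  by rewrite /Rx (enormBC xs); have := enorm_ge0 (x0 d - xs); lra.
have primals : primal d r F h xs = S xs ys.
  rewrite (primalE ad af im) // /psi -(ystar_unique ad af Qxs hys (ystarP ad af im Qxs)).
  by rewrite addrA.
split => //=; rewrite /local_gap.
  rewrite primals; apply: le_trans pv _; apply: lerB.
    apply: ub_le_sup; last by exists v.
    exists (S xs y + eps d) => _ [w [Qw _] <-].
    by have := gap xs w Qxs Qw; lra.
  apply: ge_inf; last by exists xs.
  exists (S x ys - eps d) => _ [u [Qu _] <-].
  by have := gap u ys Qu Qys; lra.
rewrite lerBlDr; apply: ge_sup; first by exists (S x v); exists v.
move=> _ [w [Qw _] <-]; rewrite -lerBlDl.
apply: lb_le_inf; first by exists (S xs y); exists xs.
by move=> _ [u [Qu _] <-]; have := gap u w Qu Qw; lra.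
Qed.

(** Here [v] is [ys], and the strong concavity gain of [ys] over [y] pays for [primal_excess]. *)
Lemma eps_solution_far_y (bx by_ : R) x y :
  x_certificate bx x y -> y_certificate by_ x y -> Qx d x -> Qy d y ->
  bx ^+ 2 / (2 * mux d) + by_ ^+ 2 / (2 * muy d) <= eps d ->
  Lxy d * enorm (x - xs) <= muy d * enorm (y - ys) ->
  eps_solution d r F h xs ys (x, y).
Proof.
move=> cx cy Qxx Qyy be far; have [Qys _] := hys.
apply: (eps_solution_of_certificate cx cy Qxx Qyy be Qys).
  by rewrite /Ry enormBC; have := enorm_ge0 (y0 d - ys); lra.
have h1 := primal_excess ad af im hxs hys Qxx.
have h2 := saddle_y Qyy.
have mu0 := muy_gt0 ad.
have h3 : (Lxy d * enorm (x - xs)) ^+ 2 / (2 * muy d) <=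
   muy d / 2 * sqn (y - ys).
  rewrite ler_pdivrMr ?mulr_gt0 // -enorm_sqr.
  have -> : muy d / 2 * enorm (y - ys) ^+ 2 * (2 * muy d) =
    (muy d * enorm (y - ys)) ^+ 2 by field.
  by rewrite lerXn2r ?nnegrE ?mulr_ge0 ?enorm_ge0 ?(Lxy_ge0 ad) ?(ltW mu0).
lra.
Qed.

Lemma eps_solution_local (bx by_ : R) x y :
  x_certificate bx x y -> y_certificate by_ x y -> Qx d x -> Qy d y ->
  bx ^+ 2 / (2 * mux d) + by_ ^+ 2 / (2 * muy d) <= eps d ->
  enorm (ystar d F h x - y0 d) <= 2 * Ry d ys ->
  eps_solution d r F h xs ys (x, y).
Proof.
move=> cx cy Qxx Qyy be near.
have [Qv _] := ystarP ad af im Qxx.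
apply: (eps_solution_of_certificate cx cy Qxx Qyy be Qv near).
rewrite (primalE ad af im) // /psi.
have := saddle_y Qyy; have := mulr_ge0 (ltW (muy_gt0 ad)) (sqn_ge0 (y - ys)); lra.
Qed.

Lemma eps_solution_far_start (bx by_ : R) x y :
  x_certificate bx x y -> y_certificate by_ x y -> Qx d x -> Qy d y ->
  bx ^+ 2 / (2 * mux d) + by_ ^+ 2 / (2 * muy d) <= eps d ->
  Lxy d * enorm (x - xs) <= muy d * Ry d ys ->
  eps_solution d r F h xs ys (x, y).
Proof.
move=> cx cy Qxx Qyy be far; apply: (eps_solution_local cx cy Qxx Qyy be).
have [Qxs _] := hxs.
have lip := ystar_lipschitz ad af Qxx Qxs (ystarP ad af im Qxx) hys.
have h1 := le_trans lip far.
rewrite (ler_pM2l (muy_gt0 ad)) in h1.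
have := enorm_tri ys (ystar d F h x) (y0 d).
rewrite (enormBC ys) -/(Ry d ys); lra.
Qed.

(* A fixed point of the step in [y] is an exact inner maximizer. *)
Lemma eps_solution_fixed_start (bx by_ La kap : R) x y :
  x_certificate bx x y -> y_certificate by_ x y -> Qx d x -> Qy d y ->
  bx ^+ 2 / (2 * mux d) + by_ ^+ 2 / (2 * muy d) <= eps d ->
  model_step_spec La (muy d) kap (Qy d) h (- gy x (y0 d)) (y0 d) (y0 d) ->
  eps_solution d r F h xs ys (x, y).
Proof.
move=> cx cy Qxx Qyy be [Qy0 [e he hu]].
apply: (eps_solution_local cx cy Qxx Qyy be).
have ys0 : is_ystar d F h x (y0 d).
  split => // v Qv; have := hu v Qv; have := F_upper_y af Qxx Qy0 Qv.
  have e0 : e = 0.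
    apply: enorm_eq0; apply/eqP; rewrite eq_le enorm_ge0 andbT.
    by apply: le_trans he _; rewrite subrr enorm0 mulr0.
  rewrite e0 subrr scaler0 subr0 addr0 opprK.
  have := mulr_ge0 (ltW (muy_gt0 ad)) (sqn_ge0 (v - y0 d)); lra.
rewrite -(ystar_unique ad af Qxx ys0 (ystarP ad af im Qxx)) subrr enorm0.
by rewrite mulr_ge0 // enorm_ge0.
Qed.

End Certificate.

(** * Normalizing the Lipschitz constants of the accessed functions *)

Section EffectiveAccess.
Context {R : realType} {k n m : nat} (O : oracles R n m).
Implicit Types (u v : 'rV[R]_k) (Q : set 'rV[R]_k) (f : 'rV[R]_k -> R)
  (gf : 'rV[R]_k -> 'rV[R]_k).
Notation progm := (prog (R := R) (n := n) (m := m)).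

(* A gradient whose Lipschitz constant is below the strong convexity modulus
   forces the domain to be a single point, where no call is needed. *)
Definition eff_access (mu : R) (a : @access R) : @access R :=
  if a is Grad L then Grad (Num.max L mu) else Prox.

Definition eff_grad (mu : R) (a : @access R) gf : 'rV[R]_k -> 'rV[R]_k :=
  if a is Grad L then if L < mu then fun=> 0 else gf else gf.

Definition eff_grad_prog (mu : R) (a : @access R)
    (pg : 'rV[R]_k -> progm 'rV[R]_k) : 'rV[R]_k -> progm 'rV[R]_k :=
  if a is Grad L then if L < mu then fun=> ret 0 else pg else pg.

Definition eff_cost (mu : R) (a : @access R) (cg cp : cost) : cost :=
  if a is Grad L then if L < mu then cost0 else cg else cp.

Lemma eff_provides (mu : R) a Q f gf Pf : 0 < mu -> convex_set Q ->
  strongly_convex Q mu f -> provides a Q f gf Pf ->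
  provides (eff_access mu a) Q f (eff_grad mu a gf) Pf.
Proof.
move=> mu0 cQ cf; case: a => [//|L] /= lg; rewrite /eff_grad /eff_access.
have fo := strongly_convex_first_order (ltW mu0) cf (segment_gradient_lipschitz cQ lg).
case: (lg) => L0 near lip.
case: ltP => Lmu; last by [].
have single u v : Q u -> Q v -> u = v.
  move=> Qu Qv; apply/eqP; rewrite -subr_eq0; apply/eqP; apply: enorm_eq0.
  have h := sqn_le_enorm (ltW mu0) (strong_monotone (fo u v Qu Qv) (fo v u Qv Qu)).
  have h2 := le_trans h (lip u v Qu Qv).
  have h3 : 0 <= (L - mu) * enorm (u - v) by lra.
  rewrite nmulr_rge0 ?subr_lt0 // in h3.
  by apply/eqP; rewrite eq_le h3 enorm_ge0.
split; first exact: ltW.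
  move=> u Qu e e0; rewrite near_withinE; apply: nearW => v Qv.
  by rewrite (single v u Qv Qu) !subrr dot0l subr0 normr0 enorm0 mulr0.
by move=> u v Qu Qv; rewrite subrr enorm0 mulr_ge0 ?enorm_ge0 // ltW.
Qed.

Lemma eff_implemented (mu : R) a Q gf Pf pg pp (cg cp : cost) :
  (forall u, hoare O (pg u) (fun w => w = gf u) cg) ->
  (forall t, hoare O (pp t) (fun w => w = Pf t) cp) ->
  implemented_by O (eff_access mu a) Q (eff_grad mu a gf) Pf
    (eff_grad_prog mu a pg) pp (eff_cost mu a cg cp).
Proof.
move=> hg hp; case: a => [|L] /=; first exact: hp.
rewrite /eff_grad /eff_grad_prog /eff_cost => u Qu.
by case: ifP => _; [exact: hoare_ret | exact: hg].
Qed.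

Lemma eff_well_scaled (mu T : R) a : mu <= pw T 1 -> access_const a <= pw T 1 ->
  well_scaled (eff_access mu a) mu T.
Proof.
by case: a => [//|L] /= h1 h2; rewrite le_max lexx orbT ge_max h1 h2.
Qed.

End EffectiveAccess.

(** * The nested solver under assumed radii *)

Section SaddleSolver.
Context {R : realType} {n m : nat} (d : data R n m) (ax ay : @access R).
Notation progm := (prog (R := R) (n := n) (m := m)).

Definition call_gradR : 'rV[R]_n -> progm 'rV[R]_n := fun u K => Call (o := GradR) u K.
Definition call_proxR : 'rV[R]_n * R -> progm 'rV[R]_n := fun t K => Call (o := ProxR) t K.
Definition call_gradH : 'rV[R]_m -> progm 'rV[R]_m := fun u K => Call (o := GradH) u K.
Definition call_proxH : 'rV[R]_m * R -> progm 'rV[R]_m := fun t K => Call (o := ProxH) t K.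
Definition call_gradFx : 'rV[R]_n * 'rV[R]_m -> progm 'rV[R]_n :=
  fun z K => Call (o := GradFx) z K.
Definition call_gradFy : 'rV[R]_n * 'rV[R]_m -> progm 'rV[R]_m :=
  fun z K => Call (o := GradFy) z K.

(** The 2 is the loss in [psi_smooth]; the maximum makes the constant at least the modulus of strong
    convexity, as the accelerated methods require. *)
Definition Lbx : R := 2 * Num.max (Lpsi d) (mux d).
Definition Lby : R := 2 * Num.max (Lyy d) (muy d).

Definition prog_gradR := eff_grad_prog (mux d) ax call_gradR.
Definition prog_gradH := eff_grad_prog (muy d) ay call_gradH.
Definition costR : cost := eff_cost (mux d) ax (cost1 GradR) (cost1 ProxR).
Definition costH : cost := eff_cost (muy d) ay (cost1 GradH) (cost1 ProxH).

(** Multiplied by [Lxy], at most [pw T 1], the error [pw T (- (2 * c + 19))] in [y] becomes the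
    gradient error [pw T (- (2 * c + 18))] that the outer solve tolerates. The scale is [10 * T]
    because queries [x] may be [pw T 7] away from [xs], which moves the maximizer by up to [pw T 9];
    together with [Ry] the starting distance is at most [pw T 10]. *)
Definition ysolve (c T : R) (x : 'rV[R]_n) : progm 'rV[R]_m :=
  composite (eff_access (muy d) ay) (Qy d) (muy d) Lby (2 * c + 19) (10 * T)
    prog_gradH call_proxH
    (fun y => bind (call_gradFy (x, y)) (fun ge => ret (- ge))) (y0 d).

Definition xsolve (c T : R) : progm 'rV[R]_n :=
  composite (eff_access (mux d) ax) (Qx d) (mux d) Lbx c T
    prog_gradR call_proxR
    (fun x => bind (ysolve c T x) (fun y => call_gradFx (x, y))) (x0 d).

Definition saddle_solve (c T : R) : progm ('rV[R]_n * 'rV[R]_m) :=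
  bind (xsolve c T) (fun x => bind (ysolve c T x) (fun y => ret (x, y))).

Definition ysolve_cost (c T : R) : cost :=
  composite_cost (eff_access (muy d) ay) (muy d) Lby (2 * c + 19) (10 * T)
    costH (cost1 GradFy).

Definition xsolve_cost (c T : R) : cost :=
  composite_cost (eff_access (mux d) ax) (mux d) Lbx c T
    costR (costD (ysolve_cost c T) (cost1 GradFx)).

Record scale_ok (T : R) : Prop := {
  scale_ge1 : 1 <= T;
  scale_mux : pw T (-1) <= mux d;
  scale_muy : pw T (-1) <= muy d;
  scale_mux' : mux d <= pw T 1;
  scale_muy' : muy d <= pw T 1;
  scale_Lxx : Lxx d <= pw T 1;
  scale_Lxy : Lxy d <= pw T 1;
  scale_Lyy : Lyy d <= pw T 1;
  scale_ax : access_const ax <= pw T 1;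
  scale_ay : access_const ay <= pw T 1;
  scale_eps : pw T (-1) <= eps d }.

Variables (r : 'rV[R]_n -> R) (F : 'rV[R]_n -> 'rV[R]_m -> R) (h : 'rV[R]_m -> R).
Variable O : oracles R n m.
Hypotheses (ad : admissible_data d) (af : admissible_functions d r F h)
  (im : implements d ax ay r F h O).
Variables (xs : 'rV[R]_n) (ys : 'rV[R]_m).
Hypotheses (hxs : is_xstar d r F h xs) (hys : is_ystar d F h xs ys).

Lemma r_effective : provides (eff_access (mux d) ax) (Qx d) r
  (eff_grad (mux d) ax (@O GradR)) (@O ProxR).
Proof.
exact: eff_provides (mux_gt0 ad) (Qx_convex ad) (r_strongly_convex af) (r_spec im).
Qed.

Lemma h_effective : provides (eff_access (muy d) ay) (Qy d) h
  (eff_grad (muy d) ay (@O GradH)) (@O ProxH).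
Proof.
exact: eff_provides (muy_gt0 ad) (Qy_convex ad) (h_strongly_convex af) (h_spec im).
Qed.

Lemma r_implemented : implemented_by O (eff_access (mux d) ax) (Qx d)
  (eff_grad (mux d) ax (@O GradR)) (@O ProxR) prog_gradR call_proxR costR.
Proof.
apply: eff_implemented => u; first exact: (@hoare_call R n m O GradR u).
exact: (@hoare_call R n m O ProxR u).
Qed.

Lemma h_implemented : implemented_by O (eff_access (muy d) ay) (Qy d)
  (eff_grad (muy d) ay (@O GradH)) (@O ProxH) prog_gradH call_proxH costH.
Proof.
apply: eff_implemented => u; first exact: (@hoare_call R n m O GradH u).
exact: (@hoare_call R n m O ProxH u).
Qed.

Lemma gradFx_correct x y : Qx d x -> Qy d y ->
  hoare O (call_gradFx (x, y)) (fun g => g = grad (F ^~ y) x) (cost1 GradFx).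
Proof.
move=> Qxx Qyy; apply: (hoare_weaken (@hoare_call R n m O GradFx (x, y))) => // g ->.
exact: (GradFx_spec im).
Qed.

Lemma gradFy_correct x y : Qx d x -> Qy d y ->
  hoare O (call_gradFy (x, y)) (fun g => g = grad (F x) y) (cost1 GradFy).
Proof.
move=> Qxx Qyy; apply: (hoare_weaken (@hoare_call R n m O GradFy (x, y))) => // g ->.
exact: (GradFy_spec im).
Qed.

Lemma pw_rescale (s T a : R) : pw (s * T) a = pw T (s * a).
Proof. by rewrite /pw; congr expR; ring. Qed.

Lemma ystar_distance T a x y : scale_ok T -> Qx d x ->
  enorm (x - xs) <= pw T a -> enorm (y - ystar d F h x) <= pw T (a + 2) ->
  enorm (y - ys) <= pw T (a + 3).
Proof.
move=> sc Qxx xa ya; have [Qxs _] := hxs; have T1 := scale_ge1 sc.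
have lip := ystar_lipschitz ad af Qxx Qxs (ystarP ad af im Qxx) hys.
have h1 : enorm (ystar d F h x - ys) <= (muy d)^-1 * (Lxy d * enorm (x - xs)).
  by rewrite mulrC ler_pdivlMr ?(muy_gt0 ad) // mulrC.
have h2 : (muy d)^-1 * (Lxy d * enorm (x - xs)) <= pw T (1 + (1 + a)).
  apply: pw_mul; rewrite ?invr_ge0 ?(ltW (muy_gt0 ad)) ?mulr_ge0 ?(Lxy_ge0 ad) ?enorm_ge0 //.
    rewrite -[1]opprK; exact: (pw_inv (scale_muy sc)).
  by apply: pw_mul; rewrite ?(Lxy_ge0 ad) ?enorm_ge0 ?(scale_Lxy sc).
apply: le_trans (enorm_tri (ystar d F h x) _ _) _.
have -> : a + 3 = (a + 2) + 1 by ring.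
apply: pw_add => //; apply: le_trans h1 _; apply: (pw_trans T1 h2); lra.
Qed.

Lemma ysolve_correct c T x : scale_ok T -> 0 <= c -> Ry d ys <= pw T 1 ->
  Qx d x -> enorm (x - xs) <= pw T 7 ->
  hoare O (ysolve c T x)
    (fun y => Qy d y /\ enorm (y - ystar d F h x) <= pw T (- (2 * c + 19)))
    (ysolve_cost c T).
Proof.
move=> sc c0 RyT Qxx xT; have T1 := scale_ge1 sc.
have T1' : 1 <= 10 * T by lra.
have [Qxs _] := hxs; have [Qys _] := ystarP ad af im Qxx.
have two := pw_ge2 T1.
have start : enorm (y0 d - ystar d F h x) <= pw (10 * T) 1.
  rewrite pw_rescale mulr1.
  have h1 : enorm (ys - ystar d F h x) <= pw T (1 + (1 + 7)).
    have lip := ystar_lipschitz ad af Qxx Qxs (ystarP ad af im Qxx) hys.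
    apply: (@le_trans _ _ ((muy d)^-1 * (Lxy d * enorm (x - xs)))).
      by rewrite mulrC enormBC ler_pdivlMr ?(muy_gt0 ad) // mulrC.
    apply: pw_mul; rewrite ?invr_ge0 ?(ltW (muy_gt0 ad)) ?mulr_ge0 ?(Lxy_ge0 ad) ?enorm_ge0 //.
      rewrite -[X in pw _ X]opprK; exact: (pw_inv (scale_muy sc)).
    by apply: pw_mul; rewrite ?(Lxy_ge0 ad) ?enorm_ge0 ?(scale_Lxy sc).
  apply: le_trans (enorm_tri ys _ _) _.
  have -> : 10 = 9 + 1 :> R by ring.
  apply: (pw_add T1); first by apply: (pw_trans T1 RyT); lra.
  by apply: (pw_trans T1 h1); lra.
have sm : smooth_on (Qy d) (fun y => - F x y) (fun y => - grad (F x) y) Lby.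
  apply: smooth_onW (smooth_on_negFy af Qxx).
  by rewrite /Lby ler_wpM2l // le_max lexx.
have big a : a <= 50 -> pw T a <= pw (10 * T) 5.
  by move=> a50; rewrite pw_rescale; apply: pw_mono => //; lra.
have c19 : 0 <= 2 * c + 19 by lra.
suff hc : hoare O (ysolve c T x) (fun y => Qy d y /\
    enorm (y - ystar d F h x) <= pw (10 * T) (- (2 * c + 19))) (ysolve_cost c T).
  apply: (hoare_weaken hc) => // y [Qyy hy]; split => //; apply: le_trans hy _.
  by rewrite pw_rescale; apply: pw_mono => //; lra.
apply: (composite_correct T1' c19 _ _ _ _ (Qy_convex ad)
  (Qy_compact ad) (h_strongly_convex af) h_effective h_implemented sm Qys _ (y0_in ad)
  start _).
- rewrite pw_rescale; apply: le_trans (scale_muy sc); apply: pw_mono => //; lra.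
- by rewrite /Lby; have : muy d <= Num.max (Lyy d) (muy d) by [rewrite le_max lexx orbT];
    have := muy_gt0 ad; lra.
- apply: le_trans (big (1 + 1) _); last lra.
  apply: pw_mul => //; rewrite ?le_max ?(Lyy_ge0 ad) //.
  by rewrite ge_max (scale_Lyy sc) (scale_muy' sc).
- apply: eff_well_scaled; rewrite pw_rescale mulr1.
    apply: (pw_trans T1 (scale_muy' sc)); lra.
  apply: (pw_trans T1 (scale_ay sc)); lra.
- by move=> u Qu; have [_ ym] := ystarP ad af im Qxx; have := ym u Qu; lra.
- move=> y Qyy _.
  have hr g : g = grad (F x) y -> hoare O (ret (- g))
     (fun ge => enorm (ge - - grad (F x) y) <= pw (10 * T) (- (2 * (2 * c + 19) + 18))) cost0.
    by move=> ->; apply: hoare_ret; rewrite subrr enorm0 pw_ge0.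
  apply: (hoare_weaken (hoare_bind (gradFy_correct Qxx Qyy) hr)) => // i.
  by rewrite /costD addn0.
Qed.

Lemma xsolve_correct c T : scale_ok T -> 0 <= c -> Rx d xs <= pw T 1 ->
  Ry d ys <= pw T 1 ->
  hoare O (xsolve c T) (fun x => Qx d x /\ enorm (x - xs) <= pw T (- c))
    (xsolve_cost c T).
Proof.
move=> sc c0 RxT RyT; have T1 := scale_ge1 sc.
have [Qxs _] := hxs; have two := pw_ge2 T1.
have muyV : (muy d)^-1 <= pw T 1 by rewrite -[X in pw _ X]opprK; exact: (pw_inv (scale_muy sc)).
have Lp0 : 0 <= Lpsi d.
  by rewrite /Lpsi addr_ge0 ?(Lxx_ge0 ad) // divr_ge0 ?sqr_ge0 // ltW ?(muy_gt0 ad).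
have Lp4 : Lpsi d <= pw T (3 + 1).
  apply: pw_add => //; first by apply: (pw_trans T1 (scale_Lxx sc)); lra.
  apply: (@pw_trans _ _ ((1 + 1) + 1)) => //; last lra.
  apply: pw_mul; rewrite ?sqr_ge0 ?invr_ge0 ?(ltW (muy_gt0 ad)) //.
  exact: pw_sqr (Lxy_ge0 ad) (scale_Lxy sc).
have sm : smooth_on (Qx d) (psi d F h) (fun x => grad (F ^~ (ystar d F h x)) x) Lbx.
  apply: smooth_onW (psi_smooth ad af im).
  by rewrite /Lbx ler_wpM2l // le_max lexx.
apply: (composite_correct T1 c0 (scale_mux sc) _ _ _ (Qx_convex ad)
  (Qx_compact ad) (r_strongly_convex af) r_effective r_implemented sm Qxs
  (xstar_min ad af im hxs) (x0_in ad) RxT _).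
- by rewrite /Lbx; have : mux d <= Num.max (Lpsi d) (mux d) by [rewrite le_max lexx orbT];
    have := mux_gt0 ad; lra.
- apply: (@pw_trans _ _ (1 + (3 + 1))) => //; last lra.
  apply: pw_mul => //; rewrite ?le_max ?Lp0 //.
  rewrite ge_max Lp4 /=; apply: (pw_trans T1 (scale_mux' sc)); lra.
- exact: eff_well_scaled (scale_mux' sc) (scale_ax sc).
- move=> x Qxx xT.
  have hr y : Qy d y /\ enorm (y - ystar d F h x) <= pw T (- (2 * c + 19)) ->
     hoare O (call_gradFx (x, y)) (fun ge =>
       enorm (ge - grad (F ^~ (ystar d F h x)) x) <= pw T (- (2 * c + 18))) (cost1 GradFx).
    move=> [Qyy hy]; apply: (hoare_weaken (gradFx_correct Qxx Qyy)) => // g ->.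
    have [Qyx _] := ystarP ad af im Qxx.
    apply: le_trans (F_Lxy af Qxx Qyy Qyx) _.
    apply: (@pw_trans _ _ (1 + - (2 * c + 19))) => //; last lra.
    by apply: pw_mul; rewrite ?(Lxy_ge0 ad) ?enorm_ge0 ?(scale_Lxy sc).
  exact: hoare_bind (ysolve_correct sc c0 RyT Qxx xT) hr.
Qed.

Lemma saddle_solve_correct c T : scale_ok T -> 0 <= c -> Rx d xs <= pw T 1 ->
  Ry d ys <= pw T 1 ->
  hoare O (saddle_solve c T)
    (fun s => [/\ Qx d s.1, Qy d s.2, enorm (s.1 - xs) <= pw T (- c) &
       enorm (s.2 - ys) <= pw T (3 - c)])
    (costD (xsolve_cost c T) (ysolve_cost c T)).
Proof.
move=> sc c0 RxT RyT; have T1 := scale_ge1 sc.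
apply: (hoare_bind (xsolve_correct sc c0 RxT RyT)) => x [Qxx xT].
have xT7 : enorm (x - xs) <= pw T 7 by apply: (pw_trans T1 xT); lra.
have hr y : Qy d y /\ enorm (y - ystar d F h x) <= pw T (- (2 * c + 19)) ->
  hoare O (ret (x, y)) (fun s => [/\ Qx d s.1, Qy d s.2, enorm (s.1 - xs) <= pw T (- c) &
       enorm (s.2 - ys) <= pw T (3 - c)]) cost0.
  move=> [Qyy hy]; apply: hoare_ret; split => //=.
  have -> : 3 - c = - c + 3 by ring.
  apply: (ystar_distance sc Qxx xT).
  by apply: (pw_trans T1 hy); lra.
apply: (hoare_weaken (hoare_bind (ysolve_correct sc c0 RyT Qxx xT7) hr)) => // i.
by rewrite /costD addn0.
Qed.

End SaddleSolver.

(** * Certified stages *)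

Section Totality.
Context {R : realType} {k n m : nat} (O : oracles R n m).
Implicit Types (u v w x y z : 'rV[R]_k) (Q : set 'rV[R]_k).
Notation progm := (prog (R := R) (n := n) (m := m)).
Notation total p c := (hoare O p (fun=> True) c).

(** Costs are bounded here without any claim on results: a stage that guesses the radii wrongly must
    still finish within its count. *)
Lemma hoare_total (A : Type) (p : progm A) (P : A -> Prop) (c : cost) :
  hoare O p P c -> total p c.
Proof. by move=> hp; apply: (hoare_weaken hp). Qed.

Lemma total_bind (A B : Type) (p : progm A) (q : A -> progm B) (c c' : cost) :
  total p c -> (forall a, total (q a) c') -> total (bind p q) (costD c c').
Proof. by move=> hp hq; apply: (hoare_bind hp) => a _; exact: hq. Qed.

Lemma total_bind_ret (A B : Type) (p : progm A) (f : A -> B) (c : cost) :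
  total p c -> total (bind p (fun a => ret (f a))) c.
Proof.
move=> hp; apply: (hoare_weaken (total_bind hp (fun a => hoare_ret O cost0 I))) => // i.
by rewrite /costD addn0.
Qed.

Lemma total_iterate (A : Type) (q : A -> progm A) (c : cost) N a :
  (forall a, total (q a) c) -> total (iterate N q a) (costM N c).
Proof. by move=> hq; apply: (@hoare_iterate _ _ _ O A q (fun _ _ => True)). Qed.

Lemma total_agd (G : 'rV[R]_k -> progm 'rV[R]_k)
    (PX : 'rV[R]_k -> 'rV[R]_k -> R -> progm 'rV[R]_k) (L mu : R) N x cg cp :
  (forall y, total (G y) cg) -> (forall c z tau, total (PX c z tau) cp) ->
  total (agd G PX L mu N x) (costM N.+1 (costD cg cp)).
Proof.
move=> hG hP.
have hs th tau s : total (agd_step G PX th tau s) (costD cg cp).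
  apply: total_bind => [|ge]; first exact: hG.
  exact: total_bind_ret.
by apply: (hoare_weaken (total_bind (hs _ _ _) (fun a => total_iterate N a (hs _ _)))).
Qed.

Lemma total_sliding (GP GQ : 'rV[R]_k -> progm 'rV[R]_k) Q (mu Lp Lq : R) N1 N2 x cp cq :
  (forall y, total (GP y) cp) -> (forall y, total (GQ y) cq) ->
  total (sliding GP GQ Q mu Lp Lq N1 N2 x)
    (costM N1.+1 (costD cp (costM N2.+1 cq))).
Proof.
move=> hP hQ.
have hs th s : total (sliding_step GP GQ Q mu Lp Lq th N2 s)
    (costD cp (costM N2.+1 cq)).
  case: s => x' z'; apply: total_bind => [|gp]; first exact: hP.
  apply: total_bind_ret.
  apply: (hoare_weaken (total_agd _ _ _ _ (cg := cq) (cp := cost0) _ _)) => //.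
  - by move=> y; exact: total_bind_ret.
  - by move=> c z tau; exact: hoare_ret.
  - by move=> i; rewrite /costM /costD addn0.
by apply: (hoare_weaken (total_bind (hs _ _) (fun a => total_iterate N1 a (hs _)))).
Qed.

Lemma total_composite (a : @access R) Q (mu Lb c T : R) pg pp GB x0 ca cb :
  (forall u, a <> Prox -> total (pg u) ca) -> (forall t, a = Prox -> total (pp t) ca) ->
  (forall u, total (GB u) cb) ->
  total (composite a Q mu Lb c T pg pp GB x0) (composite_cost a mu Lb c T ca cb).
Proof.
case: a => [|L] hg hp hb /=.
  apply: total_bind_ret; apply: total_agd => // d z tau; exact: hp.
by case: ifP => _; apply: total_bind_ret; apply: total_sliding => // y;
  apply: total_bind_ret; apply: hg.
Qed.

End Totality.

Section Stage.
Context {R : realType} {n m : nat} (d : data R n m) (ax ay : @access R).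
Notation progm := (prog (R := R) (n := n) (m := m)).

Lemma costR_total O (u : 'rV[R]_n) : eff_access (mux d) ax <> Prox ->
  hoare O (prog_gradR d ax u) (fun=> True) (costR d ax).
Proof.
rewrite /prog_gradR /eff_grad_prog /costR; case: ax => [//|L] _ /=.
case: ifP => _; first exact: hoare_ret.
by apply: (hoare_total (@hoare_call R n m O GradR u)).
Qed.

Lemma costR_total_prox O (t : 'rV[R]_n * R) : eff_access (mux d) ax = Prox ->
  hoare O (call_proxR (m := m) t) (fun=> True) (costR d ax).
Proof.
rewrite /costR; case: ax => [_|//] /=.
by apply: (hoare_total (@hoare_call R n m O ProxR t)).
Qed.

Lemma costH_total O (u : 'rV[R]_m) : eff_access (muy d) ay <> Prox ->
  hoare O (prog_gradH d ay u) (fun=> True) (costH d ay).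
Proof.
rewrite /prog_gradH /eff_grad_prog /costH; case: ay => [//|L] _ /=.
case: ifP => _; first exact: hoare_ret.
by apply: (hoare_total (@hoare_call R n m O GradH u)).
Qed.

Lemma costH_total_prox O (t : 'rV[R]_m * R) : eff_access (muy d) ay = Prox ->
  hoare O (call_proxH (n := n) t) (fun=> True) (costH d ay).
Proof.
rewrite /costH; case: ay => [_|//] /=.
by apply: (hoare_total (@hoare_call R n m O ProxH t)).
Qed.

Lemma ysolve_total O c T x :
  hoare O (ysolve d ay c T x) (fun=> True) (ysolve_cost d ay c T).
Proof.
apply: total_composite => [u|t|y]; [exact: costH_total|exact: costH_total_prox|].
by apply: total_bind_ret; apply: (hoare_total (@hoare_call R n m O GradFy (x, y))).
Qed.

Lemma xsolve_total O c T :
  hoare O (xsolve d ax ay c T) (fun=> True) (xsolve_cost d ax ay c T).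
Proof.
apply: total_composite => [u|t|x]; [exact: costR_total|exact: costR_total_prox|].
apply: total_bind => [|y]; first exact: ysolve_total.
by apply: (hoare_total (@hoare_call R n m O GradFx (x, y))).
Qed.

Lemma saddle_solve_total O c T :
  hoare O (saddle_solve d ax ay c T) (fun=> True)
    (costD (xsolve_cost d ax ay c T) (ysolve_cost d ay c T)).
Proof.
apply: total_bind => [|x]; first exact: xsolve_total.
by apply: total_bind_ret; exact: ysolve_total.
Qed.

(** Positive, and at least the gradient's Lipschitz constant, which is what [model_step_stable] asks
    of the weight. *)
Definition kapx : R := mux d + access_const (eff_access (mux d) ax).
Definition kapy : R := muy d + access_const (eff_access (muy d) ay).

Definition xstep x y : progm 'rV[R]_n :=
  bind (call_gradFx (x, y)) (fun g =>
    model_step (eff_access (mux d) ax) (Qx d) kapx (prog_gradR d ax) (call_proxR (m := m)) g x).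

Definition ystep x y : progm 'rV[R]_m :=
  bind (call_gradFy (x, y)) (fun g =>
    model_step (eff_access (muy d) ay) (Qy d) kapy (prog_gradH d ay) (call_proxH (n := n)) (- g) y).

Definition xstep_cost : cost := costD (cost1 GradFx) (costR d ax).
Definition ystep_cost : cost := costD (cost1 GradFy) (costH d ay).

(** Membership is tested rather than derived, so that soundness needs nothing from the solver when
    the radii are guessed wrongly. The choice 40: the solver reaches [pw T (-40)] in [x] and
    [pw T (-37)] in [y], a step loses at most 6 in the exponent, and the triangle inequality one
    more, so with correct radii both displacements pass the test at [pw T (-30)]. *)
Definition stage (T : R) : progm (option ('rV[R]_n * 'rV[R]_m)) :=
  bind (saddle_solve d ax ay 40 T) (fun s =>
  if `[< Qx d s.1 /\ Qy d s.2 >] then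
    bind (xstep s.1 s.2) (fun xh =>
    bind (ystep s.1 s.2) (fun yh =>
    ret (if (enorm (xh - s.1) <= pw T (-30)) && (enorm (yh - s.2) <= pw T (-30))
         then Some (xh, yh) else None)))
  else ret None).

Definition stage_cost (T : R) : cost :=
  costD (costD (xsolve_cost d ax ay 40 T) (ysolve_cost d ay 40 T))
    (costD xstep_cost ystep_cost).

Variables (r : 'rV[R]_n -> R) (F : 'rV[R]_n -> 'rV[R]_m -> R) (h : 'rV[R]_m -> R).
Variable O : oracles R n m.
Hypotheses (ad : admissible_data d) (af : admissible_functions d r F h)
  (im : implements d ax ay r F h O).

Definition xstep_spec x y xh : Prop :=
  model_step_spec (access_const (eff_access (mux d) ax)) (mux d) kapx (Qx d) r
    (grad (F ^~ y) x) x xh.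

Definition ystep_spec x y yh : Prop :=
  model_step_spec (access_const (eff_access (muy d) ay)) (muy d) kapy (Qy d) h
    (- grad (F x) y) y yh.

Lemma eff_const_ge0 (mu : R) a : 0 < mu -> 0 <= access_const (eff_access mu a).
Proof. by move=> mu0; case: a => [//|L] /=; rewrite le_max (ltW mu0) orbT. Qed.

Lemma kapx_gt0 : 0 < kapx.
Proof. by rewrite /kapx ltr_wpDr ?eff_const_ge0 ?(mux_gt0 ad). Qed.

Lemma kapy_gt0 : 0 < kapy.
Proof. by rewrite /kapy ltr_wpDr ?eff_const_ge0 ?(muy_gt0 ad). Qed.

Lemma xstep_correct x y : Qx d x -> Qy d y ->
  hoare O (xstep x y) (xstep_spec x y) xstep_cost.
Proof.
move=> Qxx Qyy; apply: (hoare_bind (gradFx_correct im Qxx Qyy)) => g ->.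
exact: (model_step_correct _ (mux_gt0 ad) kapx_gt0 (Qx_convex ad) (Qx_compact ad)
  (r_strongly_convex af) (r_effective ad af im) (r_implemented d ax O) Qxx).
Qed.

Lemma ystep_correct x y : Qx d x -> Qy d y ->
  hoare O (ystep x y) (ystep_spec x y) ystep_cost.
Proof.
move=> Qxx Qyy; apply: (hoare_bind (gradFy_correct im Qxx Qyy)) => g ->.
exact: (model_step_correct _ (muy_gt0 ad) kapy_gt0 (Qy_convex ad) (Qy_compact ad)
  (h_strongly_convex af) (h_effective ad af im) (h_implemented d ay O) Qyy).
Qed.

Definition certified T xh yh : Prop := exists x, exists y,
  [/\ [/\ Qx d x & Qy d y], xstep_spec x y xh, ystep_spec x y yh,
      enorm (xh - x) <= pw T (-30) & enorm (yh - y) <= pw T (-30)].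

Lemma stage_sound T :
  hoare O (stage T) (fun o => if o is Some s then certified T s.1 s.2 else True)
    (stage_cost T).
Proof.
apply: (hoare_bind (saddle_solve_total O 40 T)) => s _.
case: ifPn => [/asboolP [Qxx Qyy]|_]; last exact: hoare_ret.
apply: (hoare_bind (xstep_correct Qxx Qyy)) => xh hx.
have hr yh : ystep_spec s.1 s.2 yh -> hoare O
  (ret (if (enorm (xh - s.1) <= pw T (-30)) && (enorm (yh - s.2) <= pw T (-30))
         then Some (xh, yh) else None))
  (fun o => if o is Some s then certified T s.1 s.2 else True) cost0.
  move=> hy; apply: hoare_ret; case: ifP => // /andP [cx cy].
  by exists s.1, s.2.
apply: (hoare_weaken (hoare_bind (ystep_correct Qxx Qyy) hr)) => // i.
by rewrite /costD addn0.
Qed.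

Variables (xs : 'rV[R]_n) (ys : 'rV[R]_m).
Hypotheses (hxs : is_xstar d r F h xs) (hys : is_ystar d F h xs ys).

Lemma eff_const_scale T (mu : R) a : mu <= pw T 1 -> access_const a <= pw T 1 ->
  access_const (eff_access mu a) <= pw T 1.
Proof.
move=> h1; case: a => [|L] /= h2; first exact: pw_ge0.
by rewrite ge_max h1 h2.
Qed.

Lemma kapx_scale T : scale_ok d ax ay T ->
  kapx + access_const (eff_access (mux d) ax) <= pw T 3.
Proof.
move=> sc; have T1 := scale_ge1 sc.
have h1 := eff_const_scale (scale_mux' sc) (scale_ax sc).
have h2 := pw_add T1 (scale_mux' sc) h1.
have := pw_add T1 h2 (pw_trans T1 h1 (_ : 1 <= 1 + 1)); rewrite -/kapx.
by move=> h3; apply: (pw_trans T1 (h3 _)); lra.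
Qed.

Lemma kapy_scale T : scale_ok d ax ay T ->
  kapy + access_const (eff_access (muy d) ay) <= pw T 3.
Proof.
move=> sc; have T1 := scale_ge1 sc.
have h1 := eff_const_scale (scale_muy' sc) (scale_ay sc).
have h2 := pw_add T1 (scale_muy' sc) h1.
have := pw_add T1 h2 (pw_trans T1 h1 (_ : 1 <= 1 + 1)); rewrite -/kapy.
by move=> h3; apply: (pw_trans T1 (h3 _)); lra.
Qed.

Lemma xstep_near T a x y xh : scale_ok d ax ay T -> Qx d x -> Qy d y ->
  enorm (x - xs) <= pw T a -> enorm (y - ys) <= pw T a ->
  xstep_spec x y xh -> enorm (xh - xs) <= pw T (a + 6).
Proof.
move=> sc Qxx Qyy xa ya hx; have T1 := scale_ge1 sc.
have [Qxs _] := hxs; have [Qys _] := hys.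
have hs := model_step_stable (mux_gt0 ad) (eff_const_ge0 ax (mux_gt0 ad)) _ hx Qxs
  (fun u Qu => xstar_optimality ad af im hxs hys Qu).
have {}hs := hs _; rewrite {1}/kapx in hs.
have hg : enorm (grad (F ^~ y) x - grad (F ^~ ys) xs) <= pw T (1 + a + 1).
  apply: le_trans (enorm_tri (grad (F ^~ y) xs) _ _) _; apply: (pw_add T1).
    apply: le_trans (F_Lxx af Qxx Qxs Qyy) _.
    by apply: pw_mul; rewrite ?(Lxx_ge0 ad) ?enorm_ge0 ?(scale_Lxx sc).
  apply: le_trans (F_Lxy af Qxs Qyy Qys) _.
  by apply: pw_mul; rewrite ?(Lxy_ge0 ad) ?enorm_ge0 ?(scale_Lxy sc).
have K0 : 0 <= kapx + access_const (eff_access (mux d) ax).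
  by rewrite addr_ge0 ?(ltW kapx_gt0) ?eff_const_ge0 ?(mux_gt0 ad).
have hk := pw_mul K0 (kapx_scale sc) (enorm_ge0 _) xa.
have hm : mux d * enorm (xh - xs) <= pw T (a + 5).
  have h1 : enorm (grad (F ^~ y) x - grad (F ^~ ys) xs) <= pw T (3 + a).
    by apply: (pw_trans T1 hg); lra.
  apply: (pw_trans T1 (le_trans (hs _) (pw_add T1 h1 hk))); last lra.
  by rewrite lerDr ltW ?(mux_gt0 ad).
have -> : enorm (xh - xs) = (mux d)^-1 * (mux d * enorm (xh - xs)).
  by rewrite mulKf // gt_eqF ?(mux_gt0 ad).
have -> : a + 6 = 1 + (a + 5) by ring.
apply: pw_mul; rewrite ?invr_ge0 ?mulr_ge0 ?enorm_ge0 ?(ltW (mux_gt0 ad)) //.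
rewrite -[X in pw _ X]opprK; exact: (pw_inv (scale_mux sc)).
Qed.

Lemma ystep_near T a x y yh : scale_ok d ax ay T -> Qx d x -> Qy d y ->
  enorm (x - xs) <= pw T a -> enorm (y - ys) <= pw T a ->
  ystep_spec x y yh -> enorm (yh - ys) <= pw T (a + 6).
Proof.
move=> sc Qxx Qyy xa ya hy; have T1 := scale_ge1 sc.
have [Qxs _] := hxs; have [Qys _] := hys.
have opt u : Qy d u -> h ys + dot (- - grad (F xs) ys) (u - ys) +
    muy d / 2 * sqn (u - ys) <= h u.
  by move=> Qu; rewrite opprK; exact: (ystar_optimality ad af Qxs hys Qu).
have hs := model_step_stable (muy_gt0 ad) (eff_const_ge0 ay (muy_gt0 ad)) _ hy Qys opt.
have hg : enorm (- grad (F x) y - - grad (F xs) ys) <= pw T (1 + a + 1).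
  rewrite -opprD enormN.
  apply: le_trans (enorm_tri (grad (F xs) y) _ _) _; apply: (pw_add T1).
    apply: le_trans (F_Lyx af Qxx Qxs Qyy) _.
    by apply: pw_mul; rewrite ?(Lxy_ge0 ad) ?enorm_ge0 ?(scale_Lxy sc).
  apply: le_trans (F_Lyy af Qxs Qyy Qys) _.
  by apply: pw_mul; rewrite ?(Lyy_ge0 ad) ?enorm_ge0 ?(scale_Lyy sc).
have K0 : 0 <= kapy + access_const (eff_access (muy d) ay).
  by rewrite addr_ge0 ?(ltW kapy_gt0) ?eff_const_ge0 ?(muy_gt0 ad).
have hk := pw_mul K0 (kapy_scale sc) (enorm_ge0 _) ya.
have hm : muy d * enorm (yh - ys) <= pw T (a + 5).
  have h1 : enorm (- grad (F x) y - - grad (F xs) ys) <= pw T (3 + a).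
    by apply: (pw_trans T1 hg); lra.
  apply: (pw_trans T1 (le_trans (hs _) (pw_add T1 h1 hk))); last lra.
  by rewrite lerDr ltW ?(muy_gt0 ad).
have -> : enorm (yh - ys) = (muy d)^-1 * (muy d * enorm (yh - ys)).
  by rewrite mulKf // gt_eqF ?(muy_gt0 ad).
have -> : a + 6 = 1 + (a + 5) by ring.
apply: pw_mul; rewrite ?invr_ge0 ?mulr_ge0 ?enorm_ge0 ?(ltW (muy_gt0 ad)) //.
rewrite -[X in pw _ X]opprK; exact: (pw_inv (scale_muy sc)).
Qed.

Lemma stage_complete T : scale_ok d ax ay T -> Rx d xs <= pw T 1 ->
  Ry d ys <= pw T 1 ->
  hoare O (stage T) (fun o => exists2 s, o = Some s & certified T s.1 s.2)
    (stage_cost T).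
Proof.
move=> sc RxT RyT; have T1 := scale_ge1 sc.
have c0 : 0 <= 40 :> R by [].
apply: (hoare_bind (saddle_solve_correct ad af im hxs hys sc c0 RxT RyT)).
move=> s [Qxx Qyy sx sy].
case: ifPn => [_|/asboolPn nQ]; last by exfalso; apply: nQ.
apply: (hoare_bind (xstep_correct Qxx Qyy)) => xh hx.
have sx' : enorm (s.1 - xs) <= pw T (-37) by apply: (pw_trans T1 sx); lra.
have sy' : enorm (s.2 - ys) <= pw T (-37) by apply: (pw_trans T1 sy); lra.
have hr yh : ystep_spec s.1 s.2 yh -> hoare O
  (ret (if (enorm (xh - s.1) <= pw T (-30)) && (enorm (yh - s.2) <= pw T (-30))
         then Some (xh, yh) else None))
  (fun o => exists2 s, o = Some s & certified T s.1 s.2) cost0.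
  move=> hy; apply: hoare_ret.
  have hx' := xstep_near sc Qxx Qyy sx' sy' hx.
  have hy' := ystep_near sc Qxx Qyy sx' sy' hy.
  have h37 : -37 <= -37 + 6 :> R by lra.
  have cx : enorm (xh - s.1) <= pw T (-30).
    apply: le_trans (enorm_tri xs _ _) _; rewrite (enormBC xs).
    by apply: (pw_trans T1 (pw_add T1 hx' (pw_trans T1 sx' h37))); lra.
  have cy : enorm (yh - s.2) <= pw T (-30).
    apply: le_trans (enorm_tri ys _ _) _; rewrite (enormBC ys).
    by apply: (pw_trans T1 (pw_add T1 hy' (pw_trans T1 sy' h37))); lra.
  by rewrite cx cy; exists (xh, yh) => //; exists s.1, s.2.
apply: (hoare_weaken (hoare_bind (ystep_correct Qxx Qyy) hr)) => // i.
by rewrite /costD addn0.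
Qed.

End Stage.

(** * What a certified pair guarantees *)

Section StageCertificates.
Context {R : realType} {n m : nat} (d : data R n m) (ax ay : @access R).
Variables (r : 'rV[R]_n -> R) (F : 'rV[R]_n -> 'rV[R]_m -> R) (h : 'rV[R]_m -> R).
Variable O : oracles R n m.
Hypotheses (ad : admissible_data d) (af : admissible_functions d r F h)
  (im : implements d ax ay r F h O).
Variables (xs : 'rV[R]_n) (ys : 'rV[R]_m).
Hypotheses (hxs : is_xstar d r F h xs) (hys : is_ystar d F h xs ys).

Notation x_cert := (x_certificate d r F).
Notation y_cert := (y_certificate d F h).
Notation cert T := (certified d ax ay r F h T).
Notation solution := (eps_solution d r F h xs ys).
Notation ystep_to := (ystep_spec d ay F h).

(** A certified [yh] is within [pw T (-23)] of [ys], so this observable test proves that [y] is at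
    least [pw T (-21)] away from [ys]. Times [muy] that is [pw T (-22)], which dominates [Lxy] times
    the error [pw T (-23)] of [xh]. *)
Definition far (T : R) (y yh : 'rV[R]_m) : bool := pw T (-20) <= enorm (yh - y).

Lemma certificate_budget T e : scale_ok d ax ay T ->
  pw T e ^+ 2 / (2 * mux d) + pw T e ^+ 2 / (2 * muy d) <= pw T (2 * e + 2).
Proof.
move=> sc; have T1 := scale_ge1 sc.
have hb mu : 0 < mu -> pw T (-1) <= mu -> pw T e ^+ 2 / (2 * mu) <= pw T (2 * e + 1).
  move=> mu0 mu1.
  have h1 : mu^-1 <= pw T 1 by rewrite -[X in pw _ X]opprK; exact: pw_inv.
  have i0 : 0 <= mu^-1 by rewrite invr_ge0 ltW.
  have h2 : (2 * mu)^-1 <= mu^-1 by rewrite lef_pV2 ?posrE ?mulr_gt0 //; lra.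
  have h3 := pw_mul (sqr_ge0 _) (pw_sqr (pw_ge0 T e) (lexx _)) i0 h1.
  apply: le_trans (ler_wpM2l (sqr_ge0 _) h2) _.
  by apply: (pw_trans T1 h3); lra.
have := pw_add T1 (hb _ (mux_gt0 ad) (scale_mux sc)) (hb _ (muy_gt0 ad) (scale_muy sc)).
by move=> hs; apply: (pw_trans T1 hs); lra.
Qed.

Lemma certificate_eps T e : scale_ok d ax ay T -> e <= -7 ->
  pw T e ^+ 2 / (2 * mux d) + pw T e ^+ 2 / (2 * muy d) <= eps d.
Proof.
move=> sc e7; apply: le_trans (scale_eps sc).
by apply: (pw_trans (scale_ge1 sc) (certificate_budget e sc)); lra.
Qed.

Lemma x_cert_weaken b b' x y : b <= b' -> x_cert b x y -> x_cert b' x y.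
Proof. by move=> bb [v vb hv]; exists v => //; exact: le_trans vb bb. Qed.

Lemma y_cert_weaken b b' x y : b <= b' -> y_cert b x y -> y_cert b' x y.
Proof. by move=> bb [v vb hv]; exists v => //; exact: le_trans vb bb. Qed.

Lemma x_weight T : scale_ok d ax ay T ->
  Lxx d + kapx d ax + access_const (eff_access (mux d) ax) <= pw T 4.
Proof.
move=> sc; have T1 := scale_ge1 sc; rewrite -addrA.
have h1 : Lxx d <= pw T 3 by apply: (pw_trans T1 (scale_Lxx sc)); lra.
by apply: (pw_trans T1 (pw_add T1 h1 (kapx_scale sc))); lra.
Qed.

Lemma y_weight T : scale_ok d ax ay T ->
  Lyy d + kapy d ay + access_const (eff_access (muy d) ay) <= pw T 4.
Proof.
move=> sc; have T1 := scale_ge1 sc; rewrite -addrA.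
have h1 : Lyy d <= pw T 3 by apply: (pw_trans T1 (scale_Lyy sc)); lra.
by apply: (pw_trans T1 (pw_add T1 h1 (kapy_scale sc))); lra.
Qed.

Lemma x_weight_ge0 : 0 <= Lxx d + kapx d ax + access_const (eff_access (mux d) ax).
Proof.
apply: addr_ge0; last exact: eff_const_ge0 (mux_gt0 ad).
by rewrite addr_ge0 ?(Lxx_ge0 ad) ?(ltW (kapx_gt0 ax ad)).
Qed.

Lemma y_weight_ge0 : 0 <= Lyy d + kapy d ay + access_const (eff_access (muy d) ay).
Proof.
apply: addr_ge0; last exact: eff_const_ge0 (muy_gt0 ad).
by rewrite addr_ge0 ?(Lyy_ge0 ad) ?(ltW (kapy_gt0 ay ad)).
Qed.

Lemma cert_bound T a b c (w l u v : R) : 1 <= T -> 0 <= w -> w <= pw T 4 ->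
  0 <= l -> l <= pw T 1 -> 0 <= u -> u <= pw T a -> 0 <= v -> v <= pw T b ->
  4 + a <= c -> 1 + b <= c -> w * u + l * v <= pw T (c + 1).
Proof.
move=> T1 w0 w4 l0 l1 u0 ua v0 vb ac bc; apply: (pw_add T1).
  exact: (pw_trans T1 (pw_mul w0 w4 u0 ua)).
exact: (pw_trans T1 (pw_mul l0 l1 v0 vb)).
Qed.

Lemma sqn_bound T k (mu b : R) (u : 'rV[R]_k) : 1 <= T -> 0 < mu ->
  pw T (-1) <= mu -> mu / 2 * sqn u <= pw T b -> sqn u <= pw T (b + 2).
Proof.
move=> T1 mu0 mu1 hu.
have h1 : mu^-1 <= pw T 1 by rewrite -[X in pw _ X]opprK; exact: pw_inv.
have i0 : 0 <= mu^-1 by rewrite invr_ge0 ltW.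
have -> : sqn u = 2 * (mu^-1 * (mu / 2 * sqn u)) by field; rewrite gt_eqF.
have q0 : 0 <= mu / 2 * sqn u by rewrite mulr_ge0 ?sqn_ge0 ?divr_ge0 // ltW.
apply: (pw_trans T1 (pw_mul _ (pw_ge2 T1) _ (pw_mul i0 h1 q0 hu))) => //; last lra.
by rewrite mulr_ge0.
Qed.

(** Displacements [pw T (-30)] with weights at most [pw T 4] give certificates of size [pw T (-25)],
    hence a gap of at most [pw T (-48)]; strong convexity turns this into distances [pw T (-23)]. No
    bound on [Rx] or [Ry] is assumed. *)
Lemma certified_facts T xh yh : scale_ok d ax ay T -> cert T xh yh ->
  [/\ [/\ Qx d xh & Qy d yh], x_cert (pw T (-25)) xh yh, y_cert (pw T (-25)) xh yh,
      enorm (xh - xs) <= pw T (-23) & enorm (yh - ys) <= pw T (-23)].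
Proof.
move=> sc [x [y [[Qxx Qyy] hx hy cx cy]]]; have T1 := scale_ge1 sc.
have Qxh : Qx d xh by case: hx.
have Qyh : Qy d yh by case: hy.
have ccx : x_cert (pw T (-25)) xh yh.
  apply: x_cert_weaken (x_certificate_step af (ltW (kapx_gt0 ax ad)) Qxx Qyy Qyh hx).
  have -> : -25 = -26 + 1 :> R by ring.
  apply: (cert_bound T1 x_weight_ge0 (x_weight sc) (Lxy_ge0 ad) (scale_Lxy sc)
    (enorm_ge0 _) cx (enorm_ge0 _) cy); lra.
have ccy : y_cert (pw T (-25)) xh yh.
  apply: y_cert_weaken (y_certificate_step af (ltW (kapy_gt0 ay ad)) Qxx Qyy Qxh hy).
  have -> : -25 = -26 + 1 :> R by ring.
  apply: (cert_bound T1 y_weight_ge0 (y_weight sc) (Lxy_ge0 ad) (scale_Lxy sc)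
    (enorm_ge0 _) cy (enorm_ge0 _) cx); lra.
have hd := certified_distance ad af im hxs hys ccx ccy Qxh Qyh.
have {}hd := le_trans hd (certificate_budget (-25) sc).
have qx := mulr_ge0 (ltW (mux_gt0 ad)) (sqn_ge0 (xh - xs)).
have qy := mulr_ge0 (ltW (muy_gt0 ad)) (sqn_ge0 (yh - ys)).
have nx : mux d / 2 * sqn (xh - xs) <= pw T (2 * -25 + 2) by lra.
have ny : muy d / 2 * sqn (yh - ys) <= pw T (2 * -25 + 2) by lra.
split => //.
  apply: sqrt_pw (enorm_ge0 _) _; rewrite enorm_sqr.
  by apply: (pw_trans T1 (sqn_bound T1 (mux_gt0 ad) (scale_mux sc) nx)); lra.
apply: sqrt_pw (enorm_ge0 _) _; rewrite enorm_sqr.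
by apply: (pw_trans T1 (sqn_bound T1 (muy_gt0 ad) (scale_muy sc) ny)); lra.
Qed.

Lemma far_dominates T xh yh y : scale_ok d ax ay T -> cert T xh yh -> far T y yh ->
  Lxy d * enorm (xh - xs) <= muy d * enorm (y - ys).
Proof.
move=> sc ce fa; have T1 := scale_ge1 sc.
have [_ _ _ nx ny] := certified_facts sc ce.
have h1 : Lxy d * enorm (xh - xs) <= pw T (1 + -23).
  by apply: pw_mul; rewrite ?(Lxy_ge0 ad) ?enorm_ge0 ?(scale_Lxy sc).
have h2 : pw T (-21) <= enorm (y - ys).
  have h3 := enorm_tri ys yh y; rewrite (enormBC ys y) in h3.
  have h4 : pw T (-23) <= pw T (-21) by apply: pw_mono => //; lra.
  have h5 := pw_add T1 (lexx (pw T (-21))) (lexx _).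
  have e : -21 + 1 = -20 :> R by ring.
  rewrite e in h5; move: fa; rewrite /far; lra.
have h3 : pw T (-1 + -21) <= muy d * enorm (y - ys).
  by rewrite pwD ler_pM ?pw_ge0 ?(scale_muy sc).
by apply: le_trans h1 (le_trans (pw_mono T1 _) h3); lra.
Qed.

Lemma far_start_solution T xh yh : scale_ok d ax ay T -> cert T xh yh ->
  far T (y0 d) yh -> solution (xh, yh).
Proof.
move=> sc ce fa; have [[Qxh Qyh] ccx ccy nx ny] := certified_facts sc ce.
apply: (eps_solution_far_start ad af im hxs hys ccx ccy Qxh Qyh).
  by apply: certificate_eps sc _; lra.
exact: far_dominates sc ce fa.
Qed.

Lemma fixed_start_solution T xh yh : scale_ok d ax ay T -> cert T xh yh ->
  ystep_to xh (y0 d) (y0 d) -> solution (xh, yh).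
Proof.
move=> sc ce fx; have [[Qxh Qyh] ccx ccy nx ny] := certified_facts sc ce.
apply: (eps_solution_fixed_start ad af im hxs hys ccx ccy Qxh Qyh _ fx).
by apply: certificate_eps sc _; lra.
Qed.

Lemma far_start_of_Ry T xh yh : scale_ok d ax ay T -> cert T xh yh ->
  pw T (-1) <= Ry d ys -> far T (y0 d) yh.
Proof.
move=> sc ce RyT; have T1 := scale_ge1 sc.
have [_ _ _ nx ny] := certified_facts sc ce.
have h3 := enorm_tri yh ys (y0 d).
rewrite (enormBC ys (y0 d)) -/(Ry d ys) (enormBC ys yh) in h3.
have h4 : pw T (-23) <= pw T (-20) by apply: pw_mono => //; lra.
have h5 := pw_add T1 (lexx (pw T (-20))) (lexx _).
have h6 : pw T (-20 + 1) <= pw T (-1) by apply: pw_mono => //; lra.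
rewrite /far; lra.
Qed.

(** The old [xh] is remembered because the step that produced [ya] was taken there; its
    [y]-certificate is later carried over to a new [x]. *)
Definition perturbed T ya : Prop := exists xh,
  [/\ Qx d xh, enorm (xh - xs) <= pw T (-23), ystep_to xh (y0 d) ya,
      enorm (ya - ys) <= pw T (-13) & enorm (ya - y0 d) <= pw T (-12)].

Lemma perturbed_of_near T xh yh ya : scale_ok d ax ay T -> cert T xh yh ->
  ~~ far T (y0 d) yh -> ystep_to xh (y0 d) ya -> perturbed T ya.
Proof.
move=> sc ce nf hya; have T1 := scale_ge1 sc.
have [[Qxh Qyh] ccx ccy nx ny] := certified_facts sc ce.
have n0 : enorm (y0 d - ys) <= pw T (-19).
  apply: le_trans (enorm_tri yh _ _) _; rewrite (enormBC (y0 d)).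
  have h1 : enorm (yh - y0 d) <= pw T (-20) by move: nf; rewrite /far -ltNge => /ltW.
  have h2 : enorm (yh - ys) <= pw T (-20) by apply: (pw_trans T1 ny); lra.
  by apply: (pw_trans T1 (pw_add T1 h1 h2)); lra.
have nx' : enorm (xh - xs) <= pw T (-19) by apply: (pw_trans T1 nx); lra.
have hn := ystep_near ad af hxs hys sc Qxh (y0_in ad) nx' n0 hya.
have hn' : enorm (ya - ys) <= pw T (-13) by apply: (pw_trans T1 hn); lra.
exists xh; split => //.
apply: le_trans (enorm_tri ys _ _) _; rewrite (enormBC ys).
have h2 : enorm (y0 d - ys) <= pw T (-13) by apply: (pw_trans T1 n0); lra.
by apply: (pw_trans T1 (pw_add T1 hn' h2)); lra.
Qed.

(** Two stages are mixed: the [x]-certificate of the later one is transported from its [y] to [ya],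
    and the [y]-certificate of the step that gave [ya] is transported to the later [xh]. Both stay
    within [pw T (-7)] at the earlier scale, limited by [enorm (ya - y0 d) <= pw T (-12)]; this
    already meets [eps], so [ya] is never refined. *)
Lemma far_perturbed_solution T T' xh yh ya : scale_ok d ax ay T ->
  scale_ok d ax ay T' -> T <= T' -> perturbed T ya -> cert T' xh yh ->
  far T' ya yh -> solution (xh, ya).
Proof.
move=> sc sc' TT [x1 [Qx1 n1 hya nya na]] ce fa; have T1 := scale_ge1 sc.
have [[Qxh Qyh] _ _ nx ny] := certified_facts sc' ce.
have down a : a <= 0 -> pw T' a <= pw T a.
  by move=> a0; rewrite /pw ler_expR ler_wnM2l.
have [x [y [[Qxx Qyy] hx hy cx cy]]] := ce.
have Qya : Qy d ya by case: hya.
have m0 k : - (k%:R) <= 0 :> R by rewrite oppr_le0 ler0n.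
have nx' : enorm (xh - xs) <= pw T (-23) by apply: le_trans nx (down _ _).
have ny' : enorm (yh - ys) <= pw T (-23) by apply: le_trans ny (down _ _).
have cx' : enorm (xh - x) <= pw T (-30) by apply: le_trans cx (down _ _).
have cy' : enorm (yh - y) <= pw T (-30) by apply: le_trans cy (down _ _).
have ccx : x_cert (pw T (-7)) xh ya.
  apply: x_cert_weaken (x_certificate_step af (ltW (kapx_gt0 ax ad)) Qxx Qyy Qya hx).
  have h1 : enorm (ya - y) <= pw T (-11).
    apply: le_trans (enorm_tri ys _ _) _.
    apply: (pw_trans T1 (pw_add T1 (a := -12) _ _)); last lra.
      by apply: (pw_trans T1 nya); lra.
    apply: le_trans (enorm_tri yh _ _) _; rewrite (enormBC ys).
    apply: (pw_trans T1 (pw_add T1 (a := -23) _ _)) => //; last lra.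
    by apply: (pw_trans T1 cy'); lra.
  have -> : -7 = -8 + 1 :> R by ring.
  apply: (cert_bound T1 x_weight_ge0 (x_weight sc) (Lxy_ge0 ad) (scale_Lxy sc)
    (enorm_ge0 _) cx' (enorm_ge0 _) h1); lra.
have ccy : y_cert (pw T (-7)) xh ya.
  apply: y_cert_weaken (y_certificate_step af (ltW (kapy_gt0 ay ad)) Qx1 (y0_in ad) Qxh hya).
  have h1 : enorm (xh - x1) <= pw T (-22).
    apply: le_trans (enorm_tri xs _ _) _; rewrite (enormBC xs).
    by apply: (pw_trans T1 (pw_add T1 nx' n1)); lra.
  have -> : -7 = -8 + 1 :> R by ring.
  apply: (cert_bound T1 y_weight_ge0 (y_weight sc) (Lxy_ge0 ad) (scale_Lxy sc)
    (enorm_ge0 _) na (enorm_ge0 _) h1); lra.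
apply: (eps_solution_far_y ad af im hxs hys ccx ccy Qxh Qya).
  by apply: certificate_eps sc _; lra.
exact: far_dominates sc' ce fa.
Qed.

(** A point near [y0] is far from [ya] once [ya] is resolved from [y0]. The condition involves only
    known points, so the moment of success can be predicted even if [Ry = 0]. *)
Lemma far_perturbed_of_start T ya yh : 1 <= T -> ~~ far T (y0 d) yh ->
  pw T (-1) <= enorm (ya - y0 d) -> far T ya yh.
Proof.
move=> T1; rewrite /far -ltNge => nf hya.
have h3 := enorm_tri yh ya (y0 d); rewrite (enormBC ya yh) in h3.
have h5 := pw_add T1 (lexx (pw T (-20))) (lexx _).
have h6 : pw T (-20 + 1) <= pw T (-1) by apply: pw_mono => //; lra.
lra.
Qed.

End StageCertificates.

(** * Oracle complexity *)

Section StageCost.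
Context {R : realType} {n m : nat} (d : data R n m) (ax ay : @access R).
Hypothesis ad : admissible_data d.

Definition budget (o : oracle) : R :=
  match o with
  | GradR => if ax is Grad L then Num.sqrt (L / mux d) else 0
  | ProxR => if ax is Prox then count1 d else 0
  | GradFx => count1 d
  | GradFy => count2 d
  | GradH => if ay is Grad L then count3 d L else 0
  | ProxH => if ay is Prox then count2 d else 0
  end.

Let n1 := count1 d.
Let sy := Num.sqrt (Num.max (Lyy d / muy d) 1).

Lemma count1_ge1 : 1 <= count1 d.
Proof. by rewrite /count1 le_max lexx. Qed.

Lemma sy_ge1 : 1 <= sy.
Proof. by rewrite /sy -[leLHS]sqrtr1 ler_wsqrtr // le_max lexx orbT. Qed.

(** The maximum in [count2] is the outer count, floored at 1, times the cost of one inner problem;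
    the nested solver is bounded in this product form. *)
Lemma count2E : count2 d = n1 * sy.
Proof.
rewrite /count2 /N2 /n1 /count1 maxr_pMl ?mul1r //.
exact: le_trans ler01 sy_ge1.
Qed.

Lemma count3E L : count3 d L = n1 * Num.sqrt (L / muy d).
Proof. by rewrite /count3 /N3 /n1 /count1 maxr_pMl ?mul1r // sqrtr_ge0. Qed.

Lemma budget_ge0 o : 0 <= budget o.
Proof.
have h1 : 0 <= n1 by exact: le_trans ler01 count1_ge1.
have h2 : 0 <= sy by exact: le_trans ler01 sy_ge1.
case: o => /=; rewrite ?count2E; rewrite ?mulr_ge0 //.
- by case: ax => // L; exact: sqrtr_ge0.
- by case: ay => // L; rewrite count3E mulr_ge0 ?sqrtr_ge0.
- by case: ax.
- by case: ay; rewrite ?mulr_ge0.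
Qed.

Lemma sqrt_le_sqr (x y : R) : 0 <= y -> x <= y ^+ 2 -> Num.sqrt x <= y.
Proof.
by move=> y0 xy; rewrite -[leRHS](ger0_norm y0) -sqrtr_sqr ler_wsqrtr.
Qed.

Lemma Lpsi_ge0 : 0 <= Lpsi d.
Proof. by rewrite /Lpsi addr_ge0 ?(Lxx_ge0 ad) // divr_ge0 ?sqr_ge0 // ltW ?(muy_gt0 ad). Qed.

Lemma x_rate_bound : Num.sqrt (Lbx d / mux d) <= 2 * n1.
Proof.
have mu0 := mux_gt0 ad; have c1 := count1_ge1.
have hN : Lpsi d / mux d <= n1 ^+ 2.
  have e : Lpsi d / mux d = N1 d ^+ 2.
    by rewrite sqr_sqrtr // divr_ge0 ?Lpsi_ge0 // ltW.
  rewrite e lerXn2r ?nnegrE ?sqrtr_ge0 //; first by rewrite (le_trans ler01).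
  by rewrite /n1 /count1 le_max lexx orbT.
have h1 : 1 <= n1 ^+ 2 by rewrite exprn_ege1.
apply: sqrt_le_sqr; first by rewrite mulr_ge0 // (le_trans ler01).
rewrite ler_pdivrMr // in hN; rewrite ler_pdivrMr // /Lbx exprMn.
have h2 : Num.max (Lpsi d) (mux d) <= n1 ^+ 2 * mux d.
  by rewrite ge_max hN /= ler_peMl // ltW.
have h3 : 0 <= n1 ^+ 2 * mux d by rewrite mulr_ge0 ?sqr_ge0 // ltW.
lra.
Qed.

Lemma y_rate_bound : Num.sqrt (Lby d / muy d) <= 2 * sy.
Proof.
have mu0 := muy_gt0 ad.
have hs : sy ^+ 2 = Num.max (Lyy d / muy d) 1.
  by rewrite sqr_sqrtr // le_max ler01 orbT.
have s0 : 0 <= sy by exact: sqrtr_ge0.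
apply: sqrt_le_sqr; first by rewrite mulr_ge0.
rewrite ler_pdivrMr // /Lby exprMn hs.
have h2 : Num.max (Lyy d) (muy d) <= Num.max (Lyy d / muy d) 1 * muy d.
  rewrite ge_max -ler_pdivrMr // le_max lexx /=.
  by rewrite ler_peMl ?(ltW mu0) // le_max lexx orbT.
have h3 : 0 <= Num.max (Lyy d / muy d) 1 * muy d.
  by rewrite mulr_ge0 ?(ltW mu0) // le_max ler01 orbT.
lra.
Qed.

Lemma x_access_bound o :
  access_rate (eff_access (mux d) ax) (mux d) (Lbx d) * (costR d ax o)%:R
  <= 2 * budget o.
Proof.
have c0 : 0 <= n1 by exact: le_trans ler01 count1_ge1.
have b0 := budget_ge0 o.
rewrite /costR /eff_cost /eff_access /budget in b0 *.
case: ax b0 => [|L] b0 /=.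
  rewrite /cost1; case: asboolP => [<-|_]; rewrite ?mulr0 ?mulr_ge0 //.
  by rewrite mulr1 x_rate_bound.
case: ltP => Lmu; first by rewrite mulr0 mulr_ge0.
rewrite /cost1; case: asboolP b0 => [<-|_] b0; rewrite ?mulr0 ?mulr_ge0 //.
rewrite mulr1 /=; have := sqrtr_ge0 (L / mux d); lra.
Qed.

Lemma y_access_bound o :
  n1 * (access_rate (eff_access (muy d) ay) (muy d) (Lby d) * (costH d ay o)%:R)
  <= 2 * budget o.
Proof.
have c0 : 0 <= n1 by exact: le_trans ler01 count1_ge1.
have b0 := budget_ge0 o.
rewrite /costH /eff_cost /eff_access /budget in b0 *.
case: ay b0 => [|L] b0 /=.
  rewrite /cost1; case: asboolP => [<-|_]; rewrite ?mulr0 ?mulr_ge0 //.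
  by rewrite mulr1 count2E mulrCA ler_wpM2l // y_rate_bound.
case: ltP => Lmu; first by rewrite !mulr0 mulr_ge0.
rewrite /cost1; case: asboolP b0 => [<-|_] b0; rewrite ?mulr0 ?mulr_ge0 //.
rewrite mulr1 /= count3E.
have := mulr_ge0 c0 (sqrtr_ge0 (L / muy d)); lra.
Qed.

Lemma gradFx_budget o : n1 * (cost1 GradFx o)%:R <= budget o.
Proof.
have := budget_ge0 o; rewrite /cost1; case: asboolP => [<-|_] b0; last by rewrite mulr0.
by rewrite mulr1 /=.
Qed.

Lemma gradFy_budget o : n1 * (sy * (cost1 GradFy o)%:R) <= budget o.
Proof.
have := budget_ge0 o; rewrite /cost1; case: asboolP => [<-|_] b0; last by rewrite !mulr0.
by rewrite mulr1 /= count2E.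
Qed.

Lemma access_rate_ge1 (mu Lb : R) a : 0 < mu -> mu <= Lb ->
  1 <= access_rate (eff_access mu a) mu Lb.
Proof.
move=> mu0 muL; case: a => [|L] /=; first exact: sqrt_ratio_ge1.
by apply: sqrt_ratio_ge1 => //; rewrite le_max lexx orbT.
Qed.

Lemma mux_Lbx : mux d <= Lbx d.
Proof.
rewrite /Lbx; have : mux d <= Num.max (Lpsi d) (mux d) by rewrite le_max lexx orbT.
have := mux_gt0 ad; lra.
Qed.

Lemma muy_Lby : muy d <= Lby d.
Proof.
rewrite /Lby; have : muy d <= Num.max (Lyy d) (muy d) by rewrite le_max lexx orbT.
have := muy_gt0 ad; lra.
Qed.

(** The constant of [composite_cost_bound] at [c = 2 * 40 + 19] and scale [10 * T]; the last 4 is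
    two summands of at most [2 * budget] each. [Kouter] is the same constant at [c = 40]. In
    [Kstage] the 9 counts the single steps: 3 for one step in [x] and 3 for each of two steps in
    [y]. *)
Definition Kinner : R := 64 * (2 * (2 * 40 + 19) + 13) * (4 * (2 * 40 + 19) + 45) * 10 ^+ 2 * 4.
Definition Kouter : R := 64 * (2 * 40 + 13) * (4 * 40 + 45).
Definition Kstage : R := Kouter * (4 + 2 * Kinner) + Kinner + 9.

(** The factor [n1] is there because the inner problem is solved for every outer gradient of [psi];
    [count2] and [count3] already contain it. *)
Lemma ysolve_budget T o : scale_ok d ax ay T ->
  n1 * (ysolve_cost d ay 40 T o)%:R <= Kinner * T ^+ 2 * budget o.
Proof.
move=> sc; have T1 := scale_ge1 sc.
have T1' : 1 <= 10 * T by lra.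
have c0 : 0 <= n1 by exact: le_trans ler01 count1_ge1.
have ws : well_scaled (eff_access (muy d) ay) (muy d) (10 * T).
  apply: eff_well_scaled; rewrite pw_rescale mulr1.
    by apply: (pw_trans T1 (scale_muy' sc)); lra.
  by apply: (pw_trans T1 (scale_ay sc)); lra.
have hc : 0 <= 2 * 40 + 19 :> R by lra.
have h := composite_cost_bound (costH d ay) (cost1 GradFy) o T1' hc (muy_gt0 ad) muy_Lby ws.
apply: le_trans (ler_wpM2l c0 h) _.
have h1 := y_access_bound o; have h2 := gradFy_budget o.
have h3 : n1 * (Num.sqrt (Lby d / muy d) * (cost1 GradFy o)%:R) <= 2 * budget o.
  apply: (@le_trans _ _ (n1 * (2 * sy * (cost1 GradFy o)%:R))); last by lra.
  by rewrite ler_wpM2l // ler_wpM2r ?ler0n // y_rate_bound.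
set A := access_rate _ _ _ * _ in h1 *; set B := Num.sqrt (Lby d / muy d) * _ in h3 *.
set K := 64 * _ * _.
have K0 : 0 <= K by rewrite /K !mulr_ge0 //; lra.
have -> : n1 * (K * (10 * T) ^+ 2 * (A + B)) = K * 10 ^+ 2 * T ^+ 2 * (n1 * A + n1 * B) by ring.
have -> : Kinner * T ^+ 2 * budget o = K * 10 ^+ 2 * T ^+ 2 * (4 * budget o).
  by rewrite /Kinner -/K; ring.
rewrite ler_wpM2l ?mulr_ge0 ?sqr_ge0 //; lra.
Qed.

(** The extra [ystep_cost] pays for the step from [y0] in [early_body]. Two nested composite solves,
    each with a factor [T ^+ 2], give [T ^+ 4]. *)
Lemma stage_budget T o : scale_ok d ax ay T ->
  ((stage_cost d ax ay T o + ystep_cost d ay o)%N)%:R <= Kstage * T ^+ 4 * budget o.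
Proof.
move=> sc; have T1 := scale_ge1 sc.
have c1 := count1_ge1; rewrite -/n1 in c1.
have c0 : 0 <= n1 by exact: le_trans ler01 c1.
have b0 := budget_ge0 o.
have ws : well_scaled (eff_access (mux d) ax) (mux d) T.
  exact: eff_well_scaled (scale_mux' sc) (scale_ax sc).
have hc : 0 <= 40 :> R by [].
have hx := composite_cost_bound (costR d ax) (costD (ysolve_cost d ay 40 T) (cost1 GradFx))
  o T1 hc (mux_gt0 ad) mux_Lbx ws.
have hy := ysolve_budget o sc.
have hR := x_access_bound o; have hH := y_access_bound o.
have hFx := gradFx_budget o; have hFy := gradFy_budget o.
rewrite /stage_cost /xstep_cost /ystep_cost /costD !natrD.
rewrite -/(xsolve_cost d ax ay 40 T) /costD natrD in hx.
set X := (xsolve_cost _ _ _ _ _ o)%:R in hx *.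
set Y := (ysolve_cost _ _ _ _ o)%:R in hx hy *.
set cR := (costR d ax o)%:R in hx hR *; set cH := (costH d ay o)%:R in hH *.
set cFx := (cost1 GradFx o)%:R in hx hFx *; set cFy := (cost1 GradFy o)%:R in hFy *.
have Y0 : 0 <= Y by exact: ler0n.
have cR0 : 0 <= cR by exact: ler0n.
have cH0 : 0 <= cH by exact: ler0n.
have cFx0 : 0 <= cFx by exact: ler0n.
have cFy0 : 0 <= cFy by exact: ler0n.
have Yb : Y <= Kinner * T ^+ 2 * budget o.
  by apply: le_trans hy; rewrite ler_peMl.
have cRb : cR <= 2 * budget o.
  apply: le_trans hR; rewrite ler_peMl //; exact: access_rate_ge1 (mux_gt0 ad) mux_Lbx.
have cHb : cH <= 2 * budget o.
  apply: le_trans hH; apply: (@le_trans _ _ (n1 * cH)); first by rewrite ler_peMl.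
  rewrite ler_wpM2l // ler_peMl //; exact: access_rate_ge1 (muy_gt0 ad) muy_Lby.
have cFxb : cFx <= budget o by apply: le_trans hFx; rewrite ler_peMl.
have cFyb : cFy <= budget o.
  apply: le_trans hFy; apply: (@le_trans _ _ (n1 * cFy)); first by rewrite ler_peMl.
  by rewrite ler_wpM2l // ler_peMl // sy_ge1.
have hXY : Num.sqrt (Lbx d / mux d) * (Y + cFx) <=
    2 * (Kinner * T ^+ 2 * budget o + budget o).
  apply: (@le_trans _ _ (2 * n1 * (Y + cFx))).
    by rewrite ler_wpM2r ?addr_ge0 // x_rate_bound.
  by rewrite -mulrA ler_wpM2l // mulrDr lerD.
have T2 : 1 <= T ^+ 2 by rewrite exprn_ege1.
have KI0 : 0 <= Kinner by rewrite /Kinner !mulr_ge0 ?sqr_ge0 //; lra.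
have KO0 : 0 <= Kouter by rewrite /Kouter !mulr_ge0 //; lra.
have Xb : X <= Kouter * T ^+ 2 * (4 * budget o + 2 * (Kinner * T ^+ 2 * budget o)).
  apply: le_trans hx _; rewrite -/Kouter ler_wpM2l ?mulr_ge0 ?sqr_ge0 //; lra.
have e4 : T ^+ 4 = T ^+ 2 * T ^+ 2 by rewrite -exprD.
rewrite e4 /Kstage; move: T2 Xb Yb; set t := T ^+ 2 => T2 Xb Yb.
have tt : t <= t * t by rewrite ler_peMl //; lra.
have t11 : 1 <= t * t by lra.
have g1 : Kouter * budget o * t <= Kouter * budget o * (t * t).
  by rewrite ler_wpM2l ?mulr_ge0.
have g2 : Kinner * budget o * t <= Kinner * budget o * (t * t).
  by rewrite ler_wpM2l ?mulr_ge0.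
have g3 : budget o * 1 <= budget o * (t * t) by rewrite ler_wpM2l.
move: Xb Yb; lra.
Qed.

End StageCost.

(** * Staged search *)

Section Search.
Context {R : realType} {n m : nat}.
Implicit Types (M : method R n m).

Lemma hoare_run (O : oracles R n m) (A : Type) (p : prog A) (P : A -> Prop) c
    (X : 'rV[R]_n * 'rV[R]_m -> Prop) K :
  hoare O p P c -> (forall a, P a -> X (run O (K a))) -> X (run O (p K)).
Proof. by move=> [a Pa [e ec ep]] hX; have [-> _] := ep K; exact: hX. Qed.

Lemma hoare_calls (O : oracles R n m) (A : Type) (p : prog A) (P : A -> Prop) c
    o N K :
  hoare O p P c -> (forall a, P a -> (calls O o (K a) <= N)%N) ->
  (calls O o (p K) <= c o + N)%N.
Proof.
move=> [a Pa [e ec ep]] hK; have [_ ->] := ep K.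
by apply: leq_add; [exact: ec | exact: hK].
Qed.

Fixpoint search (body : nat -> method R n m -> method R n m) (fuel s : nat) :
    method R n m :=
  body s (if fuel is f.+1 then search body f s.+1 else Output 0 0).

(** From index [smax] on the body must be right for every continuation, so the dummy output at
    exhausted fuel is never relied on. *)
Lemma search_run (body : nat -> method R n m -> method R n m)
    (P : method R n m -> Prop) smax fuel s :
  (forall t M, (s <= t)%N -> P M -> P (body t M)) ->
  (forall t M, (s <= t)%N -> (smax <= t)%N -> P (body t M)) ->
  (smax <= s + fuel)%N -> P (search body fuel s).
Proof.
elim: fuel s => [|fuel IH] s h1 h2 hs /=; first by apply: h2; rewrite // -[s]addn0.
apply: (h1) => //; apply: IH; last by rewrite addSnnS.
- by move=> t M st; apply: h1; exact: ltnW.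
- by move=> t M st; apply: h2; exact: ltnW.
Qed.

(** The count refers to the index [s1] at which the body stops by itself, which depends on the
    instance, and is independent of [fuel], however large that is. *)
Lemma search_calls (O : oracles R n m) (body : nat -> method R n m -> method R n m)
    o cm s1 fuel s :
  (forall t M, (s <= t)%N -> (t < s1)%N -> (calls O o M <= (s1 - t) * cm)%N ->
     (calls O o (body t M) <= (s1 - t).+1 * cm)%N) ->
  (forall M, (calls O o (body s1 M) <= cm)%N) ->
  (s <= s1)%N -> (calls O o (search body fuel s) <= (s1 - s).+1 * cm)%N.
Proof.
move=> h1 h2; elim: fuel s h1 => [|fuel IH] s h1; rewrite leq_eqVlt => /orP[/eqP ->|ss1] /=.
- by rewrite subnn mul1n h2.
- exact: h1.
- by rewrite subnn mul1n h2.
apply: (h1) => //.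
have -> : (s1 - s = (s1 - s.+1).+1)%N by rewrite -subSn // subSS.
by apply: IH => // t M st; apply: h1; exact: ltnW.
Qed.

End Search.

Section MainMethod.
Context {R : realType} {n m : nat} (d : data R n m) (ax ay : @access R).

Definition stage_scale (T0 s : nat) : R := (T0 + s)%:R.

(* [ya] is a deliberate perturbation of the maximizer, kept for the later stages;
   the search ends once [yh] is resolved away from [y0] or from [ya]. *)
Definition late_body (T0 : nat) ya (s : nat) (fail : method R n m) : method R n m :=
  let T := stage_scale T0 s in
  stage d ax ay T (fun o =>
    if o is Some z then
      if far T (y0 d) z.2 then Output z.1 z.2
      else if far T ya z.2 then Output z.1 ya else fail
    else fail).

(** From this index on, [expR T] exceeds both radii and the inverse of [enorm (ya - y0 d)], so a
    certificate exists and [far_perturbed_of_start] applies. *)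
Definition late_fuel (D : R) (ya : 'rV[R]_m) : nat :=
  (Num.truncn (D + (enorm (ya - y0 d))^-1)).+1.

Definition early_body (T0 : nat) (D : R) (s : nat) (fail : method R n m) :
    method R n m :=
  let T := stage_scale T0 s in
  stage d ax ay T (fun o =>
    if o is Some z then
      if far T (y0 d) z.2 then Output z.1 z.2
      else ystep d ay z.1 (y0 d) (fun ya =>
        if ya == y0 d then Output z.1 z.2
        else search (late_body T0 ya) (late_fuel D ya) s.+1)
    else fail).

Definition main_method (T0 : nat) (D : R) : method R n m :=
  search (early_body T0 D) (Num.truncn D).+1 0.

Variables (r : 'rV[R]_n -> R) (F : 'rV[R]_n -> 'rV[R]_m -> R) (h : 'rV[R]_m -> R).
Variable O : oracles R n m.
Hypotheses (ad : admissible_data d) (af : admissible_functions d r F h)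
  (im : implements d ax ay r F h O).
Variables (xs : 'rV[R]_n) (ys : 'rV[R]_m).
Hypotheses (hxs : is_xstar d r F h xs) (hys : is_ystar d F h xs ys).
Variables (T0 : nat) (D : R).
Hypotheses (scT0 : forall s, scale_ok d ax ay (stage_scale T0 s))
  (RxD : Rx d xs <= D) (RyD : Ry d ys <= D).

Notation Ts := (stage_scale T0).
Notation solution := (eps_solution d r F h xs ys).

Lemma stage_scale_ge s : s%:R <= Ts s.
Proof. by rewrite /stage_scale ler_nat leq_addl. Qed.

Lemma le_pw_stage (x : R) s : x <= s%:R -> x <= pw (Ts s) 1.
Proof.
move=> xs1; rewrite /pw mul1r; have := expR_ge1Dx (Ts s).
have := stage_scale_ge s; lra.
Qed.

Lemma stage_solves s : D <= s%:R ->
  hoare O (stage d ax ay (Ts s))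
    (fun o => exists2 z, o = Some z & certified d ax ay r F h (Ts s) z.1 z.2)
    (stage_cost d ax ay (Ts s)).
Proof.
move=> Ds; apply: (stage_complete ad af im hxs hys (scT0 s)); apply: le_pw_stage;
  exact: le_trans Ds.
Qed.

Lemma late_run s ya fuel : perturbed d ay F h xs ys (Ts s) ya -> ya != y0 d ->
  (late_fuel D ya <= s.+1 + fuel)%N ->
  solution (run O (search (late_body T0 ya) fuel s.+1)).
Proof.
move=> pe ya0 hf.
have al0 : 0 < enorm (ya - y0 d).
  rewrite lt_neqAle enorm_ge0 andbT eq_sym; apply: contra ya0 => /eqP.
  by move/enorm_eq0 => /eqP; rewrite subr_eq0.
apply: (search_run (P := fun M => solution (run O M)) (smax := late_fuel D ya)) => //.
- move=> t M st PM; rewrite /late_body.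
  apply: (hoare_run (stage_sound ad af im (Ts t))) => -[[xh yh]|] //= ce.
  case: ifPn => fa; first exact: (far_start_solution ad af im hxs hys (scT0 t) ce fa).
  case: ifPn => // fa'.
  apply: (far_perturbed_solution ad af im hxs hys (scT0 s) (scT0 t) _ pe ce fa').
  by rewrite /stage_scale ler_nat leq_add2l ltnW.
move=> t M st smt; rewrite /late_body.
have hD : D + (enorm (ya - y0 d))^-1 <= t%:R.
  by apply: ltW; apply: lt_le_trans (truncnS_gt _) _; rewrite ler_nat.
have i0 : 0 <= (enorm (ya - y0 d))^-1 by rewrite invr_ge0 enorm_ge0.
have D0 : 0 <= D by apply: le_trans RxD; exact: enorm_ge0.
have hDt : D <= t%:R by lra.
apply: (hoare_run (stage_solves hDt)) => _ [[xh yh] -> ce] /=.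
case: ifPn => fa; first exact: (far_start_solution ad af im hxs hys (scT0 t) ce fa).
have fa' : far (Ts t) ya yh.
  apply: (far_perturbed_of_start (scale_ge1 (scT0 t)) fa).
  rewrite pwN -[leRHS]invrK lef_pV2 ?posrE ?pw_gt0 ?invr_gt0 //.
  apply: le_pw_stage; lra.
rewrite fa'.
apply: (far_perturbed_solution ad af im hxs hys (scT0 s) (scT0 t) _ pe ce fa').
by rewrite /stage_scale ler_nat leq_add2l ltnW.
Qed.

Lemma early_certified_run s xh yh : certified d ax ay r F h (Ts s) xh yh ->
  solution (run O (if far (Ts s) (y0 d) yh then Output xh yh
      else ystep d ay xh (y0 d) (fun ya => if ya == y0 d then Output xh yh
        else search (late_body T0 ya) (late_fuel D ya) s.+1))).
Proof.
move=> ce; have [[Qxh _] _ _ _ _] := certified_facts ad af im hxs hys (scT0 s) ce.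
case: ifPn => fa; first exact: (far_start_solution ad af im hxs hys (scT0 s) ce fa).
apply: (hoare_run (ystep_correct ad af im Qxh (y0_in ad))) => ya hya.
case: eqP => [ya0|/eqP ya0].
  rewrite ya0 in hya.
  exact: (fixed_start_solution ad af im hxs hys (scT0 s) ce hya).
apply: late_run => //; last exact: leq_addl.
exact: (perturbed_of_near ad af im hxs hys (scT0 s) ce fa hya).
Qed.

Lemma main_run : solution (run O (main_method T0 D)).
Proof.
apply: (search_run (P := fun M => solution (run O M)) (smax := (Num.truncn D).+1)) => //.
  move=> t M _ PM; rewrite /early_body.
  apply: (hoare_run (stage_sound ad af im (Ts t))) => -[[xh yh]|] //= ce.
  exact: early_certified_run.
move=> t M _ smt; rewrite /early_body.
have hDt : D <= t%:R.
  by apply: ltW; apply: lt_le_trans (truncnS_gt _) _; rewrite ler_nat.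
apply: (hoare_run (stage_solves hDt)) => _ [[xh yh] -> ce] /=.
exact: early_certified_run.
Qed.

(** The late search continues the stage index of the early one, so no index is visited twice. At
    [s1] the certified [yh] is far from [y0], whether or not a point [ya] has been fixed, so either
    search ends there. *)
Lemma main_calls s1 o cm : Rx d xs <= pw (Ts s1) 1 -> Ry d ys <= pw (Ts s1) 1 ->
  pw (Ts s1) (-1) <= Ry d ys ->
  (forall t, (t <= s1)%N ->
     (stage_cost d ax ay (Ts t) o + ystep_cost d ay o <= cm)%N) ->
  (calls O o (main_method T0 D) <= s1.+1 * cm)%N.
Proof.
move=> Rx1 Ry1 Ry2 hcm.
have hst t : (t <= s1)%N -> (stage_cost d ax ay (Ts t) o <= cm)%N.
  by move=> ts; apply: leq_trans (hcm t ts); exact: leq_addr.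
have last_stage K : (forall xh yh, far (Ts s1) (y0 d) yh ->
    calls O o (K (Some (xh, yh))) = 0%N) ->
    (calls O o (stage d ax ay (Ts s1) K) <= cm)%N.
  move=> hK; apply: leq_trans (hst s1 (leqnn _)); rewrite -[leqRHS]addn0.
  apply: (hoare_calls (stage_complete ad af im hxs hys (scT0 s1) Rx1 Ry1)).
  move=> _ [[xh yh] -> ce]; rewrite hK //.
  exact: (far_start_of_Ry ad af im hxs hys (scT0 s1) ce Ry2).
have late_calls ya fuel s : (s <= s1)%N ->
    (calls O o (search (late_body T0 ya) fuel s) <= (s1 - s).+1 * cm)%N.
  move=> ss1; apply: search_calls => //.
    move=> t M _ ts1 hM; rewrite mulSn; apply: leq_trans (leq_add (hst t (ltnW ts1)) hM).
    apply: (hoare_calls (stage_sound ad af im (Ts t))) => -[[xh yh]|] //= _.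
    by case: ifP => //; case: ifP.
  by move=> M; apply: last_stage => xh yh /= ->.
suff : (calls O o (main_method T0 D) <= (s1 - 0).+1 * cm)%N by rewrite subn0.
apply: search_calls => //.
  move=> t M _ ts1 hM; rewrite mulSn.
  apply: leq_trans (leq_add (hcm t (ltnW ts1)) (leqnn _)); rewrite -addnA.
  apply: (hoare_calls (stage_sound ad af im (Ts t))) => -[[xh yh]|] //= ce.
    case: ifP => // _.
    have [[Qxh _] _ _ _ _] := certified_facts ad af im hxs hys (scT0 t) ce.
    apply: (hoare_calls (ystep_correct ad af im Qxh (y0_in ad))) => ya _.
    case: ifP => // _; apply: leq_trans (late_calls ya (late_fuel D ya) _ ts1) _.
    by rewrite -subSn // subSS.
  by apply: leq_trans hM _; exact: leq_addl.
by move=> M; apply: last_stage => xh yh /= ->.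
Qed.

End MainMethod.

(** * The logarithmic factor and the final count *)

Section Reachability.
Context {R : realType} {n m : nat} (d : data R n m) (ax ay : @access R).

(** The part of [log_factor] that is free of [Rx] and [Ry]: the method may start its stages at this
    scale, and the stage index makes up for the rest. *)
Definition known_log : R := 1 + `|ln (eps d)| + `|ln (mux d)| + `|ln (muy d)|
    + ln (1 + Lxx d + Lxy d + Lyy d + access_const ax + access_const ay).

Lemma le_expR_ln (x T : R) : 0 < x -> `|ln x| <= T ->
  x <= pw T 1 /\ pw T (-1) <= x.
Proof.
move=> x0 xT; have e : x = expR (ln x) by rewrite lnK // posrE.
rewrite {1 2}e /pw mul1r mulN1r !ler_expR.
by move: xT; rewrite ler_norml => /andP [? ?]; split; lra.
Qed.

Lemma known_log_scale (T : R) : admissible_data d -> 0 <= access_const ax ->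
  0 <= access_const ay -> known_log <= T -> scale_ok d ax ay T.
Proof.
move=> ad cx0 cy0.
have [[x1 y1] xy] := (Lxx_ge0 ad, Lyy_ge0 ad, Lxy_ge0 ad).
set S := 1 + Lxx d + Lxy d + Lyy d + access_const ax + access_const ay.
rewrite /known_log -/S => hT.
have S1 : 1 <= S by rewrite /S; lra.
have lS : 0 <= ln S by rewrite ln_ge0.
have e0 := normr_ge0 (ln (eps d)); have mx0 := normr_ge0 (ln (mux d)).
have my0 := normr_ge0 (ln (muy d)).
have ST : S <= pw T 1.
  by apply: (proj1 (le_expR_ln _ _)); [lra | rewrite ger0_norm //; lra].
have [e1 e2] : eps d <= pw T 1 /\ pw T (-1) <= eps d.
  by apply: le_expR_ln (eps_gt0 ad) _; lra.
have [mx1 mx2] : mux d <= pw T 1 /\ pw T (-1) <= mux d.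
  by apply: le_expR_ln (mux_gt0 ad) _; lra.
have [my1 my2] : muy d <= pw T 1 /\ pw T (-1) <= muy d.
  by apply: le_expR_ln (muy_gt0 ad) _; lra.
by split => //; move: ST; rewrite /S; lra.
Qed.

(** The last scale [T] and the number of stages [s1.+1] are each at most three times the logarithmic
    factor, and 243 is [3 * 3 ^+ 4]. *)
Definition call_constant : R := 243 * Kstage.

Lemma reachable_budget : admissible_data d -> 0 <= access_const ax ->
  0 <= access_const ay -> reachable call_constant 5 d ax ay (budget d ax ay).
Proof.
move=> ad cx0 cy0.
have [Dx hDx] := compact_bounded_dist (x0 d) (Qx_compact ad).
have [Dy hDy] := compact_bounded_dist (y0 d) (Qy_compact ad).
pose D := Num.max Dx Dy.
pose T0 := (Num.truncn known_log).+1.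
have kT0 : known_log <= T0%:R by exact: ltW (truncnS_gt _).
have sc s : scale_ok d ax ay (stage_scale T0 s).
  apply: known_log_scale => //; apply: le_trans kT0 _.
  by rewrite /stage_scale ler_nat leq_addr.
exists (main_method d ax ay T0 D) => r F h O xs ys af im hxs hys.
have RxD : Rx d xs <= D by rewrite /D le_max hDx //; case: hxs.
have RyD : Ry d ys <= D by rewrite /D le_max hDy ?orbT //; case: hys.
split; first exact: (main_run ad af im hxs hys sc RxD RyD).
move=> Ry0 o.
pose l := `|ln (Rx d xs)| + `|ln (Ry d ys)|.
(* At this stage [expR T] exceeds [Rx], [Ry] and [1 / Ry], so the search must end; the index exists
   for the count only and is unknown to the method. *)
pose s1 := (Num.truncn l).+1.
pose T := stage_scale T0 s1 : R.
have l0 : 0 <= l by rewrite addr_ge0.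
have ls1 : l <= s1%:R by exact: ltW (truncnS_gt _).
have lT : l <= T by apply: le_trans ls1 (stage_scale_ge _ _).
have T1 := scale_ge1 (sc s1); rewrite -/T in T1.
have Rx1 : Rx d xs <= pw T 1.
  (* Since [ln 0 = 0], the logarithm says nothing about [Rx = 0]; only an upper bound on [Rx] is
     wanted, and it is trivial there. *)
  have [->|x0] := eqVneq (Rx d xs) 0; first exact: pw_ge0.
  have xp : 0 < Rx d xs by rewrite lt_neqAle eq_sym x0 enorm_ge0.
  by have [] := le_expR_ln xp (T := T); first by apply: le_trans lT; rewrite /l lerDl.
have [Ry1 Ry2] : Ry d ys <= pw T 1 /\ pw T (-1) <= Ry d ys.
  by apply: le_expR_ln Ry0 _; apply: le_trans lT; rewrite /l lerDr.
have b0 := budget_ge0 d ax ay o.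
have KI0 : 0 <= Kinner :> R by rewrite /Kinner !mulr_ge0 ?exprn_ge0 //; lra.
have KO0 : 0 <= Kouter :> R by rewrite /Kouter !mulr_ge0 //; lra.
have K0 : 0 <= Kstage :> R.
  by rewrite /Kstage; have := mulr_ge0 KO0 KI0; lra.
pose cm := Num.truncn (Kstage * T ^+ 4 * budget d ax ay o).
have cm0 : 0 <= Kstage * T ^+ 4 * budget d ax ay o.
  by rewrite !mulr_ge0 // exprn_ge0 //; lra.
have hcm t : (t <= s1)%N -> (stage_cost d ax ay (stage_scale T0 t) o + ystep_cost d ay o <= cm)%N.
  move=> ts; rewrite truncn_ge_nat //.
  apply: le_trans (stage_budget ad o (sc t)) _.
  rewrite ler_wpM2r // ler_wpM2l // lerXn2r ?nnegrE ?ler0n //.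
  by rewrite /T /stage_scale ler_nat leq_add2l.
have := main_calls ad af im hxs hys D sc Rx1 Ry1 Ry2 hcm.
rewrite -(ler_nat R) => /le_trans; apply; rewrite natrM.
have cmb : cm%:R <= Kstage * T ^+ 4 * budget d ax ay o by rewrite truncn_le.
set LF := log_factor _ _ _ _ _.
have eLF : LF = known_log + l by rewrite /LF /log_factor /known_log /l; ring.
have kl1 : 1 <= known_log.
  rewrite /known_log.
  have lS : 0 <= ln (1 + Lxx d + Lxy d + Lyy d + access_const ax + access_const ay).
    rewrite ln_ge0 //.
    have := Lxx_ge0 ad; have := Lyy_ge0 ad; have := Lxy_ge0 ad; lra.
  have := normr_ge0 (ln (eps d)); have := normr_ge0 (ln (mux d)).
  have := normr_ge0 (ln (muy d)); lra.
have kl0 : 0 <= known_log by lra.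
have T0k : T0%:R <= known_log + 1.
  by rewrite /T0 -natr1 lerD2r truncn_le.
have s1l : s1%:R <= l + 1 by rewrite /s1 -natr1 lerD2r truncn_le.
have TLF : T <= 3 * LF by rewrite /T /stage_scale natrD eLF; lra.
have sLF : s1.+1%:R <= 3 * LF by rewrite -natr1 eLF; lra.
have LF0 : 0 <= LF by rewrite eLF; lra.
have T4 : T ^+ 4 <= 81 * LF ^+ 4.
  have -> : 81 * LF ^+ 4 = (3 * LF) ^+ 4 by ring.
  by rewrite lerXn2r ?nnegrE //; lra.
have -> : call_constant * budget d ax ay o * LF ^+ 5 =
  3 * LF * (Kstage * (81 * LF ^+ 4) * budget d ax ay o).
  by rewrite /call_constant; ring.
apply: ler_pM => //; apply: le_trans cmb _.
by rewrite ler_wpM2r // ler_wpM2l.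
Qed.

End Reachability.

Lemma reachable_eq (R : realType) (n m : nat) (C : R) p (d : data R n m) ax ay N N' :
  (forall o, N o = N' o) -> reachable C p d ax ay N -> reachable C p d ax ay N'.
Proof. by move=> /funext ->. Qed.

Theorem mainTheorem1 (R : realType) :
  (exists (C : R) (p : nat),
     forall (n m : nat) (d : data R n m) (Lx : R),
       admissible_data d -> 0 <= Lx ->
       reachable C p d (Grad Lx) Prox
         (fun o => match o with
          | GradR => Num.sqrt (Lx / mux d)
          | GradFx => count1 d
          | GradFy => count2 d
          | ProxH => count2 d
          | ProxR | GradH => 0
          end))
  /\
  (exists (C : R) (p : nat),
     forall (n m : nat) (d : data R n m) (Ly : R),
       admissible_data d -> 0 <= Ly ->
       reachable C p d Prox (Grad Ly)
         (fun o => match o with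
          | GradFx => count1 d
          | ProxR => count1 d
          | GradH => count3 d Ly
          | GradFy => count2 d
          | GradR | ProxH => 0
          end))
  /\
  (exists (C : R) (p : nat),
     forall (n m : nat) (d : data R n m) (Lx Ly : R),
       admissible_data d -> 0 <= Lx -> 0 <= Ly ->
       reachable C p d (Grad Lx) (Grad Ly)
         (fun o => match o with
          | GradR => Num.sqrt (Lx / mux d)
          | GradFx => count1 d
          | GradH => count3 d Ly
          | GradFy => count2 d
          | ProxR | ProxH => 0
          end)).
Proof.
split; [|split]; exists call_constant, 5%N => n m d.
- move=> Lx ad Lx0; apply: reachable_eq (reachable_budget ad _ _) => //=; by case.
- move=> Ly ad Ly0; apply: reachable_eq (reachable_budget ad _ _) => //=; by case.
- move=> Lx Ly ad Lx0 Ly0; apply: reachable_eq (reachable_budget ad _ _) => //=; by case.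
Qed.
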